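(* Let $X(K,U)$ be an Oeljeklaus-Toma manifold, where $K$ is a number field with exactly $s\ge 1$ real embeddings and $2t\ge 2$ non-real complex embeddings. Let $\mathcal{A}(U)$ be the set of isomorphism classes of flat complex line bundles over $X(K,U)$ given by homomorphisms $\rho\in\mathrm{Hom}(U,\mathbb{C}^{*})$, each regarded as a holomorphic line bundle. Then for any integers $p,q$, $$\dim\Big(\bigwedge^{p}\mathbb{C}^{s+t}\otimes\bigwedge^{q}\mathbb{C}^{s+t}\Big)=\sum_{E\in\mathcal{A}(U)}\dim H^{p,q}(X(K,U),E).$$
   Context: OT-manifolds. Let $s,t$ be positive integers and $K$ an extension field of $\mathbb{Q}$ of degree $s+2t$ with embeddings $\sigma_1,\dots,\sigma_{s+2t}$ into $\mathbb{C}$, where $\sigma_1,\dots,\sigma_s$ are real and $\sigma_{s+1},\dots,\sigma_{s+2t}$ are non-real with $\sigma_{s+i}=\overline{\sigma_{s+t+i}}$ for $1\le i\le t$. Let $\mathcal{O}_K$ be the ring of integers, $\mathcal{O}_K^{*}$ its unit group and $\mathcal{O}_K^{*,+}=\{a\in\mathcal{O}_K^{*}:\sigma_i(a)>0 \text{ for } 1\le i\le s\}$. Let $U\subset\mathcal{O}_K^{*,+}$ be a free abelian subgroup of rank $s$ such that $\{(\log\sigma_1(u),\dots,\log\sigma_s(u)):u\in U\}$ is a lattice in $\mathbb{R}^{s}$. With $H=\{z\in\mathbb{C}:\mathrm{Im}\,z>0\}$, the group $U\ltimes\mathcal{O}_K$ acts on $H^{s}\times\mathbb{C}^{t}$ by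 $(a,b)\cdot(w_1,\dots,w_s,z_1,\dots,z_t)=(\sigma_1(a)w_1+\sigma_1(b),\dots,\sigma_s(a)w_s+\sigma_s(b),\sigma_{s+1}(a)z_1+\sigma_{s+1}(b),\dots,\sigma_{s+t}(a)z_t+\sigma_{s+t}(b))$. The quotient $X(K,U)=(U\ltimes\mathcal{O}_K)\backslash(H^{s}\times\mathbb{C}^{t})$ is a compact complex manifold of dimension $s+t$, called an Oeljeklaus-Toma (OT) manifold; its fundamental group is $U\ltimes\mathcal{O}_K$. Flat line bundles. A homomorphism $\rho\in\mathrm{Hom}(U,\mathbb{C}^{*})$ is regarded as a character of $U\ltimes\mathcal{O}_K$ via the projection to $U$, and gives the flat line bundle $E_\rho=(U\ltimes\mathcal{O}_K)\backslash\big((H^{s}\times\mathbb{C}^{t})\times\mathbb{C}\big)$ for the action $\gamma\cdot(x,c)=(\gamma x,\rho(\gamma)c)$. In this way $\mathcal{A}(U)$ is identified with $\mathrm{Hom}(U,\mathbb{C}^{*})$. $H^{p,q}(X(K,U),E)=H^{q}(X(K,U),\Omega^{p}(E))$ denotes Dolbeault cohomology with values in the holomorphic line bundle $E$. The sum over the (infinite) set $\mathcal{A}(U)$ means the dimension of the direct sum of the spaces; in particular only finitely many terms are non-zero. *)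

(* Defs.v *)
From HB Require Import structures.
From mathcomp Require Import all_boot all_order all_algebra all_fingroup all_field.
From mathcomp Require Import all_classical all_reals all_analysis.
From mathcomp Require Import complex.
Set Implicit Arguments.
Unset Strict Implicit.
Unset Printing Implicit Defensive.
Import Order.TTheory GRing.Theory Num.Theory.
Import numFieldNormedType.Exports.

Local Open Scope classical_set_scope.
Local Open Scope ring_scope.
Local Open Scope complex_scope.

(* dim (Z / (B `&` Z)) in [0, +oo], for linear subspaces Z and B of V: the
   supremum of the sizes of the families of Z linearly independent modulo B. *)
Definition dim_mod (R : realType) (V : lmodType R[i]) (Z B : set V) : \bar R :=
  ereal_sup [set (n%:R)%:E | n in [set n : nat |
    exists v : 'I_n -> V, (forall i, Z (v i)) /\
      (forall c : 'I_n -> R[i],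
         B (\sum_(i < n) c i *: v i) -> forall i, c i = 0)]].

Definition vdim (R : realType) (V : lmodType R[i]) (Z : set V) : \bar R :=
  dim_mod Z [set 0].

(* The k-th exterior power of C^n, as the space of antisymmetric tensors in the
   k-th tensor power of C^n; it is 0 for k < 0. *)
Definition ext_power (R : realType) (n : nat) (k : int) :
    set ({ffun 'I_(`|k|%N) -> 'I_n} -> R[i]) :=
  [set T | (forall (f : {ffun 'I_(`|k|%N) -> 'I_n}) (g : 'S_(`|k|%N)),
              T [ffun a => f (g a)] = (-1) ^+ (odd_perm g) * T f) /\
           (k < 0 -> T = 0)].

Arguments ext_power R n k : clear implicits.

(* A (x) B inside C^X (x) C^Y = C^(X * Y) (X and Y finite). *)
Definition tensor (R : realType) (X Y : finType)
    (A : set (X -> R[i])) (B : set (Y -> R[i])) : set (X * Y -> R[i]) :=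
  [set h | exists (m : nat) (a : 'I_m -> X -> R[i]) (b : 'I_m -> Y -> R[i]),
     (forall i, A (a i) /\ B (b i)) /\
     (forall z, h z = \sum_(i < m) a i z.1 * b i z.2)].

Definition is_enum_embeddings (R : realType) (K : fieldExtType rat) (s t : nat)
    (sigma : 'I_(s + t + t) -> {rmorphism K -> R[i]}) : Prop :=
  [/\ forall f : {rmorphism K -> R[i]}, exists! i, f =1 sigma i,
      forall (i : 'I_s) (x : K), complex.Im (sigma (lshift t (lshift t i)) x) = 0,
      forall i : 'I_(s + t + t), (s <= i)%N ->
        exists x : K, complex.Im (sigma i x) != 0 &
      forall (i : 'I_t) (x : K),
        sigma (lshift t (rshift s i)) x = conjc (sigma (rshift (s + t) i) x)].

Definition ring_of_integers (K : fieldExtType rat) : set K :=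
  [set x | integralOver (intr : int -> K) x].

Definition pos_units (R : realType) (K : fieldExtType rat) (s t : nat)
    (sigma : 'I_(s + t + t) -> {rmorphism K -> R[i]}) : set K :=
  [set a | [/\ a != 0, ring_of_integers a, ring_of_integers a^-1 &
     forall i : 'I_s, 0 < sigma (lshift t (lshift t i)) a]].

Definition is_lattice (R : realType) (s : nat) (L : set 'rV[R]_s) : Prop :=
  exists2 B : 'M[R]_s, B \in unitmx &
    L = [set map_mx intr m *m B | m in [set: 'rV[int]_s]].

Definition log_embedding (R : realType) (K : fieldExtType rat) (s t : nat)
    (sigma : 'I_(s + t + t) -> {rmorphism K -> R[i]}) (a : K) : 'rV[R]_s :=
  \row_i ln (complex.Re (sigma (lshift t (lshift t i)) a)).

Definition admissible (R : realType) (K : fieldExtType rat) (s t : nat)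
    (sigma : 'I_(s + t + t) -> {rmorphism K -> R[i]}) (U : set K) : Prop :=
  [/\ U `<=` pos_units sigma,
      [/\ U 1, (forall a b, U a -> U b -> U (a * b)) & forall a, U a -> U a^-1],
      (exists2 e : 'I_s -> K, forall i, U (e i) &
         forall a, U a -> exists! m : {ffun 'I_s -> int}, a = \prod_i e i ^ m i) &
      is_lattice [set log_embedding sigma u | u in U]].

(* Hom(U, C^x), C^x being the group of non-zero complex numbers. *)
Definition characters (R : realType) (K : fieldExtType rat) (U : set K) :
    set (set_type U -> R[i]) :=
  [set rho | (forall u, rho u != 0) /\
     (forall u v w : set_type U, val w = val u * val v -> rho w = rho u * rho v)].

Arguments characters R {K} U.

(* C^n as R^n * R^n: the pair (x, y) is the point x + i y. *)
Notation Cn R n := ('rV[R]_n * 'rV[R]_n)%type.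

Definition zcoord (R : realType) (n : nat) (x : Cn R n) (k : 'I_n) : R[i] :=
  x.1 0 k +i* x.2 0 k.

(* H^s * C^t *)
Definition HsCt (R : realType) (s t : nat) : set (Cn R (s + t)) :=
  [set x | forall i : 'I_s, 0 < complex.Im (zcoord x (lshift t i))].

Arguments HsCt R s t : clear implicits.

Definition act (R : realType) (K : fieldExtType rat) (s t : nat)
    (sigma : 'I_(s + t + t) -> {rmorphism K -> R[i]}) (a b : K)
    (x : Cn R (s + t)) : Cn R (s + t) :=
  let z k := sigma (lshift t k) a * zcoord x k + sigma (lshift t k) b in
  (\row_k complex.Re (z k), \row_k complex.Im (z k)).

Fixpoint Ck (R : realType) (V : normedModType R) (D : set V) (k : nat)
    (f : V -> R) : Prop :=
  (forall x, D x -> {for x, continuous f}) /\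
  match k with
  | 0%N => True
  | k'.+1 => forall v : V,
      (forall x, D x -> derivable f x v) /\ Ck D k' (fun x => 'D_v f x)
  end.

Definition smooth (R : realType) (V : normedModType R) (D : set V)
    (f : V -> R[i]) : Prop :=
  forall k, Ck D k (fun x => complex.Re (f x)) /\
            Ck D k (fun x => complex.Im (f x)).

Definition deriveC (R : realType) (V : normedModType R) (v : V) (f : V -> R[i])
    (x : V) : R[i] :=
  'D_v (fun y => complex.Re (f y)) x +i* 'D_v (fun y => complex.Im (f y)) x.

(* d/d(zbar_j) = (d/dx_j + i d/dy_j) / 2 *)
Definition dzbar (R : realType) (n : nat) (j : 'I_n) (f : Cn R n -> R[i])
    (x : Cn R n) : R[i] :=
  (deriveC ((delta_mx 0 j, 0) : Cn R n) f x +
   (0 +i* 1) * deriveC ((0, delta_mx 0 j) : Cn R n) f x) / 2%:R.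

(* omega stands for the form
     \sum_(I, J) omega x I J dz_I /\ dzbar_J,
   dz_I and dzbar_J being the wedge products in increasing order of indices. *)
Notation cform R n := (Cn R n -> {set 'I_n} -> {set 'I_n} -> R[i]).

(* dzbar_j /\ dz_I /\ dzbar_(J \ j) is (-1)^(#|I| + #|{k in J | k < j}|)
   times dz_I /\ dzbar_J. *)
Definition dbar (R : realType) (n : nat) (omega : cform R n) : cform R n :=
  fun x I J => (-1) ^+ #|I| *
    \sum_(j in J) (-1) ^+ #|[set k in J | (k < j)%N]|%SET *
      dzbar j (fun y => omega y I (J :\ j)%SET) x.

(* Smooth (p,q)-forms on X(K,U) with values in E_rho, i.e. smooth (p,q)-forms
   omega on H^s * C^t such that gamma^* omega = rho(gamma) omega for all gamma
   in U |x O_K.  The values of omega outside of H^s * C^t are irrelevant. *)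
Definition is_form (R : realType) (K : fieldExtType rat) (s t : nat)
    (sigma : 'I_(s + t + t) -> {rmorphism K -> R[i]}) (U : set K)
    (rho : set_type U -> R[i]) (p q : int) (omega : cform R (s + t)) : Prop :=
  [/\ forall I J, smooth (HsCt R s t) (fun x => omega x I J),
      forall x I J, HsCt R s t x -> omega x I J != 0 -> #|I|%:Z = p /\ #|J|%:Z = q &
      forall (u : set_type U) (b : K) x I J, ring_of_integers b -> HsCt R s t x ->
        omega (act sigma (val u) b x) I J *
          (\prod_(i in I) sigma (lshift t i) (val u)) *
          (\prod_(j in J) conjc (sigma (lshift t j) (val u)))
        = rho u * omega x I J].

Definition closed_forms (R : realType) (K : fieldExtType rat) (s t : nat)
    (sigma : 'I_(s + t + t) -> {rmorphism K -> R[i]}) (U : set K)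
    (rho : set_type U -> R[i]) (p q : int) : set (cform R (s + t)) :=
  [set omega | is_form sigma rho p q omega /\
     forall x, HsCt R s t x -> dbar omega x = 0].

(* All forms vanishing on H^s * C^t belong to this set, so that forms equal on
   H^s * C^t are identified in the quotient below. *)
Definition exact_forms (R : realType) (K : fieldExtType rat) (s t : nat)
    (sigma : 'I_(s + t + t) -> {rmorphism K -> R[i]}) (U : set K)
    (rho : set_type U -> R[i]) (p q : int) : set (cform R (s + t)) :=
  [set omega | exists2 eta, is_form sigma rho p (q - 1) eta &
     forall x, HsCt R s t x -> omega x = dbar eta x].

(* dim H^{p,q}(X(K,U), E_rho) *)
Definition dim_dolbeault (R : realType) (K : fieldExtType rat) (s t : nat)
    (sigma : 'I_(s + t + t) -> {rmorphism K -> R[i]}) (U : set K)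
    (p q : int) (rho : set_type U -> R[i]) : \bar R :=
  dim_mod (closed_forms sigma rho p q) (exact_forms sigma rho p q).

(* Main.v *)
(* On H^s put Im w_j = e^(lambda_j), and take the coefficients of forms in the
   frame where dwbar_j is divided by Im w_j.  They become functions on
   R^(2(s+t)) which are invariant under the translations by O_K and multiplied
   by rho / chi_IJ under U, where chi_IJ(u) is the product of the sigma_i(u) for
   i in I and of the conjugates of sigma_j(u) for the non-real places j in J,
   while dbar becomes the Koszul differential of operators theta_j.

   On the tori given by O_K, the operator theta_l at one non-real place l is
   inverted, up to the mean, by Fourier series: its symbol at a non-zero
   frequency is a factor of a norm form, whose values are rational numbers with
   bounded denominator, so it is bounded below by an inverse power of the
   frequency.  The Koszul homotopy along theta_l then makes every closed form
   cohomologous to one depending on lambda only.  The same homotopy along each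
   generator of the lattice log U leaves only constants, and these only where
   chi_IJ = rho; averages show that such constants are not exact.  Hence
   dim H^(p,q)(X, E_rho) is the number of pairs (I, J) with |I| = p, |J| = q and
   chi_IJ = rho, and the sum over rho is the number of all pairs (I, J).

   Means, Fourier coefficients and inverse operators are limits of finite
   combinations of translations, so no integration theory is involved: such
   limits commute with derivatives, translations and multiplication by invariant
   functions. *)
Require Import Defs.
From HB Require Import structures.
From mathcomp Require Import all_boot all_order all_algebra all_fingroup all_field.
From mathcomp Require Import all_classical all_reals all_analysis.
From mathcomp Require Import complex.
From mathcomp Require Import ring lra zify.
Set Implicit Arguments.
Unset Strict Implicit.
Unset Printing Implicit Defensive.
Import Order.TTheory GRing.Theory Num.Theory.
Import numFieldNormedType.Exports.
Local Open Scope classical_set_scope.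
Local Open Scope ring_scope.

(** * Directional derivatives *)

(** The inverse of [theta l] must respect all the other structure. It is built inside the class
    [regop flat_dir] of operators commuting with derivatives, with translations and with
    multiplication by functions of lambda. The variable coefficients of every [theta j] are
    functions of lambda, so such an operator commutes with all the [theta j], as the Koszul homotopy
    requires. Small divisors are treated algebraically. The inverse of the symbol at one embedding
    is the product of the symbols at all the others divided by the norm form: the loss of
    derivatives becomes an explicit differential operator, followed by a bounded multiplier. Further
    factors 1 + (2 pi k)^2 make the multiplier absolutely summable. A non-real place is chosen
    because [theta l] has constant coefficients there and kills the functions of lambda, which are
    what the mean produces. The inverse depends on a choice of basis and is not visibly compatible
    with U, which does not act by translations. Its equivariance comes from uniqueness: a function
    killed by [theta l] and of mean zero vanishes. *)

Section Directional.
Context {R : realType} {V : normedModType R}.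
Implicit Types (f g : V -> R) (x v w : V).

(** Bounding the remainder by e |h| avoids quotients and the exclusion of h = 0, so the estimates
    below can be added term by term. *)
Lemma is_derive_epsP f x v (l : R) :
  is_derive x v f l <->
  (forall e : R, 0 < e -> exists2 d : R, 0 < d &
     forall h : R, `|h| < d -> `|f (x + h *: v) - f x - h * l| <= e * `|h|).
Proof.
split.
- move=> [df dl] e e0; rewrite -dl.
  have /derivable_nbhs := df.
  move=> /eqaddoP /(_ e e0)/= /nbhs_ballP[d /= d0 H]; exists d => // h hd.
  have := H h; rewrite /= -ball_normE/= sub0r normrN => /(_ hd).
  rewrite -[X in `|X| <= _]/(f (h *: v + x) - (f x + h * 'D_v f x)).
  by rewrite opprD addrA [h *: v + x]addrC.
- move=> H.
  have cv : ((fun h => h^-1 *: ((f \o shift x) (h *: v) - f x)) @ 0^') --> l.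
    apply/cvgrPdist_le => e e0; have [d d0 Hd] := H e e0.
    near=> h.
    have h0 : h != 0 by near: h; exact: nbhs_dnbhs_neq.
    have hd : `|h| < d.
      near: h; apply: (@nbhs_dnbhs _ (0 : R)).
      by apply/nbhs_ballP; exists d => //= y; rewrite -ball_normE/= sub0r normrN.
    have := Hd h hd => /= Hh.
    rewrite distrC -(ler_pM2r (_ : 0 < `|h|)) ?normr_gt0// -normrM.
    rewrite mulrBl [_ *: _]mulrC mulfVK// [h *: v + x]addrC.
    by rewrite [l * h]mulrC.
  by split; [apply/cvg_ex; exists l|apply: cvg_lim].
Unshelve. all: by end_near. Qed.

Lemma continuous_epsP f x :
  {for x, continuous f} <->
  (forall e : R, 0 < e -> exists2 d : R, 0 < d &
     forall y, `|y - x| < d -> `|f y - f x| <= e).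
Proof.
split.
- move=> /cvgrPdist_le H e e0; have /nbhs_ballP[d /= d0 Hd] := H e e0.
  exists d => // y yd; rewrite distrC; apply: Hd.
  by rewrite -ball_normE/= distrC.
- move=> H; apply/cvgrPdist_le => e e0; have [d d0 Hd] := H e e0.
  apply/nbhs_ballP; exists d => //= y; rewrite -ball_normE/= distrC => yd.
  by rewrite distrC; apply: Hd.
Qed.

Lemma is_derive_scale_dir f x v (a l : R) :
  is_derive x v f l -> is_derive x (a *: v) f (a * l).
Proof.
move=> /is_derive_epsP H; apply/is_derive_epsP => e e0.
have a1 : 0 < `|a| + 1 by rewrite ltr_wpDl.
have [d d0 Hd] := H (e / (`|a| + 1)) (divr_gt0 e0 a1).
exists (d / (`|a| + 1)); first exact: divr_gt0.
move=> h hd; rewrite scalerA mulrA.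
have hah : `|h * a| <= `|h| * (`|a| + 1).
  by rewrite normrM ler_wpM2l// lerDl.
apply: le_trans (Hd (h * a) _) _.
  by apply: le_lt_trans hah _; rewrite -ltr_pdivlMr.
by rewrite -mulrA ler_wpM2l ?(ltW e0)// mulrC ler_pdivrMr.
Qed.

Lemma is_derive_line f x v (r : R) : derivable f (x + r *: v) v ->
  is_derive r (1 : R) (fun t : R => f (x + t *: v)) ('D_v f (x + r *: v)).
Proof.
move=> /derivableP [df _].
have cv : (fun h : R => h^-1 *: ((f \o shift (x + r *: v)) (h *: v) - f (x + r *: v))) =
   (fun h : R => h^-1 *: (((fun t : R => f (x + t *: v)) \o shift r) (h *: (1 : R)) - f (x + r *: v))).
  by apply/funext => h /=; rewrite [h *: 1]mulr1 scalerDl addrCA.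
by split; rewrite /derivable /derive -cv.
Qed.

Lemma MVT_dir f x v :
  (forall r : R, 0 <= r <= 1 -> derivable f (x + r *: v) v) ->
  exists2 r : R, 0 <= r <= 1 & f (x + v) - f x = 'D_v f (x + r *: v).
Proof.
move=> H.
have H1 (r : R) : r \in `[0, 1]%R ->
    is_derive r (1 : R) (fun t : R => f (x + t *: v)) ('D_v f (x + r *: v)).
  by move=> r01; apply: is_derive_line; apply: H; rewrite in_itv/= in r01.
pose g (t : R) := f (x + t *: v); pose dg (r : R) := 'D_v f (x + r *: v).
have Hg : {within `[(0 : R), 1], continuous g}.
  by apply: derivable_within_continuous => r r01; have [] := H1 r r01.
have Hdg (r : R) : r \in `]0, 1[%R -> is_derive r (1 : R) g (dg r).
  by move=> r01; apply: H1; apply: subset_itv_oo_cc.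
have [r r01] := MVT_segment ler01 Hdg Hg.
rewrite in_itv/= in r01.
by rewrite /g /dg scale1r scale0r addr0 subr0 mulr1 => E; exists r.
Qed.

(** Directional derivatives need not be additive in the direction. Here the increment along [h *: v]
    starts from the moved point [x + h *: w]; the mean value theorem turns it into ['D_v f] at a
    nearby point, and continuity of ['D_v f] at [x] concludes. *)
Lemma is_derive_add_dir f x v w :
  (exists2 d : R, 0 < d & forall y, `|y - x| < d -> derivable f y v) ->
  {for x, continuous (fun y => 'D_v f y)} -> derivable f x w ->
  is_derive x (v + w) f ('D_v f x + 'D_w f x).
Proof.
move=> [d d0 Hd] /continuous_epsP cf /derivableP/is_derive_epsP dw.
apply/is_derive_epsP => e e0.
have e2 : 0 < e / 2 by rewrite divr_gt0.
have [d1 d10 H1] := cf _ e2; have [d2 d20 H2] := dw _ e2.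
pose m := Num.min d d1; have m0 : 0 < m by rewrite lt_min d0.
pose N := `|v| + `|w| + 1; have N0 : 0 < N by rewrite ltr_wpDl// addr_ge0.
exists (Num.min d2 (m / N)); first by rewrite lt_min d20 divr_gt0.
move=> h; rewrite lt_min => /andP[hd2 hm].
rewrite ltr_pdivlMr// in hm.
have near_pt (r : R) : 0 <= r <= 1 -> `|(x + h *: w + r *: (h *: v)) - x| < m.
  move=> /andP[r0 r1]; apply: le_lt_trans hm.
  have -> : x + h *: w + r *: (h *: v) - x = h *: w + r *: (h *: v).
    by rewrite addrC -addrA addKr.
  apply: le_trans (ler_normD _ _) _.
  rewrite !normrZ (ger0_norm r0) mulrCA -mulrDr ler_wpM2l//.
  by rewrite /N [`|v| + _]addrC -addrA lerD2l (le_trans (ler_piMl _ r1))// lerDl.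
have [|r r01] := @MVT_dir f (x + h *: w) (h *: v).
  move=> r /near_pt; rewrite lt_min => /andP[/Hd /derivableP D _].
  by have [] := is_derive_scale_dir h D.
have := near_pt r r01; rewrite lt_min => /andP[p1 p2].
have -> : 'D_(h *: v) f (x + h *: w + r *: (h *: v)) = h * 'D_v f (x + h *: w + r *: (h *: v)).
  by have /derivableP D := Hd _ p1; have [_ ->] := is_derive_scale_dir h D.
move=> E; rewrite scalerDr addrA addrAC.
have -> : f (x + h *: w + h *: v) - f x - h * ('D_v f x + 'D_w f x) =
   (f (x + h *: w + h *: v) - f (x + h *: w) - h * 'D_v f x) +
   (f (x + h *: w) - f x - h * 'D_w f x) by ring.
apply: le_trans (ler_normD _ _) _; rewrite [e]splitr mulrDl lerD//; last exact: H2.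
rewrite E -mulrBr normrM mulrC ler_wpM2r//.
exact: H1.
Qed.

(** The mean value theorem is applied to [F n] with n depending on h. This is allowed because the
    derivatives converge uniformly near [x], so that pointwise convergence of [F n] at the two end
    points, with precision proportional to |h|, is enough. *)
Lemma is_derive_limit (F : nat -> V -> R) (G G' : V -> R) x v (d : R) : 0 < d ->
  (forall n y, `|y - x| < d -> derivable (F n) y v) ->
  (forall y, `|y - x| < d -> forall e : R, 0 < e ->
     exists N, forall n, (N <= n)%N -> `|F n y - G y| <= e) ->
  (forall e : R, 0 < e -> exists N, forall n, (N <= n)%N ->
     forall y, `|y - x| < d -> `|'D_v (F n) y - G' y| <= e) ->
  {for x, continuous G'} -> is_derive x v G (G' x).
Proof.
move=> d0 dF cF cF' /continuous_epsP cG'.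
apply/is_derive_epsP => e e0.
have e4 : 0 < e / 4 by rewrite divr_gt0.
have [d1 d10 H1] := cG' _ e4.
pose m := Num.min d d1; have m0 : 0 < m by rewrite lt_min d0.
have N0 : 0 < `|v| + 1 by rewrite ltr_wpDl.
exists (m / (`|v| + 1)); first exact: divr_gt0.
move=> h; rewrite ltr_pdivlMr// => hm.
have near_pt (r : R) : 0 <= r <= 1 -> `|(x + r *: (h *: v)) - x| < m.
  move=> /andP[r0 r1]; apply: le_lt_trans hm.
  rewrite addrC addKr !normrZ ger0_norm// mulrCA ler_wpM2l//.
  by rewrite (le_trans (ler_piMl _ r1))// lerDl.
have [->|h0] := eqVneq h 0.
  by rewrite scale0r addr0 subrr mul0r subr0 normr0 mulr0.
have eh : 0 < e / 4 * `|h| by rewrite mulr_gt0// normr_gt0.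
have x1 : `|x + h *: v - x| < d.
  by have := near_pt 1; rewrite scale1r lt_min ler01 lexx => /(_ isT)/andP[].
have x0 : `|x - x| < d by rewrite subrr normr0.
have [N1 HN1] := cF _ x1 _ eh; have [N2 HN2] := cF _ x0 _ eh.
have [N3 HN3] := cF' _ e4.
pose n := maxn N1 (maxn N2 N3).
have {}HN1 := HN1 n (leq_maxl _ _).
have {}HN2 := HN2 n (leq_trans (leq_maxl _ _) (leq_maxr _ _)).
have {}HN3 := HN3 n (leq_trans (leq_maxr _ _) (leq_maxr _ _)).
have [|r r01 E] := @MVT_dir (F n) x (h *: v).
  move=> r /near_pt; rewrite lt_min => /andP[/(dF n) /derivableP D _].
  by have [] := is_derive_scale_dir h D.
have := near_pt r r01; rewrite lt_min => /andP[p1 p2].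
move: E; have -> : 'D_(h *: v) (F n) (x + r *: (h *: v)) = h * 'D_v (F n) (x + r *: (h *: v)).
  by have /derivableP D := dF n _ p1; have [_ ->] := is_derive_scale_dir h D.
move=> E.
have -> : G (x + h *: v) - G x - h * G' x =
   - (F n (x + h *: v) - G (x + h *: v)) + (F n x - G x) +
   (h * ('D_v (F n) (x + r *: (h *: v)) - G' (x + r *: (h *: v)))) +
   h * (G' (x + r *: (h *: v)) - G' x).
  rewrite !mulrBr -E; ring.
have -> : e * `|h| = e / 4 * `|h| + e / 4 * `|h| + e / 4 * `|h| + e / 4 * `|h|.
  by field.
apply: le_trans (ler_normD _ _) _; apply: lerD.
  apply: le_trans (ler_normD _ _) _; apply: lerD.
    by apply: le_trans (ler_normD _ _) _; apply: lerD => //; rewrite normrN.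
  by rewrite normrM mulrC ler_wpM2r//; apply: HN3.
by rewrite normrM mulrC ler_wpM2r//; apply: H1.
Qed.

End Directional.

(** * Functions of class C^k *)

Section CkTheory.
Context {R : realType} {V : normedModType R}.
Implicit Types (D : set V) (f g : V -> R) (x v w : V) (k : nat).

Lemma Ck_continuous D k f x : Ck D k f -> D x -> {for x, continuous f}.
Proof. by case: k => [|k] [cf _]; apply: cf. Qed.

Lemma Ck_derivable D k f v x : Ck D k.+1 f -> D x -> derivable f x v.
Proof. by move=> [_ /(_ v)[df _]]; apply: df. Qed.

Lemma Ck_derive D k f v : Ck D k.+1 f -> Ck D k (fun x => 'D_v f x).
Proof. by move=> [_ /(_ v)[]]. Qed.

Lemma Ck_pred D k f : Ck D k.+1 f -> Ck D k f.
Proof.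
elim: k f => [f [? _]//|k IH f [cf df]]; split=> // v.
by have [dfv Cfv] := df v; split=> //; apply: IH.
Qed.

Lemma near_open D x (P : V -> Prop) : open D -> D x -> (forall y, D y -> P y) ->
  \forall y \near x, P y.
Proof. by move=> oD Dx H; apply: filterS (open_nbhs_nbhs (conj oD Dx)). Qed.

Lemma Ck_eq D k f g : open D -> (forall x, D x -> f x = g x) ->
  Ck D k f -> Ck D k g.
Proof.
move=> oD; elim: k f g => [|k IH] f g fg; case=> cf df; split=> //.
- move=> x Dx; have nfg : \forall y \near x, f y = g y by exact: near_open fg.
  have := cf x Dx; rewrite /prop_for /continuous_at -fg// => H.
  by apply: cvg_trans H; apply: near_eq_cvg; apply: filterS nfg => y ->.
- move=> x Dx; have nfg : \forall y \near x, f y = g y by exact: near_open fg.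
  have := cf x Dx; rewrite /prop_for /continuous_at -fg// => H.
  by apply: cvg_trans H; apply: near_eq_cvg; apply: filterS nfg => y ->.
- move=> v; have [dfv Cfv] := df v; split.
    move=> x Dx; have nfg : \forall y \near x, f y = g y by exact: near_open fg.
    exact: near_eq_derivable nfg (dfv x Dx).
  apply: IH Cfv => x Dx; apply: near_eq_derive; exact: near_open fg.
Qed.

Lemma Ck_cst D k (c : R) : open D -> Ck D k (fun=> c).
Proof.
move=> oD; elim: k c => [|k IH] c; split=> //.
- by move=> x _; apply: cst_continuous.
- by move=> x _; apply: cst_continuous.
- move=> v; split=> [x _|]; first exact: derivable_cst.
  by apply: Ck_eq (IH 0) => // x _; rewrite derive_cst.
Qed.

Lemma Ck_add D k f g : open D -> Ck D k f -> Ck D k g ->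
  Ck D k (fun x => f x + g x).
Proof.
move=> oD; elim: k f g => [|k IH] f g [cf df] [cg dg]; split=> //.
- by move=> x Dx; apply: cvgD; [exact: cf|exact: cg].
- by move=> x Dx; apply: cvgD; [exact: cf|exact: cg].
- move=> v; have [dfv Cf] := df v; have [dgv Cg] := dg v; split.
    by move=> x Dx; apply: derivableD; [exact: dfv|exact: dgv].
  apply: Ck_eq (IH _ _ Cf Cg) => // x Dx.
  by rewrite -deriveD; [|exact: dfv|exact: dgv].
Qed.

Lemma Ck_mul D k f g : open D -> Ck D k f -> Ck D k g ->
  Ck D k (fun x => f x * g x).
Proof.
move=> oD; elim: k f g => [|k IH] f g Cf Cg; split=> //.
- by move=> x Dx; apply: cvgM; [exact: Ck_continuous Cf Dx|exact: Ck_continuous Cg Dx].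
- by move=> x Dx; apply: cvgM; [exact: Ck_continuous Cf Dx|exact: Ck_continuous Cg Dx].
- move=> v; split.
    by move=> x Dx; apply: derivableM; [exact: Ck_derivable Cf Dx|exact: Ck_derivable Cg Dx].
  have := Ck_add oD (IH _ _ (Ck_pred Cf) (Ck_derive v Cg)) (IH _ _ (Ck_pred Cg) (Ck_derive v Cf)).
  apply: Ck_eq => // x Dx.
  exact: esym (deriveM (Ck_derivable (v:=v) Cf Dx) (Ck_derivable (v:=v) Cg Dx)).
Qed.

Lemma Ck_opp D k f : open D -> Ck D k f -> Ck D k (fun x => - f x).
Proof.
move=> oD Cf; apply: Ck_eq (Ck_mul oD (Ck_cst k (-1) oD) Cf) => // x _.
by rewrite mulN1r.
Qed.

Lemma Ck_sum D k (I : Type) (r : seq I) (F : I -> V -> R) : open D ->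
  (forall i, Ck D k (F i)) -> Ck D k (fun x => \sum_(i <- r) F i x).
Proof.
move=> oD CF; elim: r => [|i r IH].
  by apply: Ck_eq (Ck_cst k 0 oD) => // x _; rewrite big_nil.
by apply: Ck_eq (Ck_add oD (CF i) IH) => // x _; rewrite big_cons.
Qed.

(** This replaces an induction on the order for families whose derivatives keep the same shape:
    limits of operators, exponentials, composites with affine maps. *)
Lemma Ck_coind (P : (V -> R) -> Prop) k f :
  (forall f, P f -> (forall x, {for x, continuous f}) /\
     forall v, (forall x, derivable f x v) /\ P (fun x => 'D_v f x)) ->
  P f -> Ck setT k f.
Proof.
move=> H; elim: k f => [|k IH] f Pf; have [cf df] := H f Pf; split=> //.
by move=> v; have [d C] := df v; split=> //; apply: IH.
Qed.

End CkTheory.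

(** * Partial derivatives and coordinatewise changes of variables *)

Section Coordinates.
Context {R : realType} {n : nat}.
Local Notation V := (Cn R n).
Implicit Types (D : set V) (f g : V -> R) (x v w : V) (k : nat).

Definition bas (b : 'I_n + 'I_n) : V :=
  match b with inl k => (delta_mx 0 k, 0) | inr k => (0, delta_mx 0 k) end.

Definition crd (b : 'I_n + 'I_n) (x : V) : R :=
  match b with inl k => x.1 0 k | inr k => x.2 0 k end.

Lemma crdD b x y : crd b (x + y) = crd b x + crd b y.
Proof. by case: b => k; rewrite /crd mxE. Qed.

Lemma crdZ b (a : R) x : crd b (a *: x) = a * crd b x.
Proof. by case: b => k; rewrite /crd mxE. Qed.

Lemma crd_bas b b' : crd b (bas b') = (b == b')%:R.
Proof.
case: b b' => k [] k'; rewrite /crd/bas/= ?mxE ?eqxx//=.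
Qed.

Lemma crdP x y : (forall b, crd b x = crd b y) -> x = y.
Proof.
case: x y => [x1 x2] [y1 y2] H; congr (_, _); apply/rowP => k.
  exact: (H (inl k)).
exact: (H (inr k)).
Qed.

Lemma crd_sum b (I : Type) (r : seq I) (F : I -> V) :
  crd b (\sum_(i <- r) F i) = \sum_(i <- r) crd b (F i).
Proof.
elim: r => [|i r IH]; last by rewrite !big_cons crdD IH.
by rewrite !big_nil; case: b => k; rewrite /crd mxE.
Qed.

Lemma sum_crd x : x = \sum_b crd b x *: bas b.
Proof.
apply: crdP => b; rewrite crd_sum (bigD1 b)//= crdZ crd_bas eqxx mulr1.
rewrite big1 ?addr0// => b' bb'; rewrite crdZ crd_bas eq_sym (negbTE bb').
by rewrite mulr0.
Qed.

Lemma crd_continuous b : continuous (crd b).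
Proof.
case: b => k x.
- apply: (@continuous_comp _ _ _ fst (fun y : 'rV[R]_n => y 0 k)).
    exact: cvg_fst.
  exact: coord_continuous.
- apply: (@continuous_comp _ _ _ snd (fun y : 'rV[R]_n => y 0 k)).
    exact: cvg_snd.
  exact: coord_continuous.
Qed.

Lemma continuous_crd (T : topologicalType) (phi : T -> V) (t : T) :
  (forall b, {for t, continuous (fun u => crd b (phi u))}) ->
  {for t, continuous phi}.
Proof.
move=> H.
have -> : phi = (fun u => \sum_(b <- index_enum (('I_n + 'I_n)%type : finType)) crd b (phi u) *: bas b).
  by apply/funext => u; rewrite {1}(sum_crd (phi u)).
elim: (index_enum _) => [|b r IH].
  rewrite (_ : (fun=> _) = cst 0); last by apply/funext => u; rewrite big_nil.
  exact: cst_continuous.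
rewrite (_ : (fun=> _) = (fun u => crd b (phi u) *: bas b) \+
   (fun u => \sum_(b <- r) crd b (phi u) *: bas b)); last first.
  by apply/funext => u; rewrite big_cons.
apply: cvgD IH; apply: cvgZr_tmp; exact: H.
Qed.

Lemma is_derive_basis D k f x v : open D -> D x ->
  (forall b, (forall x, D x -> derivable f x (bas b)) /\
     Ck D k (fun x => 'D_(bas b) f x)) ->
  is_derive x v f (\sum_b crd b v * 'D_(bas b) f x).
Proof.
move=> oD Dx H; rewrite [in X in is_derive _ X](sum_crd v).
elim: (index_enum _) => [|b r IH].
  by rewrite !big_nil; apply: is_derive0.
rewrite !big_cons.
have dfb y : D y -> is_derive y (crd b v *: bas b) f (crd b v * 'D_(bas b) f y).
  by move=> Dy; apply: is_derive_scale_dir; apply/derivableP/(H b).1.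
have [_ <-] := dfb x Dx; have [dr <-] := IH.
apply: is_derive_add_dir; last exact: dr.
  have /nbhs_ballP[d /= d0 Hd] := open_nbhs_nbhs (conj oD Dx).
  exists d => // y yd; have Dy : D y by apply: Hd; rewrite -ball_normE/= distrC.
  by have [] := dfb y Dy.
have nfg : \forall y \near x, crd b v * 'D_(bas b) f y = 'D_(crd b v *: bas b) f y.
  by apply: (near_open oD Dx) => y0 /dfb[_ ->].
rewrite /prop_for /continuous_at /=. have [_ ->] := dfb x Dx.
apply: cvg_trans (_ : (fun y => crd b v * 'D_(bas b) f y) @ x --> _).
  by apply: near_eq_cvg; apply: filterS nfg.
apply: cvgM; first exact: cvg_cst.
exact: Ck_continuous (H b).2 Dx.
Qed.

(** [Ck] asks for derivatives in all directions. By [is_derive_basis] the one along [v] is a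
    combination of partial derivatives with constant coefficients [crd b v]. *)
Lemma Ck_basis D k f : open D -> (forall x, D x -> {for x, continuous f}) ->
  (forall b, (forall x, D x -> derivable f x (bas b)) /\
     Ck D k (fun x => 'D_(bas b) f x)) ->
  Ck D k.+1 f.
Proof.
move=> oD cf H; split=> // v; split.
  by move=> x Dx; have [] := is_derive_basis v oD Dx H.
have /= := @Ck_sum _ _ D k _ (index_enum (('I_n + 'I_n)%type : finType))
    (fun b x => crd b v * 'D_(bas b) f x) oD.
move=> /(_ (fun b => Ck_mul oD (Ck_cst _ _ oD) (H b).2)).
by apply: Ck_eq => // x Dx; have [_ ->] := is_derive_basis v oD Dx H.
Qed.

(* Coordinatewise maps are enough here, so that the chain rule only has to be
   applied along coordinate lines. *)
Section Coordinatewise.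
Variables (D D' : set V) (phi : V -> V) (psi dpsi : 'I_n + 'I_n -> R -> R).
Variable slope : 'I_n + 'I_n -> V -> R.
Hypotheses (oD : open D) (oD' : open D') (phiD : forall x, D x -> D' (phi x)).
Hypothesis crd_phi : forall b x, crd b (phi x) = psi b (crd b x).
Hypothesis dpsiP : forall b x, D x ->
  is_derive (crd b x) (1 : R) (psi b) (dpsi b (crd b x)).

Lemma phi_continuous x : D x -> {for x, continuous phi}.
Proof.
move=> Dx; apply: continuous_crd => b.
rewrite (_ : (fun x => crd b (phi x)) = psi b \o crd b); last first.
  by apply/funext => y; rewrite crd_phi.
apply: continuous_comp; first exact: crd_continuous.
apply/differentiable_continuous/derivable1_diffP.
by have [] := dpsiP b Dx.
Qed.

Lemma is_derive_coordinatewise b f x : D x -> derivable f (phi x) (bas b) ->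
  is_derive x (bas b) (f \o phi) (dpsi b (crd b x) * 'D_(bas b) f (phi x)).
Proof.
move=> Dx df.
pose g (t : R) := f (phi x + t *: bas b).
pose a (h : R) := psi b (crd b x + h) - psi b (crd b x).
have a0 : a 0 = 0 by rewrite /a addr0 subrr.
have dg : is_derive (0 : R) (1 : R) g ('D_(bas b) f (phi x)).
  have := @is_derive_line _ _ f (phi x) (bas b) 0.
  by rewrite scale0r addr0; apply.
have da : is_derive (0 : R) (1 : R) a (dpsi b (crd b x)).
  have /is_derive_epsP H := dpsiP b Dx; apply/is_derive_epsP => e e0.
  have [d d0 Hd] := H e e0; exists d => // h hd.
  have := Hd h hd; rewrite /a !add0r addr0 subrr subr0.
  by rewrite (_ : h *: (1 : R) = h) //; exact: mulr1.
have : is_derive (0 : R) (1 : R) (g \o a) ('D_(bas b) f (phi x) * dpsi b (crd b x)).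
  by apply: is_derive1_comp; rewrite ?a0.
move=> /is_derive_epsP H; apply/is_derive_epsP => e e0.
have [d d0 Hd] := H e e0; exists d => // h hd; have := Hd h hd.
rewrite /= (_ : h *: (1 : R) = h); last exact: mulr1.
rewrite add0r /g a0 scale0r addr0 mulrC [_ * dpsi _ _]mulrC mulrC.
rewrite (_ : phi (x + h *: bas b) = phi x + a h *: bas b)//.
apply: crdP => b'; rewrite crdD crdZ !crd_phi crdD crdZ crd_bas.
case: (eqVneq b' b) => [->|_]; last by rewrite !mulr0 !addr0.
by rewrite !mulr1 /a [RHS]addrC subrK.
Qed.

(** The derivative of [f \o phi] is again a composite with [phi] once the chain rule factor is
    written as a function [slope] of the image point. This is what lets the induction on k close. *)
Lemma Ck_coordinatewise k f :
  (forall b k, Ck D' k (slope b)) -> (forall b x, D x -> dpsi b (crd b x) = slope b (phi x)) ->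
  (forall k, Ck D' k f) -> Ck D k (f \o phi).
Proof.
move=> Ca da; elim: k f => [|k IH] f Cf.
  split=> // x Dx; apply: continuous_comp; first exact: phi_continuous.
  by apply: Ck_continuous (Cf 0%N) _; apply: phiD.
apply: Ck_basis => //.
  move=> x Dx; apply: continuous_comp; first exact: phi_continuous.
  by apply: Ck_continuous (Cf 0%N) _; apply: phiD.
move=> b.
have dfb x : D x -> is_derive x (bas b) (f \o phi) (dpsi b (crd b x) * 'D_(bas b) f (phi x)).
  by move=> Dx; apply: is_derive_coordinatewise => //; apply: Ck_derivable (Cf 1%N) _; exact: phiD.
split; first by move=> x /dfb[].
apply: (@Ck_eq _ _ D _ ((fun y => slope b y * 'D_(bas b) f y) \o phi)) => //.
  by move=> x Dx; have [_ ->] := dfb x Dx; rewrite da.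
by apply: IH => k'; apply: Ck_mul => //; exact: Ck_derive.
Qed.

End Coordinatewise.

End Coordinates.

(** * Complex-valued smooth functions *)

Section Modulus.
Context {R : realType}.
Implicit Types z w : R[i].
Local Notation Re := complex.Re.
Local Notation Im := complex.Im.

Lemma cReD z w : Re (z + w) = Re z + Re w. Proof. by case: z w => ? ? []. Qed.
Lemma cImD z w : Im (z + w) = Im z + Im w. Proof. by case: z w => ? ? []. Qed.
Lemma cReN z : Re (- z) = - Re z. Proof. by case: z. Qed.
Lemma cImN z : Im (- z) = - Im z. Proof. by case: z. Qed.
Lemma cReM z w : Re (z * w) = Re z * Re w - Im z * Im w.
Proof. by case: z w => ? ? []. Qed.
Lemma cImM z w : Im (z * w) = Re z * Im w + Im z * Re w.
Proof. by case: z w => ? ? []. Qed.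

Lemma ReIm_inj z w : Re z = Re w -> Im z = Im w -> z = w.
Proof. by case: z w => ? ? [? ?] /= -> ->. Qed.

(** The norm of [R[i]] takes its values in [R[i]]; a modulus with values in [R] allows real
    estimates, suprema and real arithmetic. *)
Definition md z : R := Normc.normc z.

Lemma md_ge0 z : 0 <= md z.
Proof. by case: z => a b; rewrite /md/= sqrtr_ge0. Qed.
Lemma mdD z w : md (z + w) <= md z + md w. Proof. exact: le_normcD. Qed.
Lemma mdM z w : md (z * w) = md z * md w. Proof. exact: Normc.normcM. Qed.
Lemma mdN z : md (- z) = md z. Proof. exact: normcN. Qed.
Lemma md0 : md 0 = 0. Proof. exact: Normc.normc0. Qed.
Lemma md1 : md 1 = 1. Proof. exact: Normc.normc1. Qed.
Lemma mdV z : md z^-1 = (md z)^-1. Proof. exact: Normc.normcV. Qed.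
Lemma mdX z k : md (z ^+ k) = md z ^+ k.
Proof. by elim: k => [|k IH]; rewrite ?md1// !exprS mdM IH. Qed.
Lemma md_eq0 z : md z = 0 -> z = 0. Proof. exact: Normc.eq0_normc. Qed.
Lemma mdB z w : md (z - w) = md (w - z). Proof. by rewrite -mdN opprB. Qed.
Lemma md_real (x : R) : md x%:C%C = `|x|.
Proof. by rewrite /md/= expr0n/= addr0 sqrtr_sqr. Qed.
Lemma md_nat k : md k%:R = k%:R.
Proof. by rewrite -(rmorph_nat (real_complex R)) md_real ger0_norm. Qed.

Lemma Re_md z : `|Re z| <= md z.
Proof. by have := normc_ge_Re z; rewrite -lecR. Qed.

Lemma Im_md z : `|Im z| <= md z.
Proof.
case: z => a b; rewrite /md/= -[`|b|]sqrtr_sqr ler_wsqrtr//.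
by rewrite lerDr sqr_ge0.
Qed.

Lemma md_ReIm z : md z <= `|Re z| + `|Im z|.
Proof.
case: z => a b; have -> : (a +i* b)%C = a%:C%C + (0 +i* b)%C.
  by apply: ReIm_inj; rewrite /= ?addr0 ?add0r.
apply: le_trans (mdD _ _) _; rewrite md_real/= addr0 add0r lerD2l.
by rewrite /md/= expr0n/= add0r sqrtr_sqr.
Qed.

Lemma md_sum (I : Type) (r : seq I) (P : pred I) (F : I -> R[i]) :
  md (\sum_(i <- r | P i) F i) <= \sum_(i <- r | P i) md (F i).
Proof.
elim/big_ind2: _ => // [|z a w b za wb]; first by rewrite md0.
by apply: le_trans (mdD _ _) _; apply: lerD.
Qed.

Lemma md_small z : (forall e : R, 0 < e -> md z <= e) -> z = 0.
Proof.
move=> H; apply: md_eq0; apply/eqP; rewrite eq_le md_ge0 andbT.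
by apply/ler_addgt0Pl => e e0; rewrite addr0; apply: H.
Qed.

Lemma md_le_small z (B : R) : (forall e : R, 0 < e -> md z <= e * B) -> z = 0.
Proof.
move=> H; apply: md_small => e e0.
have B1 : 0 < `|B| + 1 by rewrite ltr_wpDl.
apply: le_trans (H (e / (`|B| + 1)) (divr_gt0 e0 B1)) _.
rewrite -mulrA ler_piMr// ?(ltW e0)// mulrC ler_pdivrMr// mul1r.
by apply: le_trans (ler_norm _) _; rewrite lerDl.
Qed.

Lemma real_cauchy_cvg (u : nat -> R) :
  (forall e : R, 0 < e -> exists N, forall m n, (N <= m)%N -> (N <= n)%N ->
     `|u m - u n| <= e) -> exists l, forall e : R, 0 < e ->
     exists N, forall n, (N <= n)%N -> `|u n - l| <= e.
Proof.
move=> H; have : cvg (u @ \oo).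
  apply/cauchy_cvgP/cauchy_exP => _/posnumP[e].
  have [N HN] := H (e%:num / 2) (divr_gt0 (gt0 e) (ltr0n _ 2)).
  exists (u N); exists N => // n /= Nn; rewrite -ball_normE/=.
  by rewrite (le_lt_trans (HN _ _ _ _))// ltr_pdivrMr// ltr_pMr// ltr1n.
move=> /cvg_ex[l /cvgrPdist_le Hl]; exists l => e e0.
by have [N _ HN] := Hl e e0; exists N => n Nn; rewrite distrC; apply: HN.
Qed.

Lemma complex_cauchy_cvg (u : nat -> R[i]) :
  (forall e : R, 0 < e -> exists N, forall m n, (N <= m)%N -> (N <= n)%N ->
     md (u m - u n) <= e) -> exists l, forall e : R, 0 < e ->
     exists N, forall n, (N <= n)%N -> md (u n - l) <= e.
Proof.
move=> H.
have [|a Ha] := @real_cauchy_cvg (fun n => Re (u n)).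
  move=> e /H[N HN]; exists N => m n Nm Nn.
  by apply: le_trans (HN m n Nm Nn); rewrite -cReN -cReD; apply: Re_md.
have [|b Hb] := @real_cauchy_cvg (fun n => Im (u n)).
  move=> e /H[N HN]; exists N => m n Nm Nn.
  by apply: le_trans (HN m n Nm Nn); rewrite -cImN -cImD; apply: Im_md.
exists (a +i* b)%C => e e0; have e2 : 0 < e / 2 by rewrite divr_gt0.
have [N1 H1] := Ha _ e2; have [N2 H2] := Hb _ e2.
exists (maxn N1 N2) => n; rewrite geq_max => /andP[n1 n2].
apply: le_trans (md_ReIm _) _; rewrite cReD cImD cReN cImN [e]splitr.
by apply: lerD; [exact: H1|exact: H2].
Qed.

(** The default 0 makes the limit a total operation, so that limits of operators can be defined
    before convergence is known. *)
Definition clim (u : nat -> R[i]) : R[i] :=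
  xget 0 [set l | forall e : R, 0 < e ->
     exists N, forall n, (N <= n)%N -> md (u n - l) <= e].

Lemma clim_unique (u : nat -> R[i]) l : (forall e : R, 0 < e ->
     exists N, forall n, (N <= n)%N -> md (u n - l) <= e) -> clim u = l.
Proof.
move=> Hl; have Hc : [set l | forall e : R, 0 < e ->
    exists N, forall n, (N <= n)%N -> md (u n - l) <= e] (clim u).
  by apply: (@xgetI _ 0 _ l).
apply/eqP; rewrite -subr_eq0; apply/eqP/md_small => e e0.
have e2 : 0 < e / 2 by rewrite divr_gt0.
have [N1 H1] := Hl _ e2; have [N2 H2] := Hc _ e2.
have -> : clim u - l = (u (maxn N1 N2) - l) - (u (maxn N1 N2) - clim u) by ring.
rewrite [e]splitr; apply: le_trans (mdD _ _) _; rewrite mdN lerD//.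
  by apply: H1; rewrite leq_maxl.
by apply: H2; rewrite leq_maxr.
Qed.

End Modulus.

(** * Calculus of smooth complex-valued functions *)

Section Smooth.
Context {R : realType} {V : normedModType R}.
Implicit Types (D : set V) (f g : V -> R[i]) (x v w : V).
Local Notation Re := complex.Re.
Local Notation Im := complex.Im.

Lemma smooth_deriveC D f v : smooth D f -> smooth D (deriveC v f).
Proof.
move=> Hf k; have [H1 H2] := Hf k.+1.
by split; [exact: (Ck_derive v H1)|exact: (Ck_derive v H2)].
Qed.

Lemma smooth_eq D f g : open D -> (forall x, D x -> f x = g x) ->
  smooth D f -> smooth D g.
Proof.
move=> oD fg Hf k; have [H1 H2] := Hf k.
by split; [apply: Ck_eq H1|apply: Ck_eq H2] => // x /fg ->.
Qed.

Lemma smooth_cst D (c : R[i]) : open D -> smooth D (fun=> c).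
Proof. by move=> oD k; split; apply: Ck_cst. Qed.

Lemma smooth_add D f g : open D -> smooth D f -> smooth D g ->
  smooth D (fun x => f x + g x).
Proof.
move=> oD Hf Hg k; have [f1 f2] := Hf k; have [g1 g2] := Hg k.
split; [apply: Ck_eq (Ck_add oD f1 g1)|apply: Ck_eq (Ck_add oD f2 g2)] => // x _.
  by rewrite cReD.
by rewrite cImD.
Qed.

Lemma smooth_mul D f g : open D -> smooth D f -> smooth D g ->
  smooth D (fun x => f x * g x).
Proof.
move=> oD Hf Hg k; have [f1 f2] := Hf k; have [g1 g2] := Hg k.
split.
  apply: Ck_eq (Ck_add oD (Ck_mul oD f1 g1) (Ck_opp oD (Ck_mul oD f2 g2))) => // x _.
  by rewrite cReM.
apply: Ck_eq (Ck_add oD (Ck_mul oD f1 g2) (Ck_mul oD f2 g1)) => // x _.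
by rewrite cImM.
Qed.

Lemma smooth_scale D (c : R[i]) f : open D -> smooth D f -> smooth D (fun x => c * f x).
Proof. by move=> oD; apply: smooth_mul => //; apply: smooth_cst. Qed.

Lemma smooth_sum D (I : Type) (r : seq I) (P : pred I) (F : I -> V -> R[i]) : open D ->
  (forall i, P i -> smooth D (F i)) -> smooth D (fun x => \sum_(i <- r | P i) F i x).
Proof.
move=> oD CF; elim: r => [|i r IH].
  by apply: smooth_eq (smooth_cst 0 oD) => // x _; rewrite big_nil.
case Pi : (P i); last by apply: smooth_eq IH => // x _; rewrite big_cons Pi.
by apply: smooth_eq (smooth_add oD (CF i Pi) IH) => // x _; rewrite big_cons Pi.
Qed.

Lemma smooth_derivable D f x v : smooth D f -> D x ->
  derivable (fun y => Re (f y)) x v /\ derivable (fun y => Im (f y)) x v.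
Proof.
move=> /(_ 1%N)[f1 f2] Dx.
by split; [exact: (Ck_derivable (v:=v) f1 Dx)|exact: (Ck_derivable (v:=v) f2 Dx)].
Qed.

Lemma smooth_continuous D f x : smooth D f -> D x ->
  {for x, continuous (fun y => Re (f y))} /\ {for x, continuous (fun y => Im (f y))}.
Proof.
move=> /(_ 1%N)[f1 f2] Dx.
by split; [exact: (Ck_continuous f1 Dx)|exact: (Ck_continuous f2 Dx)].
Qed.

Lemma smooth_coind (P : (V -> R[i]) -> Prop) f :
  (forall f, P f -> (forall x, {for x, continuous (fun y => Re (f y))} /\
      {for x, continuous (fun y => Im (f y))}) /\
     forall v, (forall x, derivable (fun y => Re (f y)) x v /\
        derivable (fun y => Im (f y)) x v) /\ P (deriveC v f)) ->
  P f -> smooth setT f.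
Proof.
move=> H Pf k; split.
- refine (@Ck_coind _ _ (fun g : V -> R => exists2 f0, P f0 & g = (fun y => Re (f0 y))) k _ _ _); last by exists f.
  move=> g [f' Pf' ->]; have [c d] := H f' Pf'; split=> [x|v].
    by have [] := c x.
  have [dv Pv] := d v; split=> [x|]; first by have [] := dv x.
  by exists (deriveC v f').
- refine (@Ck_coind _ _ (fun g : V -> R => exists2 f0, P f0 & g = (fun y => Im (f0 y))) k _ _ _); last by exists f.
  move=> g [f' Pf' ->]; have [c d] := H f' Pf'; split=> [x|v].
    by have [] := c x.
  have [dv Pv] := d v; split=> [x|]; first by have [] := dv x.
  by exists (deriveC v f').
Qed.

Lemma deriveC_cst (c : R[i]) v x : deriveC v (fun=> c) x = 0.
Proof. by rewrite /deriveC; rewrite !derive_cst. Qed.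

Lemma deriveCD D f g v x : smooth D f -> smooth D g -> D x ->
  deriveC v (fun y => f y + g y) x = deriveC v f x + deriveC v g x.
Proof.
move=> Hf Hg Dx; have [f1 f2] := smooth_derivable v Hf Dx.
have [g1 g2] := smooth_derivable v Hg Dx.
apply: ReIm_inj; rewrite /deriveC ?cReD ?cImD /=.
  rewrite -deriveD//; congr (derive _ x v); apply/funext => y; exact: cReD.
rewrite -deriveD//; congr (derive _ x v); apply/funext => y; exact: cImD.
Qed.

Lemma is_derive_mulr (p q : V -> R) v x : derivable p x v -> derivable q x v ->
  is_derive x v (fun y => p y * q y) ('D_v p x * q x + p x * 'D_v q x).
Proof.
move=> dp dq; have E := @deriveM _ _ p q x v dp dq.
have D := @derivableM _ _ p q x v dp dq.
split; first exact: D.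
apply: eq_trans E _.
by rewrite addrC; congr (_ + _); exact: mulrC.
Qed.

Lemma deriveCM D f g v x : smooth D f -> smooth D g -> D x ->
  deriveC v (fun y => f y * g y) x = deriveC v f x * g x + f x * deriveC v g x.
Proof.
move=> Hf Hg Dx; have [f1 f2] := smooth_derivable v Hf Dx.
have [g1 g2] := smooth_derivable v Hg Dx.
have [d11 e11] := is_derive_mulr f1 g1; have [d22 e22] := is_derive_mulr f2 g2.
have [d12 e12] := is_derive_mulr f1 g2; have [d21 e21] := is_derive_mulr f2 g1.
have e1 : 'D_v (fun y => Re (f y * g y)) x =
    'D_v (fun y => Re (f y) * Re (g y)) x - 'D_v (fun y => Im (f y) * Im (g y)) x.
  rewrite -(deriveB d11 d22); congr (derive _ x v); apply/funext => y; exact: cReM.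
have e2 : 'D_v (fun y => Im (f y * g y)) x =
    'D_v (fun y => Re (f y) * Im (g y)) x + 'D_v (fun y => Im (f y) * Re (g y)) x.
  rewrite -(deriveD d12 d21); congr (derive _ x v); apply/funext => y; exact: cImM.
apply: ReIm_inj; rewrite [in LHS]/deriveC /= ?e1 ?e2 ?e11 ?e22 ?e12 ?e21.
  by rewrite cReD !cReM /deriveC/=; ring.
by rewrite cImD !cImM /deriveC/=; ring.
Qed.

Lemma deriveCZ D f (c : R[i]) v x : open D -> smooth D f -> D x ->
  deriveC v (fun y => c * f y) x = c * deriveC v f x.
Proof.
move=> oD Hf Dx; rewrite (deriveCM v (smooth_cst c oD) Hf Dx).
by rewrite deriveC_cst mul0r add0r.
Qed.

Lemma deriveC_sum D (I : Type) (r : seq I) (P : pred I) (F : I -> V -> R[i]) v x :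
  open D -> D x -> (forall i, P i -> smooth D (F i)) ->
  deriveC v (fun y => \sum_(i <- r | P i) F i y) x = \sum_(i <- r | P i) deriveC v (F i) x.
Proof.
move=> oD Dx CF; elim: r => [|i r IH].
  rewrite big_nil (_ : (fun y => _) = (fun=> 0)); first exact: deriveC_cst.
  by apply/funext => y; rewrite big_nil.
case Pi : (P i); last first.
  by rewrite big_cons Pi -IH; congr (deriveC v _ x); apply/funext => y; rewrite big_cons Pi.
rewrite big_cons Pi -IH -(deriveCD v (CF i Pi) (smooth_sum _ oD CF) Dx).
by congr (deriveC v _ x); apply/funext => y; rewrite big_cons Pi.
Qed.

Lemma deriveC_lin D f v w (a b : R) x : open D -> smooth D f -> D x ->
  deriveC (a *: v + b *: w) f x = a%:C%C * deriveC v f x + b%:C%C * deriveC w f x.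
Proof.
move=> oD Hf Dx.
have H (g : V -> R) : Ck D 1 g ->
    'D_(a *: v + b *: w) g x = a * 'D_v g x + b * 'D_w g x.
  move=> Cg.
  have Dg y u : D y -> derivable g y u by exact: Ck_derivable Cg.
  have S (c : R) u : 'D_(c *: u) g x = c * 'D_u g x.
    by have [] := is_derive_scale_dir c (derivableP (Dg _ u Dx)).
  rewrite -!S; have [|||_ ->//] := @is_derive_add_dir _ _ g x (a *: v) (b *: w).
  - have /nbhs_ballP[d /= d0 Hd] := open_nbhs_nbhs (conj oD Dx).
    exists d => // y yd; apply: Dg; apply: Hd.
    by rewrite -ball_normE/= distrC.
  - exact: Ck_continuous (Ck_derive (a *: v) Cg) Dx.
  - exact: Dg.
have [f1 f2] := Hf 1%N.
rewrite /deriveC !H//; move: ('D_v _ _) ('D_w _ _) ('D_v _ x) ('D_w _ x) => X Y X' Y'.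
apply: ReIm_inj; rewrite ?cReD ?cImD ?cReM ?cImM/=; ring.
Qed.

Lemma quotient_line (A A0 : V -> V) (p : V -> R) v x :
  (forall h : R, A (x + h *: v) = A x + h *: A0 v) ->
  (fun h : R => h^-1 *: (((p \o A) \o shift x) (h *: v) - (p \o A) x)) =
  (fun h : R => h^-1 *: ((p \o shift (A x)) (h *: A0 v) - p (A x))).
Proof. by move=> HA; apply/funext => h /=; rewrite [_ + x]addrC HA [A x + _]addrC. Qed.

Lemma derivable_line (A A0 : V -> V) (p : V -> R) v x :
  (forall h : R, A (x + h *: v) = A x + h *: A0 v) ->
  derivable p (A x) (A0 v) -> derivable (p \o A) x v.
Proof. by move=> HA; rewrite /derivable (quotient_line p HA). Qed.

Lemma derive_line (A A0 : V -> V) (p : V -> R) v x :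
  (forall h : R, A (x + h *: v) = A x + h *: A0 v) ->
  'D_v (p \o A) x = 'D_(A0 v) p (A x).
Proof. by move=> HA; rewrite /derive (quotient_line p HA). Qed.

Lemma deriveC_line (A A0 : V -> V) f v x :
  (forall h : R, A (x + h *: v) = A x + h *: A0 v) ->
  deriveC v (f \o A) x = deriveC (A0 v) f (A x).
Proof.
move=> HA; apply: ReIm_inj; rewrite /deriveC /=.
  exact: (derive_line (fun y => Re (f y)) HA).
exact: (derive_line (fun y => Im (f y)) HA).
Qed.

(** [A] is affine with linear part [A0]. This covers translations, the sign change and the action of
    units in logarithmic coordinates. *)
Lemma smooth_line (A A0 : V -> V) f : continuous A ->
  (forall x v (h : R), A (x + h *: v) = A x + h *: A0 v) ->
  smooth setT f -> smooth setT (f \o A).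
Proof.
move=> cA HA Hf.
apply: (@smooth_coind (fun g => exists2 f, smooth setT f & g = f \o A)); last by exists f.
move=> g [f' Hf' ->]; split=> [x|v].
  have [c1 c2] := smooth_continuous Hf' (I : setT (A x)).
  split.
    exact: (@continuous_comp _ _ _ A (fun y => Re (f' y)) x (cA x) c1).
  exact: (@continuous_comp _ _ _ A (fun y => Im (f' y)) x (cA x) c2).
split; last first.
  exists (deriveC (A0 v) f'); first exact: smooth_deriveC.
  by apply/funext => x; apply: deriveC_line => h; exact: HA.
move=> x; have [d1 d2] := smooth_derivable (A0 v) Hf' (I : setT (A x)).
split.
  exact: (@derivable_line A A0 (fun y => Re (f' y)) v x (HA x v) d1).
exact: (@derivable_line A A0 (fun y => Im (f' y)) v x (HA x v) d2).
Qed.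

Lemma deriveC_shift f v w x :
  deriveC v (fun y => f (y + w)) x = deriveC v f (x + w).
Proof.
by apply: (@deriveC_line (fun y => y + w) id) => h; rewrite addrAC.
Qed.

Lemma smooth_shift f w : smooth setT f -> smooth setT (fun y => f (y + w)).
Proof.
apply: (@smooth_line (fun y => y + w) id) => [x|x v h]; last by rewrite addrAC.
by apply: cvgD; [exact: cvg_id|exact: cvg_cst].
Qed.

(** The mean value theorem gives different intermediate points for the real and the imaginary part,
    hence [B + B]. *)
Lemma smooth_increment f x v (B : R) : smooth setT f ->
  (forall r : R, 0 <= r <= 1 -> md (deriveC v f (x + r *: v)) <= B) ->
  md (f (x + v) - f x) <= B + B.
Proof.
move=> Hf HB; apply: le_trans (md_ReIm _) _; rewrite cReD cImD cReN cImN.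
apply: lerD.
  have [|r r01 ->] := @MVT_dir _ _ (fun y => Re (f y)) x v.
    by move=> r _; have [] := smooth_derivable v Hf (I : setT (x + r *: v)).
  by apply: le_trans (HB r r01); exact: (Re_md (deriveC v f (x + r *: v))).
have [|r r01 ->] := @MVT_dir _ _ (fun y => Im (f y)) x v.
  by move=> r _; have [] := smooth_derivable v Hf (I : setT (x + r *: v)).
by apply: le_trans (HB r r01); exact: (Im_md (deriveC v f (x + r *: v))).
Qed.

Lemma smooth_increment_derive f x v (B : R) : smooth setT f ->
  (forall r : R, 0 <= r <= 1 -> md (deriveC v f (x + r *: v) - deriveC v f x) <= B) ->
  md (f (x + v) - f x - deriveC v f x) <= B + B.
Proof.
move=> Hf HB; apply: le_trans (md_ReIm _) _; rewrite !cReD !cImD !cReN !cImN.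
apply: lerD.
  have [|r r01 ->] := @MVT_dir _ _ (fun y => Re (f y)) x v.
    by move=> r _; have [] := smooth_derivable v Hf (I : setT (x + r *: v)).
  apply: le_trans (HB r r01); apply: le_trans (Re_md _).
  by rewrite cReD cReN.
have [|r r01 ->] := @MVT_dir _ _ (fun y => Im (f y)) x v.
  by move=> r _; have [] := smooth_derivable v Hf (I : setT (x + r *: v)).
apply: le_trans (HB r r01); apply: le_trans (Im_md _).
by rewrite cImD cImN.
Qed.

Lemma deriveC_scale_dir f x v (a : R) : smooth setT f ->
  deriveC (a *: v) f x = a%:C%C * deriveC v f x.
Proof.
move=> Hf; have := @deriveC_lin setT f v 0 a 0 x openT Hf I.
by rewrite scale0r addr0 mul0r addr0.
Qed.

End Smooth.

(** * Locally uniform convergence *)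

Section LocallyUniform.
Context {R : realType} {n : nat}.
Local Notation V := (Cn R n).
Local Notation C := R[i].
Implicit Types (f g : V -> C) (x v w : V) (rho e : R).
Local Notation sm := (smooth setT).

Lemma crd_norm b x : `|crd b x| <= `|x|.
Proof.
have E k (y : 'rV[R]_n) : `|y 0 k| <= `|y|.
  rewrite [leRHS]/Num.norm /= mx_normrE; apply/bigmax_geP; right => /=.
  by exists (0, k).
case: b => k; apply: le_trans (E _ _) _.
  by rewrite [leRHS]/Num.norm /= le_max lexx.
by rewrite [leRHS]/Num.norm /= le_max lexx orbT.
Qed.

(** Closed balls of the sup norm are products of segments, hence compact. *)
Lemma continuous_bounded (f : V -> R) rho : continuous f ->
  exists2 B, 0 <= B & forall x, `|x| <= rho -> `|f x| <= B.
Proof.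
move=> cf.
have [rho0|rho0] := ltP rho 0.
  by exists 0 => // x xr; have := normr_ge0 x; rewrite leNgt (le_lt_trans xr).
pose I := [set y : 'rV[R]_n | forall i, y ord0 i \in `[(- rho), rho]].
have cI : compact (I `*` I).
  have c1 : compact I.
    apply: (@rV_compact _  _ (fun=> `[(- rho), rho]%classic)) => _.
    exact: segment_compact.
  exact: compact_setX.
have I0 : (I `*` I) !=set0.
  by exists (0, 0); split=> i /=; rewrite mxE in_itv/= oppr_le0 rho0.
have [|y _ Hy] := @compact_EVT_max _ _ (fun x => `|f x|) (I `*` I) I0 cI.
  apply: continuous_subspaceT => x.
  by apply: continuous_comp; [exact: cf|exact: norm_continuous].
exists `|f y| => // x xr; apply: Hy; rewrite inE; split => i /=.
  by rewrite in_itv/= -ler_norml; apply: le_trans xr; exact: (crd_norm (inl i) x).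
by rewrite in_itv/= -ler_norml; apply: le_trans xr; exact: (crd_norm (inr i) x).
Qed.

Lemma smooth_bounded f rho : sm f ->
  exists2 B, 0 <= B & forall x, `|x| <= rho -> md (f x) <= B.
Proof.
move=> Hf.
have [|B1 B10 H1] := @continuous_bounded (fun y => complex.Re (f y)) rho.
  by move=> x; have [] := smooth_continuous Hf (I : setT x).
have [|B2 B20 H2] := @continuous_bounded (fun y => complex.Im (f y)) rho.
  by move=> x; have [] := smooth_continuous Hf (I : setT x).
exists (B1 + B2); first exact: addr_ge0.
by move=> x xr; apply: le_trans (md_ReIm _) (lerD (H1 _ xr) (H2 _ xr)).
Qed.

Lemma norm_shift_le x v rho (r : R) : 0 <= r <= 1 -> `|x| <= rho ->
  `|x + r *: v| <= rho + `|v|.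
Proof.
move=> /andP[r0 r1] xr; apply: le_trans (ler_normD _ _) (lerD xr _).
by rewrite normrZ ger0_norm// ler_piMl.
Qed.

Lemma smooth_lipschitz f v rho : sm f -> exists2 L, 0 <= L &
  forall x (r : R), 0 <= r <= 1 -> `|x| <= rho -> md (f (x + r *: v) - f x) <= L * r.
Proof.
move=> Hf; have [B B0 HB] := smooth_bounded (rho + `|v|) (smooth_deriveC v Hf).
exists (B + B) => [|x r r01 xr]; first exact: addr_ge0.
rewrite mulrDl; apply: smooth_increment => // q /andP[q0 q1].
have /andP[r0 r1] := r01.
rewrite deriveC_scale_dir// mdM md_real ger0_norm// mulrC ler_wpM2r// scalerA.
by apply: HB; apply: norm_shift_le => //; rewrite mulr_ge0// mulr_ile1.
Qed.

Lemma smooth_lipschitz_derive f v rho : sm f -> exists2 L, 0 <= L &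
  forall x (r : R), 0 <= r <= 1 -> `|x| <= rho ->
    md (f (x + r *: v) - f x - r%:C%C * deriveC v f x) <= L * (r * r).
Proof.
move=> Hf; have [L L0 HL] := smooth_lipschitz v rho (smooth_deriveC v Hf).
exists (L + L) => [|x r r01 xr]; first exact: addr_ge0.
have /andP[r0 r1] := r01.
rewrite -deriveC_scale_dir// mulrDl; apply: smooth_increment_derive => // q /andP[q0 q1].
rewrite !deriveC_scale_dir// -mulrBr mdM md_real ger0_norm// mulrCA ler_wpM2l//.
rewrite scalerA; apply: le_trans (HL _ _ _ xr) _.
  by rewrite mulr_ge0// mulr_ile1.
by rewrite ler_wpM2l// ler_piMl.
Qed.

(** Uniformity on balls survives multiplication by unbounded smooth functions, translations, and
    operators that enlarge balls by a fixed radius. *)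
Definition lucv (F : nat -> V -> C) f := forall rho e, 0 < e ->
  exists N, forall k, (N <= k)%N -> forall x, `|x| <= rho -> md (F k x - f x) <= e.

Definition lucauchy (F : nat -> V -> C) := forall rho e, 0 < e ->
  exists N, forall k l, (N <= k)%N -> (N <= l)%N ->
  forall x, `|x| <= rho -> md (F k x - F l x) <= e.

Lemma lucauchy_lucv F : lucauchy F -> lucv F (fun x => clim (fun k => F k x)).
Proof.
move=> H rho e e0.
have e2 : 0 < e / 2 by rewrite divr_gt0.
have [N HN] := H rho _ e2; exists N => k Nk x xr.
have [|l Hl] := @complex_cauchy_cvg _ (fun k => F k x).
  by move=> e' e'0; have [M HM] := H rho _ e'0; exists M => a b Ma Mb; apply: HM.
rewrite (clim_unique Hl); have [M HM] := Hl _ e2.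
pose m := maxn N M.
have -> : F k x - l = (F k x - F m x) + (F m x - l) by ring.
rewrite [e]splitr; apply: le_trans (mdD _ _) (lerD _ _).
  by apply: HN => //; rewrite leq_maxl.
by apply: HM; rewrite leq_maxr.
Qed.

Lemma lucv_unique F f g : lucv F f -> lucv F g -> f = g.
Proof.
move=> Hf Hg; apply/funext => x; apply/eqP; rewrite -subr_eq0; apply/eqP.
apply: (@md_le_small _ _ 2) => e e0.
have [N HN] := Hf `|x| _ e0; have [M HM] := Hg `|x| _ e0.
have -> : f x - g x = - (F (maxn N M) x - f x) + (F (maxn N M) x - g x) by ring.
rewrite mulr_natr mulr2n; apply: le_trans (mdD _ _) _; rewrite mdN lerD//.
  by apply: HN; rewrite ?leq_maxl.
by apply: HM; rewrite ?leq_maxr.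
Qed.

Lemma lucv_eq F G f : (forall k, F k = G k) -> lucv F f -> lucv G f.
Proof. by move=> FG Hf; rewrite (_ : G = F)//; apply/funext. Qed.

Lemma lucv_add F G f g : lucv F f -> lucv G g ->
  lucv (fun k x => F k x + G k x) (fun x => f x + g x).
Proof.
move=> Hf Hg rho e e0; have e2 : 0 < e / 2 by rewrite divr_gt0.
have [N HN] := Hf rho _ e2; have [M HM] := Hg rho _ e2.
exists (maxn N M) => k; rewrite geq_max => /andP[Nk Mk] x xr.
have -> : F k x + G k x - (f x + g x) = (F k x - f x) + (G k x - g x) by ring.
by rewrite [e]splitr; apply: le_trans (mdD _ _) (lerD _ _); [exact: HN|exact: HM].
Qed.

Lemma lucv_mul F f m : sm m -> lucv F f ->
  lucv (fun k x => m x * F k x) (fun x => m x * f x).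
Proof.
move=> Hm Hf rho e e0; have [B B0 HB] := smooth_bounded rho Hm.
have B1 : 0 < B + 1 by rewrite ltr_wpDl.
have [N HN] := Hf rho _ (divr_gt0 e0 B1); exists N => k Nk x xr.
rewrite -mulrBr mdM.
apply: le_trans (ler_pM (md_ge0 _) (md_ge0 _) (HB x xr) (HN k Nk x xr)) _.
by rewrite mulrCA ler_piMr ?(ltW e0)// ler_pdivrMr// mul1r lerDl.
Qed.

Lemma lucv_shift F f w : lucv F f -> lucv (fun k x => F k (x + w)) (fun x => f (x + w)).
Proof.
move=> Hf rho e e0; have [N HN] := Hf (rho + `|w|) _ e0.
exists N => k Nk x xr; apply: HN => //.
by apply: le_trans (ler_normD _ _) (lerD xr _).
Qed.

Lemma lucv_continuous F f x : (forall k, sm (F k)) -> lucv F f ->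
  {for x, continuous (fun y => complex.Re (f y))} /\
  {for x, continuous (fun y => complex.Im (f y))}.
Proof.
move=> sF Hf.
have H (P : C -> R) : (forall z, `|P z| <= md z) -> {morph P : z w / z - w >-> z - w} ->
    (forall k, {for x, continuous (fun y => P (F k y))}) -> {for x, continuous (fun y => P (f y))}.
  move=> P1 P2 cP; apply/continuous_epsP => e e0.
  have e3 : 0 < e / 3 by rewrite divr_gt0.
  have [N HN] := Hf (`|x| + 1) _ e3; have := HN N (leqnn N) => {}HN.
  have [d d0 Hd] := (continuous_epsP _ _).1 (cP N) _ e3.
  exists (Num.min d 1); first by rewrite lt_min d0 ltr01.
  move=> y; rewrite lt_min => /andP[yd y1].
  have yr : `|y| <= `|x| + 1.
    rewrite -(subrK x y) addrC; apply: le_trans (ler_normD _ _) _.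
    by rewrite lerD2l ltW.
  have xr : `|x| <= `|x| + 1 by rewrite lerDl.
  have -> : P (f y) - P (f x) = (P (F N y) - P (F N x)) - (P (F N y) - P (f y))
     + (P (F N x) - P (f x)) by ring.
  have -> : e = e / 3 + e / 3 + e / 3 by field.
  apply: le_trans (ler_normD _ _) (lerD _ _); last first.
    by rewrite -P2; apply: le_trans (P1 _) _; apply: HN.
  apply: le_trans (ler_normB _ _) (lerD _ _); first exact: Hd.
  by rewrite -P2; apply: le_trans (P1 _) _; apply: HN.
split; apply: H.
- exact: Re_md.
- by move=> z w; rewrite cReD cReN.
- by move=> k; have [] := smooth_continuous (sF k) (I : setT x).
- exact: Im_md.
- by move=> z w; rewrite cImD cImN.
- by move=> k; have [] := smooth_continuous (sF k) (I : setT x).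
Qed.

Lemma lucv_derive F f g v x : (forall k, sm (F k)) -> lucv F f ->
  lucv (fun k => deriveC v (F k)) g ->
  (derivable (fun y => complex.Re (f y)) x v /\
   derivable (fun y => complex.Im (f y)) x v) /\ deriveC v f x = g x.
Proof.
move=> sF Hf Hg.
have [cg1 cg2] := lucv_continuous x (fun k => smooth_deriveC v (sF k)) Hg.
have nx y : `|y - x| < 1 -> `|y| <= `|x| + 1.
  move=> y1; rewrite -(subrK x y) addrC; apply: le_trans (ler_normD _ _) _.
  by rewrite lerD2l ltW.
have D1 : is_derive x v (fun y => complex.Re (f y)) (complex.Re (g x)).
  apply: (@is_derive_limit _ _ (fun k y => complex.Re (F k y)) _ (fun y => complex.Re (g y)) x v 1) => //.
  - by move=> k y _; have [] := smooth_derivable v (sF k) (I : setT y).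
  - move=> y /nx yr e e0; have [N HN] := Hf (`|x| + 1) _ e0; exists N => k Nk.
    by apply: le_trans (HN k Nk y yr); rewrite -cReN -cReD; exact: Re_md.
  - move=> e e0; have [N HN] := Hg (`|x| + 1) _ e0; exists N => k Nk y /nx yr.
    apply: le_trans (HN k Nk y yr).
    rewrite -cReN -[X in `|X + _|]/(complex.Re (deriveC v (F k) y)) -cReD.
    exact: Re_md.
have D2 : is_derive x v (fun y => complex.Im (f y)) (complex.Im (g x)).
  apply: (@is_derive_limit _ _ (fun k y => complex.Im (F k y)) _ (fun y => complex.Im (g y)) x v 1) => //.
  - by move=> k y _; have [] := smooth_derivable v (sF k) (I : setT y).
  - move=> y /nx yr e e0; have [N HN] := Hf (`|x| + 1) _ e0; exists N => k Nk.
    by apply: le_trans (HN k Nk y yr); rewrite -cImN -cImD; exact: Im_md.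
  - move=> e e0; have [N HN] := Hg (`|x| + 1) _ e0; exists N => k Nk y /nx yr.
    apply: le_trans (HN k Nk y yr).
    rewrite -cImN -[X in `|X + _|]/(complex.Im (deriveC v (F k) y)) -cImD.
    exact: Im_md.
have [d1 e1] := D1; have [d2 e2] := D2.
by split=> //; apply: ReIm_inj; rewrite /deriveC/=.
Qed.

Lemma invn_cvg0 e : 0 < e -> exists N, forall k, (N <= k)%N -> (k.+1%:R)^-1 <= e.
Proof.
move=> e0; exists (Num.Def.truncn e^-1) => k Nk.
rewrite invf_ple ?posrE// ; apply: ltW.
have : e^-1 < (Num.Def.truncn e^-1).+1%:R by exact: truncnS_gt.
by move=> /lt_le_trans; apply; rewrite ler_nat.
Qed.

Definition diffq (w : V) (k : nat) f x : C :=
  k.+1%:R * (f (x + k.+1%:R^-1 *: w) - f x).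

Lemma lucv_diffq f w : sm f -> lucv (fun k => diffq w k f) (deriveC w f).
Proof.
move=> Hf rho e e0; have [L L0 HL] := smooth_lipschitz_derive w rho Hf.
have L1 : 0 < L + 1 by rewrite ltr_wpDl.
have [N HN] := invn_cvg0 (divr_gt0 e0 L1); exists N => k Nk x xr.
have k0 : (0 : R) < k.+1%:R by rewrite ltr0n.
have r01 : 0 <= (k.+1%:R^-1 : R) <= 1.
  by rewrite invr_ge0 ler0n/= invf_le1// ler1n.
have -> : diffq w k f x - deriveC w f x =
   k.+1%:R * (f (x + k.+1%:R^-1 *: w) - f x - (k.+1%:R^-1)%:C%C * deriveC w f x).
  rewrite /diffq [in RHS]mulrBr mulrA; congr (_ - _).
  by rewrite fmorphV rmorph_nat divff ?mul1r// pnatr_eq0.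
rewrite mdM md_nat; apply: le_trans (_ : k.+1%:R * (L * (k.+1%:R^-1 * k.+1%:R^-1)) <= _).
  by rewrite ler_wpM2l// HL.
rewrite mulrCA [k.+1%:R * _]mulrA mulfV ?gt_eqF// mul1r.
apply: le_trans (ler_wpM2l L0 (HN k Nk)) _.
by rewrite mulrCA ler_piMr ?(ltW e0)// ler_pdivrMr// mul1r lerDl.
Qed.

Lemma smooth_diffq f w k : sm f -> sm (diffq w k f).
Proof.
move=> Hf; apply: smooth_scale; first exact: openT.
apply: (smooth_eq openT) (smooth_add openT (smooth_shift (k.+1%:R^-1 *: w) Hf)
  (smooth_scale (-1) openT Hf)) => x _.
by rewrite mulN1r.
Qed.

Lemma deriveC_diffq f v w k : sm f -> deriveC v (diffq w k f) = diffq w k (deriveC v f).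
Proof.
move=> Hf; apply/funext => x; rewrite /diffq.
have Hs := smooth_shift (k.+1%:R^-1 *: w) Hf.
have Hm := smooth_scale (-1) openT Hf.
rewrite (_ : (fun x => _) = (fun x => k.+1%:R * (f (x + k.+1%:R^-1 *: w) + (-1) * f x))); last first.
  by apply/funext => y; rewrite mulN1r.
rewrite (deriveCZ _ _ openT (smooth_add openT Hs Hm) (I : setT x)).
by rewrite (deriveCD _ Hs Hm (I : setT x)) (deriveCZ _ _ openT Hf (I : setT x)) deriveC_shift mulN1r.
Qed.

(* D_w is a locally uniform limit of difference quotients, and these commute
   with D_v. *)
Lemma deriveC_comm f v w : sm f -> deriveC v (deriveC w f) = deriveC w (deriveC v f).
Proof.
move=> Hf; apply/funext => x.
have [] := @lucv_derive (fun k => diffq w k f) (deriveC w f) (deriveC w (deriveC v f)) v x => //.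
- by move=> k; apply: smooth_diffq.
- exact: lucv_diffq.
- apply: lucv_eq (lucv_diffq w (smooth_deriveC v Hf)) => k.
  by rewrite deriveC_diffq.
Qed.

End LocallyUniform.

(** * Limits of combinations of translations *)

Section GoodOperators.
Context {R : realType} {n : nat}.
Local Notation V := (Cn R n).
Local Notation C := R[i].
Implicit Types (f g m : V -> C) (x v w : V) (rho c E : R).
Implicit Types (W : set V) (T : (V -> C) -> V -> C).
Local Notation sm := (@smooth R V setT).

(* The closure properties shared by the finite combinations of translations by
   vectors of [W] and their limits: they commute with derivatives, with
   translations and with multiplication by functions invariant under [W], and
   are bounded for the suprema on balls. *)
Record good W c E T : Prop := Good {
  good_smooth : forall f, sm f -> sm (T f);
  good_derive : forall f v, sm f -> deriveC v (T f) = T (deriveC v f);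
  good_add : forall f g, sm f -> sm g ->
    T (fun x => f x + g x) = (fun x => T f x + T g x);
  good_mul : forall m f, sm m -> (forall w x, W w -> m (x + w) = m x) -> sm f ->
    T (fun x => m x * f x) = (fun x => m x * T f x);
  good_shift : forall f w, sm f -> T (fun x => f (x + w)) = (fun x => T f (x + w));
  good_bound : forall f rho B, sm f -> (forall x, `|x| <= rho + E -> md (f x) <= B) ->
    forall x, `|x| <= rho -> md (T f x) <= c * B;
  good_c0 : 0 <= c;
  good_E0 : 0 <= E }.

Lemma good_weaken W c E c' E' T : c <= c' -> E <= E' -> good W c E T -> good W c' E' T.
Proof.
move=> cc EE [h1 h2 h3 h4 h5 h6 h7 h8]; split=> //; [|exact: le_trans cc|exact: le_trans EE].
move=> f rho B Hf HB x xr; have HB' y : `|y| <= rho + E -> md (f y) <= B.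
  by move=> yr; apply: HB; apply: le_trans yr _; rewrite lerD2l.
apply: le_trans (h6 f rho B Hf HB' x xr) _; apply: ler_wpM2r => //.
apply: le_trans (md_ge0 _) (HB' x _); apply: le_trans xr _; by rewrite lerDl.
Qed.

Lemma good_translation W a : W a -> good W 1 `|a| (fun f x => f (x + a)).
Proof.
move=> Wa; split; last exact: normr_ge0; last exact: ler01.
- by move=> f; apply: smooth_shift.
- by move=> f v _; apply/funext => x; rewrite deriveC_shift.
- by [].
- by move=> m f _ Hm _; apply/funext => x; rewrite Hm.
- by move=> f w _; apply/funext => x; rewrite addrAC.
- move=> f rho B _ HB x xr; rewrite mul1r; apply: HB.
  by apply: le_trans (ler_normD _ _) (lerD xr _).
Qed.

Lemma good_id W : good W 1 0 id.
Proof.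
split=> // f rho B _ HB x xr; rewrite mul1r; apply: HB.
by rewrite addr0.
Qed.

Lemma good_scale W c E T (k : C) : good W c E T ->
  good W (md k * c) E (fun f x => k * T f x).
Proof.
move=> [h1 h2 h3 h4 h5 h6 h7 h8]; split=> //.
- by move=> f Hf; apply: smooth_scale; [exact: openT|exact: h1].
- move=> f v Hf; apply/funext => x.
  by rewrite (deriveCZ _ _ openT (h1 f Hf) (I : setT x)) h2.
- by move=> f g Hf Hg; apply/funext => x; rewrite h3// mulrDr.
- by move=> m f Hm Wm Hf; apply/funext => x; rewrite h4// mulrCA.
- by move=> f w Hf; apply/funext => x; rewrite h5.
- move=> f rho B Hf HB x xr; rewrite mdM -mulrA ler_wpM2l ?md_ge0//.
  exact: (h6 f rho B).
- by rewrite mulr_ge0// md_ge0.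
Qed.

Lemma good_plus W c c' E T T' : good W c E T -> good W c' E T' ->
  good W (c + c') E (fun f x => T f x + T' f x).
Proof.
move=> [h1 h2 h3 h4 h5 h6 h7 h8] [k1 k2 k3 k4 k5 k6 k7 k8]; split=> //.
- by move=> f Hf; apply: smooth_add; [exact: openT|exact: h1|exact: k1].
- move=> f v Hf; apply/funext => x.
  by rewrite (deriveCD _ (h1 f Hf) (k1 f Hf) (I : setT x)) h2// k2.
- by move=> f g Hf Hg; apply/funext => x; rewrite h3// k3// addrACA.
- by move=> m f Hm Wm Hf; apply/funext => x; rewrite h4// k4// mulrDr.
- by move=> f w Hf; apply/funext => x; rewrite h5// k5.
- move=> f rho B Hf HB x xr; rewrite mulrDl; apply: le_trans (mdD _ _) (lerD _ _).
    exact: (h6 f rho B).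
  exact: (k6 f rho B).
- exact: addr_ge0.
Qed.

Lemma good_zero W E : 0 <= E -> good W 0 E (fun _ _ => 0).
Proof.
move=> E0; split=> //.
- by move=> f _; apply: smooth_cst; exact: openT.
- by move=> f v _; apply/funext => x; rewrite deriveC_cst.
- by move=> f g _ _; apply/funext => x; rewrite addr0.
- by move=> m f _ _ _; apply/funext => x; rewrite mulr0.
- by move=> f rho B _ HB x xr; rewrite md0 mul0r.
Qed.

Lemma good_sum W E k (c : nat -> R) (T : nat -> (V -> C) -> V -> C) : 0 <= E ->
  (forall i, (i < k)%N -> good W (c i) E (T i)) ->
  good W (\sum_(i < k) c i) E (fun f x => \sum_(i < k) T i f x).
Proof.
move=> E0; elim: k => [|k IH] gT.
  rewrite big_ord0 (_ : (fun f x => _) = (fun _ _ => 0)); first exact: good_zero.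
  by apply/funext => f; apply/funext => x; rewrite big_ord0.
rewrite big_ord_recr/= (_ : (fun f x => _) = (fun f x => \sum_(i < k) T i f x + T k f x)).
  by apply: good_plus; [apply: IH => i ik; apply: gT; exact: ltnW|exact: gT].
by apply/funext => f; apply/funext => x; rewrite big_ord_recr.
Qed.

Lemma good_comp W c c' E E' T T' : good W c E T -> good W c' E' T' ->
  good W (c * c') (E + E') (T \o T').
Proof.
move=> [h1 h2 h3 h4 h5 h6 h7 h8] [k1 k2 k3 k4 k5 k6 k7 k8]; split=> //=.
- by move=> f Hf; apply/h1/k1.
- by move=> f v Hf; rewrite h2 ?k2//; exact: k1.
- by move=> f g Hf Hg; rewrite k3// h3//; exact: k1.
- by move=> m f Hm Wm Hf; rewrite k4// h4//; exact: k1.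
- by move=> f w Hf; rewrite k5// h5//; exact: k1.
- move=> f rho B Hf HB x xr; rewrite -mulrA; apply: (h6 (T' f) rho (c' * B)) => //.
    exact: k1.
  by move=> y yr; apply: (k6 f (rho + E) B) => // z zr; apply: HB; rewrite addrA.
- exact: mulr_ge0.
- exact: addr_ge0.
Qed.

(** The algebraic part of [good], without the bound: differential operators belong to it although
    they are not bounded for suprema, and they can be composed with the limits of translations. *)
Record regop W T : Prop := Regop {
  reg_smooth : forall f, sm f -> sm (T f);
  reg_derive : forall f v, sm f -> deriveC v (T f) = T (deriveC v f);
  reg_add : forall f g, sm f -> sm g ->
    T (fun x => f x + g x) = (fun x => T f x + T g x);
  reg_mul : forall m f, sm m -> (forall w x, W w -> m (x + w) = m x) -> sm f ->
    T (fun x => m x * f x) = (fun x => m x * T f x);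
  reg_shift : forall f w, sm f -> T (fun x => f (x + w)) = (fun x => T f (x + w)) }.

Lemma good_reg W c E T : good W c E T -> regop W T.
Proof. by case. Qed.

Lemma smooth_opp f : sm f -> sm (fun x => - f x).
Proof.
move=> Hf; apply: (smooth_eq openT) (smooth_scale (-1) openT Hf) => x _.
by rewrite mulN1r.
Qed.

Lemma smooth_subr f g : sm f -> sm g -> sm (fun x => f x - g x).
Proof. by move=> Hf Hg; apply: smooth_add => //; [exact: openT|exact: smooth_opp]. Qed.

Section Regular.
Variables (W : set V) (T : (V -> C) -> V -> C).
Hypothesis rT : regop W T.

Lemma reg_scalar k f : sm f -> T (fun x => k * f x) = (fun x => k * T f x).
Proof. by move=> Hf; apply: (reg_mul rT) => //; apply: smooth_cst; exact: openT. Qed.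

Lemma reg_opp f : sm f -> T (fun x => - f x) = (fun x => - T f x).
Proof.
move=> Hf; rewrite (_ : (fun x => - f x) = (fun x => (-1) * f x)).
  by rewrite (reg_scalar _ Hf); apply/funext => x; rewrite mulN1r.
by apply/funext => x; rewrite mulN1r.
Qed.

Lemma reg_sub f g : sm f -> sm g -> T (fun x => f x - g x) = (fun x => T f x - T g x).
Proof. by move=> Hf Hg; rewrite (reg_add rT) ?reg_opp//; exact: smooth_opp. Qed.

Lemma reg_zero : T (fun=> 0) = (fun=> 0).
Proof.
have := reg_scalar 0 (smooth_cst (0 : C) openT).
rewrite (_ : (fun x => 0 * 0) = (fun=> 0)); last by apply/funext => x; rewrite mul0r.
by move=> ->; apply/funext => x; rewrite mul0r.
Qed.

Lemma reg_sum (I : Type) (r : seq I) (P : pred I) (F : I -> V -> C) :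
  (forall i, P i -> sm (F i)) ->
  T (fun x => \sum_(i <- r | P i) F i x) = (fun x => \sum_(i <- r | P i) T (F i) x).
Proof.
move=> HF; elim: r => [|i r IH].
  rewrite (_ : (fun x => _) = (fun=> 0)); last by apply/funext => x; rewrite big_nil.
  by rewrite reg_zero; apply/funext => x; rewrite big_nil.
case Pi : (P i); last first.
  rewrite (_ : (fun x => \sum_(j <- i :: r | P j) F j x) = (fun x => \sum_(j <- r | P j) F j x)).
    by rewrite IH; apply/funext => x; rewrite big_cons Pi.
  by apply/funext => x; rewrite big_cons Pi.
rewrite (_ : (fun x => \sum_(j <- i :: r | P j) F j x) =
   (fun x => F i x + \sum_(j <- r | P j) F j x)).
  rewrite (reg_add rT (HF i Pi) (smooth_sum _ openT HF)) IH.
  by apply/funext => x; rewrite big_cons Pi.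
by apply/funext => x; rewrite big_cons Pi.
Qed.

Lemma reg_periodic e f : sm f -> (forall x, f (x + e) = f x) ->
  forall x, T f (x + e) = T f x.
Proof.
move=> Hf Pf x; have /(congr1 (fun h => h x)) <- := reg_shift rT e Hf.
by congr (T _ x); apply/funext => y; rewrite Pf.
Qed.

End Regular.

Lemma reg_comp W T T' : regop W T -> regop W T' -> regop W (T \o T').
Proof.
move=> [h1 h2 h3 h4 h5] [k1 k2 k3 k4 k5]; split=> //=.
- by move=> f Hf; apply/h1/k1.
- by move=> f v Hf; rewrite h2 ?k2//; exact: k1.
- by move=> f g Hf Hg; rewrite k3// h3//; exact: k1.
- by move=> m f Hm Wm Hf; rewrite k4// h4//; exact: k1.
- by move=> f w Hf; rewrite k5// h5//; exact: k1.
Qed.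

Lemma good_lucv W c E T (F : nat -> V -> C) f : good W c E T ->
  (forall k, sm (F k)) -> sm f -> lucv F f -> lucv (fun k => T (F k)) (T f).
Proof.
move=> gT sF Hf HF rho e e0.
have c1 : 0 < c + 1 by rewrite ltr_wpDl// (good_c0 gT).
have [N HN] := HF (rho + E) _ (divr_gt0 e0 c1); exists N => k Nk x xr.
have -> : T (F k) x - T f x = T (fun x => F k x - f x) x by rewrite (reg_sub (good_reg gT)).
apply: le_trans (good_bound gT (rho := rho) (B := e / (c + 1)) _ _ xr) _.
- exact: smooth_subr.
- by move=> y yr; apply: HN.
- rewrite mulrCA ler_piMr ?(ltW e0)// ler_pdivrMr// mul1r.
  by rewrite lerDl.
Qed.

Definition limop (T : nat -> (V -> C) -> V -> C) f x := clim (fun k => T k f x).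

Section Limit.
Variables (W : set V) (c E : R) (T : nat -> (V -> C) -> V -> C).
Hypotheses (gT : forall k, good W c E (T k))
  (cT : forall f, sm f -> lucauchy (fun k => T k f)).

Lemma limop_lucv f : sm f -> lucv (fun k => T k f) (limop T f).
Proof. by move=> Hf; apply/lucauchy_lucv/cT. Qed.

Lemma limop_derive f x v : sm f ->
  (derivable (fun y => complex.Re (limop T f y)) x v /\
   derivable (fun y => complex.Im (limop T f y)) x v) /\
  deriveC v (limop T f) x = limop T (deriveC v f) x.
Proof.
move=> Hf; apply: (lucv_derive (F := fun k => T k f)).
- by move=> k; apply: (good_smooth (gT k)).
- exact: limop_lucv.
- apply: (lucv_eq (F := fun k => T k (deriveC v f))).
    by move=> k; rewrite (good_derive (gT k)).
  exact/limop_lucv/smooth_deriveC.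
Qed.

Lemma limop_smooth f : sm f -> sm (limop T f).
Proof.
move=> Hf; apply: (smooth_coind (P := fun g => exists2 f, sm f & g = limop T f)); last by exists f.
move=> _ [g Hg ->]; split=> [x|v].
  apply: (lucv_continuous _ _ (limop_lucv Hg)) => k.
  exact: (good_smooth (gT k)).
split=> [x|]; first by have [] := limop_derive x v Hg.
exists (deriveC v g); first exact: smooth_deriveC.
by apply/funext => x; have [] := limop_derive x v Hg.
Qed.

(** Each identity holds for every [T k] and passes to the limit by uniqueness of locally uniform
    limits; the bound passes because [c] and [E] are the same for all k. *)
Lemma good_limit : good W c E (limop T).
Proof.
have g0 := gT 0; split.
- exact: limop_smooth.
- by move=> f v Hf; apply/funext => x; have [_ ->] := limop_derive x v Hf.
- move=> f g Hf Hg; apply: (lucv_unique (limop_lucv (smooth_add openT Hf Hg))).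
  apply: lucv_eq (lucv_add (limop_lucv Hf) (limop_lucv Hg)) => k.
  by rewrite (good_add (gT k)).
- move=> m f Hm Wm Hf; apply: (lucv_unique (limop_lucv (smooth_mul openT Hm Hf))).
  apply: lucv_eq (lucv_mul Hm (limop_lucv Hf)) => k.
  by rewrite (good_mul (gT k)).
- move=> f w Hf; apply: (lucv_unique (limop_lucv (smooth_shift w Hf))).
  apply: lucv_eq (lucv_shift w (limop_lucv Hf)) => k.
  by rewrite (good_shift (gT k)).
- move=> f rho B Hf HB x xr; apply/ler_addgt0Pl => e e0.
  have [N HN] := limop_lucv Hf rho e0.
  rewrite -(subrK (T N f x) (limop T f x)); apply: le_trans (mdD _ _) (lerD _ _).
    by rewrite mdB; apply: HN.
  exact: (good_bound (gT N) (rho := rho)).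
- exact: good_c0 g0.
- exact: good_E0 g0.
Qed.

(* [S] commutes with finite combinations of translations, hence with limits. *)
Lemma good_limit_comm W' c' E' S f : good W' c' E' S -> sm f ->
  (forall k g, sm g -> S (T k g) = T k (S g)) -> S (limop T f) = limop T (S f).
Proof.
move=> gS Hf ST.
have := good_lucv gS (fun k => good_smooth (gT k) Hf) (limop_smooth Hf) (limop_lucv Hf).
move=> H; apply: (lucv_unique H).
apply: lucv_eq (limop_lucv (good_smooth gS Hf)) => k.
by rewrite ST.
Qed.

End Limit.

Section Series.
Variables (W : set V) (E : R) (c : nat -> R) (T : nat -> (V -> C) -> V -> C) (M : R).
Hypotheses (gT : forall k, good W (c k) E (T k)).
Hypothesis cM : forall k, \sum_(i < k) c i <= M.

Definition partial (k : nat) f x := \sum_(i < k) T i f x.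
Definition serop := limop partial.

Lemma good_partial k : good W M E (partial k).
Proof.
apply: good_weaken (cM k) (lexx E) _; apply: good_sum; first exact: good_E0 (gT 0).
by move=> i _; exact: gT.
Qed.

(** The partial sums of the non-negative [c] increase to their supremum, so tails are small beyond
    an index where the supremum is nearly reached. With [good_bound] this yields the Weierstrass
    test for series of operators. *)
Lemma sum_cauchy e : 0 < e -> exists N, forall k l, (N <= k)%N -> (k <= l)%N ->
  \sum_(k <= i < l) c i <= e.
Proof.
move=> e0; pose u k := \sum_(i < k) c i.
have u1 : has_sup (range u).
  split; first by exists (u 0%N); exists 0%N.
  by exists M => _ [k _ <-]; exact: cM.
have [_ [N _ <-] HN] := sup_adherent e0 u1.
exists N => k l Nk kl.
have le_u i : u i <= sup (range u) by apply: sup_upper_bound => //; exists i.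
have inc i j : (i <= j)%N -> u j = u i + \sum_(i <= a < j) c a.
  by move=> ij; rewrite /u -!(big_mkord xpredT c) (@big_cat_nat _ _ _ i).
have pos i j : 0 <= \sum_(i <= a < j) c a.
  by apply: sumr_ge0 => a _; exact: good_c0 (gT a).
have := le_u l; rewrite (inc _ _ kl) (inc _ _ Nk) => H.
have := pos N k; move: H HN; lra.
Qed.

Lemma partial_cauchy f : sm f -> lucauchy (fun k => partial k f).
Proof.
move=> Hf rho e e0; have [B B0 HB] := smooth_bounded (rho + E) Hf.
have B1 : 0 < B + 1 by rewrite ltr_wpDl.
have [N HN] := sum_cauchy (divr_gt0 e0 B1); exists N.
have H k l x : (N <= k)%N -> (k <= l)%N -> `|x| <= rho ->
    md (partial l f x - partial k f x) <= e.
  move=> Nk kl xr.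
  rewrite /partial -!(big_mkord xpredT (fun i => T i f x)) (@big_cat_nat _ _ _ k)//=.
  rewrite addrAC subrr add0r; apply: le_trans (md_sum _ _ _) _.
  apply: le_trans (_ : \sum_(k <= i < l) c i * (B + 1) <= _).
    apply: ler_sum => i _; apply: (good_bound (gT i) (rho := rho)) => // y yr.
    by apply: le_trans (HB y yr) _; rewrite lerDl.
  by rewrite -mulr_suml -ler_pdivlMr// HN.
move=> k l Nk Nl x xr; case: (leqP k l) => [kl|/ltnW lk]; last exact: H.
by rewrite mdB; apply: H.
Qed.

Lemma good_serop : good W M E serop.
Proof. by apply: good_limit; [exact: good_partial|exact: partial_cauchy]. Qed.

Lemma serop_lucv f : sm f -> lucv (fun k => partial k f) (serop f).
Proof. exact: (limop_lucv partial_cauchy). Qed.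

End Series.

End GoodOperators.

(** * Integrals along segments as limits of Riemann sums *)

Section RiemannSums.
Context {R : realType} {n : nat}.
Local Notation V := (Cn R n).
Local Notation C := R[i].
Implicit Types (f g m : V -> C) (x v w e : V) (rho K : R) (kap : R -> C) (W : set V).
Local Notation sm := (@smooth R V setT).

Definition klip K kap :=
  (forall r : R, 0 <= r <= 1 -> md (kap r) <= K) /\
  (forall r s : R, 0 <= r <= 1 -> 0 <= s <= 1 -> md (kap r - kap s) <= K * `|r - s|).

(** Left Riemann sum for the integral of kap(r) f(x + r e) over 0 <= r <= 1. It is a finite
    combination of translations along [e], so it is [good], and its limit [rop] is too. *)
Definition rsum kap e (k : nat) f x : C :=
  k%:R^-1 * \sum_(a < k) (kap (a%:R / k%:R) * f (x + (a%:R / k%:R) *: e)).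

Lemma ratio01 a k : (a <= k)%N -> 0 <= (a%:R / k%:R : R) <= 1.
Proof.
move=> ak; rewrite divr_ge0//=; case: k ak => [|k] ak; first by rewrite invr0 mulr0.
by rewrite ler_pdivrMr ?ltr0n// mul1r ler_nat.
Qed.

Lemma klip_K0 K kap : klip K kap -> 0 <= K.
Proof. by move=> [/(_ 0) + _]; rewrite lexx ler01 => /(_ isT); apply: le_trans; exact: md_ge0. Qed.

Lemma good_rsum W (c : R) kap e k : (forall r : R, 0 <= r <= 1 -> md (kap r) <= c) ->
  (forall r : R, W (r *: e)) -> (0 < k)%N -> good W c `|e| (rsum kap e k).
Proof.
move=> kK We k0.
have gT (a : nat) : (a < k)%N ->
    good W c `|e| (fun f x => kap (a%:R / k%:R) * f (x + (a%:R / k%:R) *: e)).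
  move=> ak; have /andP[r0 r1] := ratio01 (ltnW ak).
  apply: good_weaken (good_scale _ (good_translation (We (a%:R / k%:R)))).
    by rewrite mulr1; apply: kK; rewrite r0 r1.
  by rewrite normrZ ger0_norm// ler_piMl.
have G := good_scale (k%:R^-1) (good_sum (c := fun=> c) (normr_ge0 e) gT).
apply: good_weaken G => //.
rewrite sumr_const card_ord mdV md_nat -[c *+ k]mulr_natl mulKf//.
by rewrite pnatr_eq0 -lt0n.
Qed.

Lemma product_lipschitz K kap e f rho : klip K kap -> sm f -> exists2 L, 0 <= L &
  forall x (r s : R), 0 <= r <= 1 -> 0 <= s <= 1 -> `|x| <= rho ->
    md (kap r * f (x + r *: e) - kap s * f (x + s *: e)) <= L * `|r - s|.
Proof.
move=> kK Hf; have K0 := klip_K0 kK.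
have [L L0 HL] := smooth_lipschitz e (rho + `|e|) Hf.
have [B B0 HB] := smooth_bounded (rho + `|e|) Hf.
exists (K * B + K * L) => [|x r s]; first by rewrite addr_ge0// mulr_ge0.
wlog sr : r s / s <= r.
  move=> H r01 s01 xr; case: (leP s r) => [sr|/ltW rs]; first exact: H.
  by rewrite mdB distrC; apply: H.
move=> r01 s01 xr; have /andP[r0 r1] := r01; have /andP[s0 s1] := s01.
have -> : kap r * f (x + r *: e) - kap s * f (x + s *: e) =
  (kap r - kap s) * f (x + s *: e) + kap r * (f (x + s *: e + (r - s) *: e) - f (x + s *: e)).
  rewrite -addrA -scalerDl [s + _]addrC subrK; ring.
have xs : `|x + s *: e| <= rho + `|e| by apply: norm_shift_le.
apply: le_trans (mdD _ _) _; rewrite [(K * B + _) * _]mulrDl !mdM lerD//.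
  rewrite mulrAC; apply: ler_pM; rewrite ?md_ge0//; first exact: kK.2.
  exact: HB.
rewrite -mulrA; apply: ler_pM; rewrite ?md_ge0//; first exact: kK.1.
rewrite [`|r - s|]ger0_norm ?subr_ge0//; apply: HL => //.
by rewrite subr_ge0 sr lerBlDr (le_trans r1)// lerDl.
Qed.

Lemma sum_mul_nat (F : nat -> C) a b :
  \sum_(i < a * b) F i = \sum_(i < a) \sum_(j < b) F (i * b + j)%N.
Proof.
elim: a => [|a IH]; first by rewrite mul0n !big_ord0.
rewrite big_ord_recr/= -IH mulSn addnC -!(big_mkord xpredT F).
rewrite (@big_cat_nat _ _ _ (a * b)%N) ?leq_addr//=; congr (_ + _).
rewrite -{1}[(a * b)%N]add0n big_addn addKn big_mkord.
by apply: eq_bigr => j _; rewrite addnC.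
Qed.

(** Subdivisions of k and of l steps are not nested, so they are compared through k l steps. Each
    new node is within 1/k of the old node that it replaces. *)
Lemma rsum_refine kap e f x L k j : (0 < k)%N -> (0 < j)%N -> 0 <= L ->
  (forall r s : R, 0 <= r <= 1 -> 0 <= s <= 1 ->
    md (kap r * f (x + r *: e) - kap s * f (x + s *: e)) <= L * `|r - s|) ->
  md (rsum kap e (k * j) f x - rsum kap e k f x) <= L * k%:R^-1.
Proof.
move=> k0 j0 L0 HL; pose p r := kap r * f (x + r *: e).
have k0' : (k%:R : C) != 0 by rewrite pnatr_eq0 -lt0n.
have j0' : (j%:R : C) != 0 by rewrite pnatr_eq0 -lt0n.
have kR : (0 : R) < k%:R by rewrite ltr0n.
have jR : (0 : R) < j%:R by rewrite ltr0n.
have -> : rsum kap e (k * j) f x - rsum kap e k f x =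
   (k * j)%:R^-1 * \sum_(a < k) \sum_(b < j)
     (p ((a * j + b)%:R / (k * j)%:R) - p (a%:R / k%:R)).
  rewrite /rsum (sum_mul_nat (fun i => p (i%:R / (k * j)%:R))).
  under [in RHS]eq_bigr do rewrite sumrB sumr_const card_ord.
  rewrite sumrB mulrBr; congr (_ - _).
  by rewrite sumrMnl -[(\sum_(i < k) _) *+ j]mulr_natl mulrA natrM invfM mulfVK.
rewrite mdM mdV md_nat ler_pdivrMl; last by rewrite ltr0n muln_gt0 k0.
apply: le_trans (md_sum _ _ _) _.
apply: le_trans (_ : \sum_(a < k) \sum_(b < j) L * k%:R^-1 <= _); last first.
  by rewrite !sumr_const !card_ord -mulrnA [leRHS]mulr_natl mulnC.
apply: ler_sum => a _; apply: le_trans (md_sum _ _ _) _; apply: ler_sum => b _.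
have aj : (a * j + b < k * j)%N.
  apply: leq_trans (_ : a.+1 * j <= _)%N; last by rewrite leq_mul2r (ltn_ord a) orbT.
  by rewrite mulSn addnC ltn_add2r.
apply: le_trans (HL _ _ (ratio01 (ltnW aj)) (ratio01 (ltnW (ltn_ord a)))) _.
rewrite ler_wpM2l//.
have -> : (a * j + b)%:R / (k * j)%:R - a%:R / k%:R = b%:R / j%:R / k%:R :> R.
  rewrite natrD !natrM; field.
  by rewrite !gt_eqF.
have /andP[b0 b1] := ratio01 (ltnW (ltn_ord b)).
rewrite ger0_norm; last by rewrite mulr_ge0// invr_ge0.
by rewrite ler_piMl// invr_ge0.
Qed.

Lemma rsum_cauchy K kap e f : klip K kap -> sm f ->
  lucauchy (fun k => rsum kap e k.+1 f).
Proof.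
move=> kK Hf rho eps e0; have [L L0 HL] := product_lipschitz e rho kK Hf.
have L1 : 0 < 2 * L + 1 by rewrite ltr_wpDl// mulr_ge0.
have [N HN] := invn_cvg0 (divr_gt0 e0 L1); exists N => k l Nk Nl x xr.
have HLx r s r1 s1 := HL x r s r1 s1 xr.
have H1 := @rsum_refine kap e f x L k.+1 l.+1 isT isT L0 HLx.
have H2 := @rsum_refine kap e f x L l.+1 k.+1 isT isT L0 HLx.
rewrite mulnC in H2.
have -> : rsum kap e k.+1 f x - rsum kap e l.+1 f x =
   (rsum kap e (k.+1 * l.+1) f x - rsum kap e l.+1 f x) -
   (rsum kap e (k.+1 * l.+1) f x - rsum kap e k.+1 f x) by ring.
apply: le_trans (mdD _ _) _; rewrite mdN; apply: le_trans (lerD H2 H1) _.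
rewrite -mulrDr; apply: le_trans (_ : L * (eps / (2 * L + 1) + eps / (2 * L + 1)) <= _).
  by rewrite ler_wpM2l// lerD// HN.
rewrite -mulrDl mulrA ler_pdivrMr//.
have := ltW e0; nra.
Qed.

Definition rop kap e := limop (fun k => rsum kap e k.+1 : (V -> C) -> V -> C).

Lemma good_rop W (c : R) K kap e : klip K kap ->
  (forall r : R, 0 <= r <= 1 -> md (kap r) <= c) -> (forall r : R, W (r *: e)) ->
  good W c `|e| (rop kap e).
Proof.
move=> kK kc We; apply: good_limit => [k|f]; first exact: good_rsum.
exact: rsum_cauchy kK.
Qed.

Lemma rop_lucv K kap e f : klip K kap -> sm f ->
  lucv (fun k => rsum kap e k.+1 f) (rop kap e f).
Proof. by move=> kK Hf; apply: limop_lucv => // g; exact: rsum_cauchy kK. Qed.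

Lemma good_rsum_comm W c E S kap e k f : good W c E S -> sm f ->
  S (rsum kap e k f) = rsum kap e k (S f).
Proof.
move=> gS Hf; rewrite /rsum.
have sF (a : 'I_k) : sm (fun x => kap (a%:R / k%:R) * f (x + (a%:R / k%:R) *: e)).
  by apply: smooth_scale; [exact: openT|exact: smooth_shift].
rewrite (reg_scalar (good_reg gS)) ?(reg_sum (good_reg gS)) //; last first.
  by apply: smooth_sum => //; exact: openT.
apply/funext => x; congr (_ * _); apply: eq_bigr => a _.
rewrite (reg_scalar (good_reg gS)); last exact: smooth_shift.
by rewrite (good_shift gS).
Qed.

Lemma good_rop_comm W c E S K kap e f : good W c E S -> klip K kap -> sm f ->
  S (rop kap e f) = rop kap e (S f).
Proof.
move=> gS kK Hf.
apply: (good_limit_comm (W := setT) (c := K) (E := `|e|)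
  (T := fun k => rsum kap e k.+1) _ _ gS Hf) => [k|g Hg|k g Hg].
- by apply: good_rsum => //; exact: kK.1.
- exact: rsum_cauchy kK Hg.
- exact: good_rsum_comm gS Hg.
Qed.

(* Integration by parts: [(kap p)' = kap' p + kap p'] along [e]. *)
Lemma rop_by_parts K kap kap' e f x : klip K kap -> klip K kap' ->
  (forall r h : R, 0 <= r <= 1 -> 0 <= h -> 0 <= r + h <= 1 ->
    md (kap (r + h) - kap r - h%:C%C * kap' r) <= K * (h * h)) ->
  sm f ->
  rop kap e (deriveC e f) x + rop kap' e f x = kap 1 * f (x + e) - kap 0 * f x.
Proof.
move=> kK kK' HK Hf; have K0 := klip_K0 kK.
have Hdf := smooth_deriveC e Hf; pose rho := `|x| + `|e|.
have [L L0 HL] := smooth_lipschitz_derive e rho Hf.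
have [B B0 HB] := smooth_bounded rho Hf.
have [B' B'0 HB'] := smooth_bounded rho Hdf.
pose p r := kap r * f (x + r *: e).
pose p' r := kap r * deriveC e f (x + r *: e) + kap' r * f (x + r *: e).
pose M := K * L + K * B + K * B'.
have M0 : 0 <= M by rewrite !addr_ge0// mulr_ge0.
have Hp r h : 0 <= r <= 1 -> 0 <= h -> 0 <= r + h <= 1 ->
    md (p (r + h) - p r - h%:C%C * p' r) <= M * (h * h).
  move=> r01 h0 /[dup] rh01 /andP[_ rh1]; have /andP[r0 r1] := r01.
  have xs : `|x + r *: e| <= rho by apply: norm_shift_le.
  (* The remainder of the product rule splits into the second order remainder of [f], that of [kap],
     and a product of two first order increments; these give the three terms of [M]. *)
  have -> : p (r + h) - p r - h%:C%C * p' r =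
    kap (r + h) * (f (x + r *: e + h *: e) - f (x + r *: e) - h%:C%C * deriveC e f (x + r *: e))
    + (kap (r + h) - kap r - h%:C%C * kap' r) * f (x + r *: e)
    + (kap (r + h) - kap r) * (h%:C%C * deriveC e f (x + r *: e)).
    rewrite /p /p' scalerDl addrA; ring.
  rewrite /M [(K * L + _ + _) * _]mulrDl [(K * L + _) * _]mulrDl.
  apply: le_trans (mdD _ _) (lerD _ _); last first.
    rewrite !mdM md_real ger0_norm//.
    apply: le_trans (_ : (K * h) * (h * B') <= _); last by rewrite le_eqVlt; apply/orP; left; apply/eqP; ring.
    apply: ler_pM; rewrite ?md_ge0 ?mulr_ge0 ?md_ge0//.
      have := kK.2 _ _ rh01 r01; rewrite [r + h]addrC addrK (ger0_norm h0).
      exact.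
    by rewrite ler_wpM2l// HB'.
  apply: le_trans (mdD _ _) (lerD _ _); rewrite mdM.
    rewrite -[K * L * _]mulrA; apply: ler_pM; rewrite ?md_ge0//; first exact: kK.1.
    apply: HL => //; rewrite h0/=; apply: le_trans rh1; by rewrite lerDr.
  rewrite mulrAC; apply: ler_pM; rewrite ?md_ge0//; [exact: HK|exact: HB].
apply/eqP; rewrite -subr_eq0; apply/eqP; apply: (@md_le_small _ _ (M + 2)) => eps e0.
have [N1 H1] := rop_lucv e kK Hdf `|x| e0.
have [N2 H2] := rop_lucv e kK' Hf `|x| e0.
have [N3 H3] := invn_cvg0 e0.
pose k := maxn N1 (maxn N2 N3).
have {}H1 := H1 k (leq_maxl _ _) x (lexx _).
have {}H2 := H2 k (leq_trans (leq_maxl _ _) (leq_maxr _ _)) x (lexx _).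
have {}H3 := H3 k (leq_trans (leq_maxr _ _) (leq_maxr _ _)).
have k0 : (k.+1%:R : R) != 0 by rewrite pnatr_eq0.
(* The boundary term telescopes over the nodes; each of the k + 1 steps contributes an error M / (k
   + 1)^2. *)
have H4 : md (rsum kap e k.+1 (deriveC e f) x + rsum kap' e k.+1 f x -
    (kap 1 * f (x + e) - kap 0 * f x)) <= M * k.+1%:R^-1.
  have -> : kap 1 * f (x + e) - kap 0 * f x =
      \sum_(a < k.+1) (p (a.+1%:R / k.+1%:R) - p (a%:R / k.+1%:R)).
    rewrite -(big_mkord xpredT (fun a => p (a.+1%:R / k.+1%:R) - p (a%:R / k.+1%:R))).
    rewrite (telescope_sumr (fun a => p (a%:R / k.+1%:R)))//.
    by rewrite mulfV// mul0r /p scale1r scale0r addr0.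
  have -> : rsum kap e k.+1 (deriveC e f) x + rsum kap' e k.+1 f x =
      \sum_(a < k.+1) (k.+1%:R^-1)%:C%C * p' (a%:R / k.+1%:R).
    rewrite /rsum -mulrDr -big_split -mulr_sumr fmorphV rmorph_nat.
    by [].
  rewrite -sumrB; apply: le_trans (md_sum _ _ _) _.
  apply: le_trans (_ : \sum_(a < k.+1) M * (k.+1%:R^-1 * k.+1%:R^-1) <= _); last first.
    by rewrite sumr_const card_ord -[leLHS]mulr_natl mulrCA [k.+1%:R * _]mulrA mulfV// mul1r.
  apply: ler_sum => a _; rewrite mdB.
  have E1 : a.+1%:R / k.+1%:R = a%:R / k.+1%:R + k.+1%:R^-1 :> R.
    by rewrite -addn1 natrD mulrDl mul1r.
  rewrite E1; apply: Hp; first exact/ratio01/ltnW/ltn_ord.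
    by rewrite invr_ge0.
  by rewrite -E1; apply: ratio01; exact: ltn_ord.
set A := rop kap e (deriveC e f) x in H1 *; set A' := rop kap' e f x in H2 *.
set S := rsum kap e k.+1 (deriveC e f) x in H1 H4; set S' := rsum kap' e k.+1 f x in H2 H4.
set F := kap 1 * f (x + e) - _ in H4 *.
have -> : A + A' - F = (S + S' - F) - (S - A) - (S' - A') by ring.
apply: le_trans (mdD _ _) _; rewrite mdN.
have -> : eps * (M + 2) = M * eps + eps + eps by ring.
apply: lerD => //; apply: le_trans (mdD _ _) _; rewrite mdN lerD//.
by apply: le_trans H4 _; rewrite ler_wpM2l.
Qed.

Lemma rsum_periodic kap e k f x : (forall r : R, f (x + r *: e) = f x) ->
  (forall r, kap r = 1) -> (0 < k)%N -> rsum kap e k f x = f x.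
Proof.
move=> Hf Hk k0; rewrite /rsum.
under eq_bigr do rewrite Hf Hk mul1r.
by rewrite sumr_const card_ord -[f x *+ k]mulr_natl mulKf// pnatr_eq0 -lt0n.
Qed.

Lemma rop_invariant e f : sm f -> (forall x (r : R), f (x + r *: e) = f x) ->
  rop (fun=> 1) e f = f.
Proof.
move=> Hf He.
have k1 : klip 1 (fun=> 1 : C).
  split=> [r _|r s _ _]; rewrite ?md1// subrr md0 mul1r //.
apply: (lucv_unique (rop_lucv e k1 Hf)).
apply: (lucv_eq (F := fun k => f)) => [k|rho eps e0].
  by apply/funext => x; rewrite rsum_periodic.
by exists 0%N => k _ x _; rewrite subrr md0 ltW.
Qed.

Lemma rop_scale_kernel K kap (c : C) e f : klip K kap -> sm f ->
  rop (fun r => c * kap r) e f = (fun x => c * rop kap e f x).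
Proof.
move=> kK Hf; have K0 := klip_K0 kK.
have kc : klip (md c * K) (fun r => c * kap r).
  split=> [r r01|r s r01 s01]; first by rewrite mdM ler_wpM2l ?md_ge0// kK.1.
  by rewrite -mulrBr mdM -mulrA ler_wpM2l ?md_ge0// kK.2.
apply: (lucv_unique (rop_lucv e kc Hf)).
apply: lucv_eq (lucv_mul (smooth_cst c openT) (rop_lucv e kK Hf)) => k.
apply/funext => x; rewrite /rsum mulrCA; congr (_ * _); rewrite mulr_sumr.
by apply: eq_bigr => a _; rewrite mulrA.
Qed.

Lemma derive0_invariant e f x (r : R) : sm f -> deriveC e f = (fun=> 0) ->
  f (x + r *: e) = f x.
Proof.
move=> Hf H0; apply/eqP; rewrite -subr_eq0; apply/eqP/md_small => eps e0.
have -> : eps = eps / 2 + eps / 2 by rewrite -splitr.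
apply: smooth_increment => // q _.
by rewrite deriveC_scale_dir// H0 mulr0 md0 divr_ge0// ltW.
Qed.

End RiemannSums.

(** * Fourier coefficients *)

Section Cis.
Context {R : realType}.
Local Notation C := R[i].
Implicit Types (a b t h x : R).

Definition cis t : C := (cos t +i* sin t)%C.
Definition iC : C := (0 +i* 1)%C.

Lemma cisD a b : cis (a + b) = cis a * cis b.
Proof. by apply: ReIm_inj; rewrite /cis ?cReM ?cImM /= ?cosD ?sinD//; ring. Qed.

Lemma cis0 : cis 0 = 1.
Proof. by rewrite /cis cos0 sin0. Qed.

Lemma md_cis t : md (cis t) = 1.
Proof. by rewrite /md/= cos2Dsin2 sqrtr1. Qed.

Lemma cis_neq0 t : cis t != 0.
Proof. by apply/eqP => t0; have := md_cis t; rewrite t0 md0 => /esym/eqP; rewrite oner_eq0. Qed.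

Lemma cisMn t k : cis (t *+ k) = cis t ^+ k.
Proof. by elim: k => [|k IH]; rewrite ?mulr0n ?cis0 ?expr0// mulrS exprS cisD IH. Qed.

Lemma cisN t : cis (- t) = (cis t)^-1.
Proof.
apply: (mulfI (cis_neq0 t)); rewrite -cisD subrr cis0 mulfV//.
exact: cis_neq0.
Qed.

Lemma cis_2pi : cis (pi *+ 2) = 1.
Proof. by rewrite /cis cos2pi sin2pi. Qed.

Lemma cis_2pi_int (k : int) : cis (pi *+ 2 * k%:~R) = 1.
Proof.
case: k => k; first by rewrite -pmulrn mulr_natr cisMn cis_2pi expr1n.
by rewrite NegzE mulrNz mulrN cisN -pmulrn mulr_natr cisMn cis_2pi expr1n invr1.
Qed.

Lemma increment_le (g dg : R -> R) (B h : R) : 0 <= h ->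
  (forall t, is_derive t 1 g (dg t)) -> (forall t, 0 <= t <= h -> `|dg t| <= B) ->
  `|g h - g 0| <= B * h.
Proof.
move=> h0 Hd HB.
have [|t t01 ->] := MVT_segment h0 (fun t _ => Hd t).
  by apply: derivable_within_continuous => t _; have [] := Hd t.
by rewrite subr0 normrM (ger0_norm h0) ler_wpM2r// HB.
Qed.

Lemma sin_le h : 0 <= h -> `|sin h| <= h.
Proof.
move=> h0; have := @increment_le (@sin R) (@cos R) 1 h h0 (fun t => is_derive_sin t).
by rewrite sin0 subr0 mul1r; apply=> t _; exact: cos_max.
Qed.

Lemma cosB1_le h : 0 <= h -> `|cos h - 1| <= h * h.
Proof.
move=> h0; have := @increment_le (@cos R) (fun t : R => - sin t) h h h0 (fun t => is_derive_cos t).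
rewrite cos0; apply=> t /andP[t0 th]; rewrite normrN.
exact: le_trans (sin_le t0) th.
Qed.

Lemma cosB1_le1 h : 0 <= h -> `|cos h - 1| <= h.
Proof.
move=> h0; have := @increment_le (@cos R) (fun t : R => - sin t) 1 h h0 (fun t => is_derive_cos t).
rewrite cos0 mul1r; apply=> t _; rewrite normrN; exact: sin_max.
Qed.

Lemma sinB_le h : 0 <= h -> `|sin h - h| <= h * h.
Proof.
move=> h0.
have D t : is_derive t 1 (fun t => sin t - t) (cos t - 1) by apply: is_deriveB.
have := increment_le (B := h) h0 D; rewrite sin0 !subr0; apply=> t /andP[t0 th].
exact: le_trans (cosB1_le1 t0) th.
Qed.

Lemma cisB1_le h : md (cis h - 1) <= 2 * `|h|.
Proof.
wlog h0 : h / 0 <= h.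
  move=> H; case: (leP 0 h) => [|/ltW h0]; first exact: H.
  have -> : cis h - 1 = - (cis h * (cis (- h) - 1)).
    rewrite mulrBr -cisD subrr cis0; ring.
  by rewrite mdN mdM md_cis mul1r -normrN H// oppr_ge0.
rewrite ger0_norm// mulr_natl mulr2n; apply: le_trans (md_ReIm _) (lerD _ _).
  by rewrite cReD cReN/= cosB1_le1.
by rewrite cImD cImN/= subr0 sin_le.
Qed.

Lemma cisB1i_le h : 0 <= h -> md (cis h - 1 - iC * h%:C%C) <= 2 * (h * h).
Proof.
move=> h0; rewrite mulr_natl mulr2n; apply: le_trans (md_ReIm _) (lerD _ _).
  rewrite !cReD !cReN cReM/= !mul0r mul1r subr0 subr0; exact: cosB1_le.
rewrite !cImD !cImN cImM/= subr0 mul0r mul1r add0r; exact: sinB_le.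
Qed.

Lemma cisB1i_le_neg h : 0 <= h -> md (cis (- h) - 1 + iC * h%:C%C) <= 2 * (h * h).
Proof.
move=> h0; rewrite mulr_natl mulr2n; apply: le_trans (md_ReIm _) (lerD _ _).
  rewrite !cReD !cReN cReM/= !mul0r mul1r subr0 addr0 cosN; exact: cosB1_le.
rewrite !cImD !cImN cImM/= subr0 mul0r mul1r add0r sinN addrC -normrN opprD opprK addrC.
exact: sinB_le.
Qed.

(** With x = 2 y, sin x = 2 sin y cos y and sin y = y cos t for some t in [0, y]. On [0, pi/4] the
    square of the cosine is at least 1/2, so cos t cos y is at least 1/2. *)
Lemma sin_ge_half x : 0 <= x <= pi / 2 -> x / 2 <= sin x.
Proof.
have [y xy] : exists y, x = y + y by exists (x / 2); rewrite -splitr.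
rewrite {x}xy => /andP[yy0 xp]; have y0 : 0 <= y by move: yy0; lra.
have -> : (y + y) / 2 = y by field.
have Hc t : 0 <= t <= y -> 0 <= cos t /\ 1 / 2 <= cos t * cos t.
  move=> /andP[t0 ty]; have p0 := @pi_ge0 R; split.
    apply: cos_ge0_pihalf; apply/andP; split; first by move: p0 t0; lra.
    by move: ty xp y0; lra.
  have : 0 <= cos (t *+ 2).
    apply: cos_ge0_pihalf; apply/andP; split; rewrite [t *+ 2]mulr2n; first by move: p0 t0; lra.
    by move: ty xp; lra.
  rewrite cos_mulr2n [cos t ^+ 2 *+ 2]mulr2n expr2; lra.
have [|t t01] := MVT_segment y0 (fun t _ => is_derive_sin t).
  by apply: derivable_within_continuous => t _; exact: derivable_sin.
rewrite in_itv /= in t01; rewrite sin0 !subr0 => Es.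
have [ct ct2] := Hc t t01.
have [cy cy2] : 0 <= cos y /\ 1 / 2 <= cos y * cos y by apply: Hc; rewrite y0 lexx.
have H2 : 1 / 2 <= cos t * cos y.
  have p0 : 0 <= cos t * cos y by rewrite mulr_ge0.
  rewrite -(@ler_pXn2r _ 2)// ?nnegrE ?divr_ge0//.
  by rewrite !expr2 [leRHS]mulrACA ler_pM// divr_ge0.
rewrite -mulr2n sin_mulr2n Es; apply: le_trans (_ : y * (2 * (1 / 2)) <= _).
  by move: y0; lra.
rewrite (_ : _ *+ 2 = y * (2 * (cos t * cos y))); last by rewrite -mulr_natl; ring.
by rewrite ler_wpM2l// ler_wpM2l.
Qed.

Lemma cisB1_ge x : - pi <= x <= pi -> `|x| / 2 <= md (cis x - 1).
Proof.
move=> xp.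
have H t : 0 <= t <= pi -> t / 2 <= md (cis t - 1).
  move=> /andP[t0 tp].
  have -> : cis t - 1 = cis (t / 2) * (cis (t / 2) - cis (- (t / 2))).
    by rewrite mulrBr -!cisD subrr cis0 -splitr.
  have -> : cis (t / 2) - cis (- (t / 2)) = iC * (sin (t / 2) + sin (t / 2))%:C%C.
    apply: ReIm_inj; rewrite ?(cReD, cImD, cReN, cImN, cReM, cImM) /cis /= ?cosN ?sinN; ring.
  rewrite mdM md_cis mul1r !mdM md_real.
  rewrite (_ : md iC = 1) ?mul1r; last by rewrite /md/= expr0n/= add0r expr1n sqrtr1.
  have := @sin_ge_half (t / 2); have := ler_norm (sin (t / 2) + sin (t / 2)).
  have -> : 0 <= t / 2 <= pi / 2 by rewrite divr_ge0//= ler_pM2r.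
  by move=> H1 /(_ isT) H2; move: H1 H2; lra.
case: (leP 0 x) => x0.
  by rewrite ger0_norm//; apply: H; rewrite x0; move/andP: xp => [].
have -> : cis x - 1 = - (cis x * (cis (- x) - 1)).
  rewrite mulrBr -cisD subrr cis0; ring.
rewrite mdN mdM md_cis mul1r ltr0_norm//; apply: H.
by rewrite oppr_ge0 ltW//= lerNl; move/andP: xp => [].
Qed.

(** One constant that meets all the hypotheses of [rop_by_parts] for the kernel exp(-i c r) and its
    derivative. *)
Lemma klip_cis (c : R) : exists K : R, [/\ klip K (fun r => cis (- (c * r))),
  klip K (fun r => - iC * c%:C%C * cis (- (c * r))) &
  forall r h : R, 0 <= r <= 1 -> 0 <= h -> 0 <= r + h <= 1 ->
    md (cis (- (c * (r + h))) - cis (- (c * r)) -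
       h%:C%C * (- iC * c%:C%C * cis (- (c * r)))) <= K * (h * h)].
Proof.
pose d := `|c|; have d0 : 0 <= d by exact: normr_ge0.
have mi : md iC = 1 by rewrite /md/= expr0n/= add0r expr1n sqrtr1.
have L r s : md (cis (- (c * r)) - cis (- (c * s))) <= 2 * d * `|r - s|.
  have -> : cis (- (c * r)) - cis (- (c * s)) = cis (- (c * s)) * (cis (- (c * (r - s))) - 1).
    rewrite mulrBr -cisD mulr1; congr (cis _ - _); ring.
  rewrite mdM md_cis mul1r; apply: le_trans (cisB1_le _) _.
  by rewrite normrN normrM mulrA.
pose K := 1 + 2 * d + d + 2 * (d * d).
have K1 : 1 <= K by rewrite /K; nra.
have K2 : 2 * d <= K by rewrite /K; nra.
have K3 : d <= K by rewrite /K; nra.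
have K4 : 2 * (d * d) <= K by rewrite /K; nra.
exists K; split.
- split=> [r _|r s _ _]; first by rewrite md_cis.
  by apply: le_trans (L r s) _; rewrite ler_wpM2r.
- split=> [r _|r s _ _]; first by rewrite mdM md_cis mulr1 mdM mdN mi md_real mul1r.
  rewrite -mulrBr mdM mdM mdN mi md_real mul1r -/d.
  apply: le_trans (ler_wpM2l d0 (L r s)) _; rewrite mulrA ler_wpM2r//.
  by apply: le_trans K4; rewrite mulrCA.
- move=> r h _ h0 _.
  have -> : cis (- (c * (r + h))) - cis (- (c * r)) - h%:C%C * (- iC * c%:C%C * cis (- (c * r)))
     = cis (- (c * r)) * (cis (- (c * h)) - 1 + iC * (c * h)%:C%C).
    have -> : cis (- (c * (r + h))) = cis (- (c * r)) * cis (- (c * h)).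
      by rewrite -cisD; congr cis; ring.
    rewrite rmorphM/=; ring.
  rewrite mdM md_cis mul1r; apply: le_trans (_ : 2 * (d * d) * (h * h) <= _); last first.
    by rewrite ler_wpM2r// mulr_ge0.
  rewrite -mulrA mulrACA; case: (leP 0 c) => c0.
    rewrite /d (ger0_norm c0) [in leRHS]mulrA -mulrA; apply: le_trans (cisB1i_le_neg _) _ => //.
    by rewrite mulr_ge0.
  have -> : c * h = - (d * h) by rewrite /d ltr0_norm// mulNr opprK.
  rewrite opprK rmorphN mulrN; apply: le_trans (cisB1i_le _) _ => //.
  by rewrite mulr_ge0.
Qed.

End Cis.

Section FourierCoefficients.
Context {R : realType} {n : nat}.
Local Notation V := (Cn R n).
Local Notation C := R[i].
Implicit Types (f g : V -> C) (x v w e : V) (c : R) (k l : int) (m : nat) (W : set V).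
Local Notation sm := (@smooth R V setT).

Definition iota_freq k : R := pi *+ 2 * k%:~R.
Definition ker c (r : R) : C := cis (- (c * r)).
(** For [f] of period [e] this is the k-th Fourier component along [e]: the coefficient together
    with its character, hence again a function on the whole space, to which operators can be
    applied. *)
Definition Acoef e k : (V -> C) -> V -> C := rop (ker (iota_freq k)) e.
Definition freq k : C := iC * (iota_freq k)%:C%C.

Lemma klip_ker c : exists K : R, klip K (ker c).
Proof. by have [K [H _ _]] := klip_cis c; exists K. Qed.

Lemma md_ker c (r : R) : md (ker c r) = 1. Proof. exact: md_cis. Qed.

Lemma good_A W e k : (forall r : R, W (r *: e)) -> good W 1 `|e| (Acoef e k).
Proof.
move=> We; have [K kK] := klip_ker (iota_freq k).
by apply: good_rop kK _ We => r _; rewrite md_ker.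
Qed.

Lemma good_AT e k : good setT 1 `|e| (Acoef e k). Proof. exact: good_A. Qed.

Lemma rop_ker_by_parts c e f : sm f ->
  (fun x => rop (ker c) e (deriveC e f) x - iC * c%:C%C * rop (ker c) e f x) =
  (fun x => cis (- c) * f (x + e) - f x).
Proof.
move=> Hf; apply/funext => x; have [K [k1 k2 k3]] := klip_cis c.
have := @rop_by_parts _ _ K _ _ e f x k1 k2 k3 Hf.
rewrite (rop_scale_kernel (- iC * c%:C%C) e k1 Hf) /= mulr0 oppr0 cis0 mul1r mulr1 => <-.
by rewrite !mulNr.
Qed.

(** Integration by parts against exp(-i c r q) along [r *: e] replaces the uniqueness theorem for
    differential equations: the two integrals cancel, and only the boundary term remains. *)
Lemma eigen_shift c e g x (r : R) : sm g ->
  deriveC e g = (fun x => iC * c%:C%C * g x) ->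
  g (x + r *: e) = cis (c * r) * g x.
Proof.
move=> Hg Eg.
have [K kK] := klip_ker (c * r).
have D : deriveC (r *: e) g = (fun x => iC * (c * r)%:C%C * g x).
  by apply/funext => y; rewrite deriveC_scale_dir// Eg rmorphM/=; ring.
have /(congr1 (fun h => h x)) := rop_ker_by_parts (c * r) (r *: e) Hg.
rewrite D (reg_scalar (good_reg (good_rop (W := setT) kK (c := 1) _ _)) _ Hg)//.
  rewrite subrr => /esym/eqP; rewrite subr_eq0 => /eqP <-.
  by rewrite mulrA -cisD subrr cis0 mul1r.
by move=> q _; rewrite md_ker.
Qed.

Lemma A_derive e k f : sm f -> (forall x, f (x + e) = f x) ->
  Acoef e k (deriveC e f) = (fun x => freq k * Acoef e k f x).
Proof.
move=> Hf Pf; apply/funext => x.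
have /(congr1 (fun h => h x)) := rop_ker_by_parts (iota_freq k) e Hf.
rewrite /= cisN cis_2pi_int invr1 mul1r Pf subrr => /eqP.
by rewrite subr_eq0 => /eqP.
Qed.

Lemma derive_A e k f : sm f -> (forall x, f (x + e) = f x) ->
  deriveC e (Acoef e k f) = (fun x => freq k * Acoef e k f x).
Proof.
by move=> Hf Pf; rewrite (good_derive (good_AT e k))// A_derive.
Qed.

(** The derivative along [e] commutes with both operators, and it acts on the composite by [freq k]
    as well as by [freq l]. *)
Lemma A_orth e k l f : sm f -> (forall x, f (x + e) = f x) -> k != l ->
  Acoef e k (Acoef e l f) = (fun=> 0).
Proof.
move=> Hf Pf kl; have Hl := good_smooth (good_AT e l) Hf.
have := A_derive k Hl (reg_periodic (good_reg (good_AT e l)) Hf Pf).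
rewrite derive_A// (reg_scalar (good_reg (good_AT e k)))// => E.
apply/funext => x; have /(congr1 (fun h => h x))/eqP := E.
rewrite -subr_eq0 -mulrBl mulf_eq0 => /orP[|/eqP//].
rewrite subr_eq0 /freq => /eqP/(mulfI _) H.
have i0 : iC != 0 :> C by rewrite eq_complex/= oner_eq0 andbF.
have /complexI/mulfI H2 := H i0.
have p0 : (pi : R) *+ 2 != 0 by rewrite mulrn_eq0/= gt_eqF// pi_gt0.
have /eqP := H2 p0; rewrite eqr_int => /eqP kl'.
by rewrite kl' eqxx in kl.
Qed.

Lemma A_idem e k f : sm f -> (forall x, f (x + e) = f x) ->
  Acoef e k (Acoef e k f) = Acoef e k f.
Proof.
move=> Hf Pf; have [K kK] := klip_ker (iota_freq k).
have Hl := good_smooth (good_AT e k) Hf.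
apply: (lucv_unique (rop_lucv e kK Hl)).
apply: (lucv_eq (F := fun _ => Acoef e k f)) => [m|rho eps e0]; last first.
  by exists 0%N => j _ x _; rewrite subrr md0 ltW.
apply/funext => x; rewrite /rsum.
under eq_bigr do rewrite (eigen_shift _ _ Hl (derive_A k Hf Pf)) mulrA -cisD addrC subrr cis0 mul1r.
by rewrite sumr_const card_ord -[(Acoef e k f x) *+ _]mulr_natl mulKf.
Qed.

(** A shift by one step permutes the m nodes cyclically modulo the period; the term leaving at one
    end returns at the other. *)
Lemma rsum_ker_shift e k m f x : (forall x, f (x + e) = f x) -> (0 < m)%N ->
  rsum (ker (iota_freq k)) e m (fun y => f (y + m%:R^-1 *: e)) x =
  cis (iota_freq k / m%:R) * rsum (ker (iota_freq k)) e m f x.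
Proof.
move=> Pf m0; have m0' : (m%:R : R) != 0 by rewrite pnatr_eq0 -lt0n.
rewrite /rsum mulrCA; congr (_ * _); rewrite mulr_sumr.
pose F a := cis (iota_freq k / m%:R) *
  (ker (iota_freq k) (a%:R / m%:R) * f (x + (a%:R / m%:R) *: e)).
rewrite -[RHS](big_mkord xpredT F) -(big_mkord xpredT (fun a =>
  ker (iota_freq k) (a%:R / m%:R) * f (x + (a%:R / m%:R) *: e + m%:R^-1 *: e))).
rewrite (eq_bigr (fun a => F a.+1)); last first.
  move=> a _; rewrite /F /ker mulrA -cisD -addrA -scalerDl.
  have -> : a.+1%:R / m%:R = a%:R / m%:R + m%:R^-1 :> R by rewrite -addn1 natrD mulrDl mul1r.
  by congr (cis _ * _); ring.
case: m m0 m0' @F => // m _ m0' F.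
rewrite big_nat_recr//= [RHS]big_nat_recl//= addrC; congr (_ + _).
rewrite /F mulfV// scale1r Pf mul0r scale0r addr0 /ker mulr0 oppr0 cis0.
by rewrite mulr1 cisN cis_2pi_int invr1.
Qed.

(** A discrete form of integrating by parts twice: the second difference of [f] with step 1/m has
    Fourier sum (z - 1)^2 times that of [f] and is of size 1/m^2. The constant is uniform in m and
    k. *)
Lemma rsum_ker_decay e f x : sm f -> (forall x, f (x + e) = f x) ->
  exists2 L : R, 0 <= L & forall m k, (0 < m)%N ->
    md (rsum (ker (iota_freq k)) e m f x) * md (cis (iota_freq k / m%:R) - 1) ^+ 2
      <= L * (m%:R^-1 * m%:R^-1).
Proof.
move=> Hf Pf; pose rho := `|x| + `|e| + `|e|.
have [L L0 HL] := smooth_lipschitz_derive e rho Hf.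
have [L' L'0 HL'] := smooth_lipschitz e rho (smooth_deriveC e Hf).
exists (L + L + L') => [|m k m0]; first by rewrite !addr_ge0.
have m0' : (0 : R) < m%:R by rewrite ltr0n.
set z := cis _; pose h : R := m%:R^-1.
have h0 : 0 <= h by rewrite invr_ge0.
have h1 : h <= 1 by rewrite invf_le1// ler1n.
have h01 : 0 <= h <= 1 by rewrite h0.
pose T := rsum (ker (iota_freq k)) e m : (V -> C) -> V -> C.
have gT : good setT 1 `|e| T by apply: good_rsum => // r _; rewrite md_ker.
have Hs := smooth_shift (h *: e) Hf; have Hss := smooth_shift (h *: e) Hs.
have Ps y : f (y + e + h *: e) = f (y + h *: e) by rewrite addrAC Pf.
pose d2 y := (f (y + h *: e + h *: e) - f (y + h *: e)) - (f (y + h *: e) - f y).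
have E : T d2 x = (z - 1) ^+ 2 * T f x.
  rewrite /d2 (reg_sub (good_reg gT) (smooth_subr Hss Hs) (smooth_subr Hs Hf)).
  rewrite (reg_sub (good_reg gT) Hss Hs) (reg_sub (good_reg gT) Hs Hf).
  rewrite /T (rsum_ker_shift k (f := fun y => f (y + h *: e)) x Ps m0).
  rewrite (rsum_ker_shift k (f := f) x Pf m0) -/z; ring.
rewrite mulrC -/(T f x) -[X in X * _](_ : md ((z - 1) ^+ 2) = _); last by rewrite !expr2 mdM.
rewrite -mdM -E -[X in _ <= X]mul1r.
apply: (good_bound gT (rho := `|x|)) => //; first exact: smooth_subr (smooth_subr Hss Hs) (smooth_subr Hs Hf).
move=> y yr; have yr1 : `|y| <= rho by apply: le_trans yr _; rewrite lerDl.
have yr2 : `|y + h *: e| <= rho by apply: norm_shift_le.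
have -> : d2 y = (f (y + h *: e + h *: e) - f (y + h *: e) - h%:C%C * deriveC e f (y + h *: e))
   - (f (y + h *: e) - f y - h%:C%C * deriveC e f y)
   + h%:C%C * (deriveC e f (y + h *: e) - deriveC e f y) by rewrite /d2; ring.
rewrite -/h mulrDl mulrDl; apply: le_trans (mdD _ _) (lerD _ _).
  by apply: le_trans (mdD _ _) _; rewrite mdN lerD// HL.
rewrite mdM md_real ger0_norm// mulrCA ler_wpM2l//.
exact: HL'.
Qed.

Lemma sum_cis_root m a : (0 < a < m)%N ->
  \sum_(k < m) cis (- (iota_freq k%:Z * (a%:R / m%:R))) = 0 :> C.
Proof.
move=> /andP[a0 am]; have m0 : (m%:R : R) != 0 by rewrite pnatr_eq0 -lt0n (leq_trans _ am).
pose z : C := cis (- (pi *+ 2 * (a%:R / m%:R))).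
rewrite (eq_bigr (fun k : 'I_m => z ^+ k)); last first.
  by move=> k _; rewrite -cisMn /iota_freq -mulr_natr -pmulrn; congr cis; ring.
have zm : z ^+ m = 1.
  rewrite -cisMn -[RHS](cis_2pi_int (- a%:Z)) mulrNz; congr cis.
  by rewrite -mulr_natr -pmulrn; field.
have z1 : z - 1 != 0.
  apply/eqP => E; pose t : R := pi *+ 2 * (a%:R / m%:R).
  have p0 := @pi_gt0 R.
  have r0 : 0 < (a%:R / m%:R : R) by rewrite divr_gt0// ltr0n// (leq_trans _ am).
  have r1 : (a%:R / m%:R : R) < 1 by rewrite ltr_pdivrMr ?mul1r ?ltr_nat// ltr0n (leq_trans _ am).
  have zt : cis (- t) = z by [].
  have t0 : 0 < t by rewrite /t [pi *+ 2]mulr2n mulr_gt0// addr_gt0.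
  have t2 : t < pi + pi by rewrite -[pi + pi]mulr2n /t gtr_pMr// [pi *+ 2]mulr2n addr_gt0.
  clearbody t; case: (leP t pi) => tp.
    have := @cisB1_ge R (- t); rewrite zt E md0 normrN gtr0_norm// => H.
    have : t / 2 <= 0 by apply: H; apply/andP; split; move: p0 t0 tp; lra.
    by move: t0; lra.
  have q0 : 0 < pi + pi - t by rewrite subr_gt0.
  have := @cisB1_ge R (pi + pi - t); rewrite -{2}mulr2n cisD cis_2pi mul1r zt E md0 gtr0_norm// => H.
  have : (pi + pi - t) / 2 <= 0 by apply: H; apply/andP; split; move: p0 t2 tp; lra.
  by move: q0; lra.
have := subrX1 z m; rewrite zm subrr => /esym/eqP; rewrite mulf_eq0 (negbTE z1)/=.
by move/eqP.
Qed.

(** Summing over the frequencies leaves only the node a = 0, the sums of the other roots of unity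
    being zero. The identity is exact for each m and does not use periodicity. *)
Lemma discrete_inversion e m f x : (0 < m)%N ->
  f x = \sum_(k < m) rsum (ker (iota_freq k%:Z)) e m f x.
Proof.
move=> m0; have m0' : (m%:R : C) != 0 by rewrite pnatr_eq0 -lt0n.
rewrite /rsum -mulr_sumr exchange_big/=.
under eq_bigr do rewrite -mulr_suml.
case: m m0 m0' => // m _ m0'.
rewrite big_ord_recl [\sum_(i < m) _]big1 => [|a _]; last first.
  have H : (0 < a.+1 < m.+1)%N by rewrite /= ltnS (ltn_ord a).
  rewrite [X in X * _](_ : _ = 0) ?mul0r// -[RHS](sum_cis_root H).
  by apply: eq_bigr => k _; rewrite /ker lift0.
rewrite addr0 /= mul0r scale0r addr0.
under eq_bigr do rewrite /ker mulr0 oppr0 cis0.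
by rewrite sumr_const card_ord mulKf.
Qed.

End FourierCoefficients.

(** * Uniqueness of Fourier coefficients *)

Section FourierUniqueness.
Context {R : realType} {n : nat}.
Local Notation V := (Cn R n).
Local Notation C := R[i].
Implicit Types (f g : V -> C) (x v w e : V) (k l : int) (m j : nat) (W : set V).
Local Notation sm := (@smooth R V setT).
Local Notation rs e k m f x := (rsum (ker (iota_freq k)) e m f x).

(** Aliasing: m nodes see a frequency only modulo m, so for m = 2 q the frequencies q, ..., 2 q - 1
    stand for -q, ..., -1. *)
Lemma rsum_alias e k m f x : (0 < m)%N -> rs e (k + m%:Z) m f x = rs e k m f x.
Proof.
move=> m0; have m0' : (m%:R : R) != 0 by rewrite pnatr_eq0 -lt0n.
rewrite /rsum; congr (_ * _); apply: eq_bigr => a _; congr (_ * _).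
rewrite /ker /iota_freq intrD mulrDr mulrDl opprD cisD.
rewrite [X in _ * X](_ : _ = 1) ?mulr1// -[RHS](cis_2pi_int (- (a : nat)%:Z)) mulrNz.
by congr cis; rewrite -!pmulrn; field.
Qed.

Lemma sum_inv_sqr J d : (0 < J)%N ->
  \sum_(i < d) ((J + i).+1%:R^-1 * (J + i).+1%:R^-1) <= J%:R^-1 - (J + d)%:R^-1 :> R.
Proof.
move=> J0; elim: d => [|d IH]; first by rewrite big_ord0 addn0 subrr.
rewrite big_ord_recr/=; apply: le_trans (lerD IH (lexx _)) _.
rewrite addnS; set a := (J + d)%N.
have a0 : (0 : R) < a%:R by rewrite ltr0n addn_gt0 J0.
have -> : a.+1%:R = a%:R + 1 :> R by rewrite -natr1.
have a1 : (0 : R) < a%:R + 1 by rewrite ltr_wpDl// ltW.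
rewrite -addrA lerD2l -subr_ge0.
have -> : - (a%:R + 1)^-1 - (- a%:R^-1 + (a%:R + 1)^-1 * (a%:R + 1)^-1)
    = (a%:R * (a%:R + 1) * (a%:R + 1))^-1 :> R.
  by field; rewrite !gt_eqF.
by rewrite invr_ge0 !mulr_ge0// ltW.
Qed.

(** For |k| <= q and m = 2 q the angle 2 pi k / m stays in [-pi, pi], where |exp(i a) - 1| >= |a| /
    2 >= |k| / m. The powers of m then cancel in [rsum_ker_decay] and a bound L / k^2 independent of
    q remains. *)
Lemma rsum_ker_bound e f x : sm f -> (forall x, f (x + e) = f x) ->
  exists2 L : R, 0 <= L & forall q k, (0 < q)%N -> k != 0 -> `|k%:~R| <= q%:R :> R ->
    md (rs e k (q + q) f x) <= L * (`|k%:~R|^-1 * `|k%:~R|^-1).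
Proof.
move=> Hf Pf; have [L L0 HL] := rsum_ker_decay x Hf Pf.
exists L => // q k q0 k0 kq.
pose m := (q + q)%N; have m0 : (0 < m)%N by rewrite addn_gt0 q0.
have mR : (0 : R) < m%:R by rewrite ltr0n.
have kR : (0 : R) < `|k%:~R| by rewrite normr_gt0 intr_eq0.
have p0 := @pi_ge2 R; have p1 := @pi_gt0 R.
have H1 : `|k%:~R| / m%:R <= md (cis (iota_freq k / m%:R) - 1) :> R.
  pose u : R := `|k%:~R| / m%:R; have u0 : 0 <= u by rewrite divr_ge0// ltW.
  have u1 : u + u <= 1.
    rewrite -mulrDl ler_pdivrMr// mul1r /m natrD lerD//.
  have fu : `|iota_freq k / m%:R| = (pi + pi) * u.
    rewrite normrM normfV (ger0_norm (ltW mR)) /iota_freq normrM [pi *+ 2]mulr2n.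
    by rewrite ger0_norm ?mulrA// addr_ge0// ltW.
  have := @cisB1_ge R (iota_freq k / m%:R); rewrite -ler_norml fu -/u => H.
  apply: le_trans (H _); last by move: p1 u1 u0; nra.
  by move: p0 u0; nra.
have := HL m k m0; rewrite expr2.
have u0 : 0 <= `|k%:~R| / m%:R :> R by rewrite divr_ge0// ltW.
move=> H2; have H3 : md (rs e k m f x) * ((`|k%:~R| / m%:R) * (`|k%:~R| / m%:R)) <= L * (m%:R^-1 * m%:R^-1).
  by apply: le_trans H2; rewrite ler_wpM2l ?md_ge0// ler_pM.
have up : 0 < (`|k%:~R| / m%:R) * (`|k%:~R| / m%:R) :> R by rewrite mulr_gt0// divr_gt0.
rewrite -(ler_pM2r up); apply: le_trans H3 _.
rewrite le_eqVlt; apply/orP; left; apply/eqP; field.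
by rewrite !gt_eqF.
Qed.

(** Dominated convergence in the discrete inversion formula: each fixed frequency contributes a term
    tending to [Acoef e k f] = 0, and the tail is small uniformly in the number of nodes thanks to
    the bound L / k^2. *)
Lemma fourier_unique e f : sm f -> (forall x, f (x + e) = f x) ->
  (forall k, Acoef e k f = (fun=> 0)) -> f = (fun=> 0).
Proof.
move=> Hf Pf A0; apply/funext => x; apply: (@md_le_small _ _ 2) => eps e0.
have [L L0 HL] := rsum_ker_bound x Hf Pf.
have small k (d : R) : 0 < d -> exists N, forall m, (N <= m)%N -> md (rs e k m.+1 f x) <= d.
  move=> d0; have [K kK] := @klip_ker R (iota_freq k).
  have [N HN] := rop_lucv e kK Hf `|x| d0; exists N => m Nm.
  have := HN m Nm x (lexx _); rewrite -[rop _ e f]/(Acoef e k f) A0 subr0.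
  exact.
have smalls J (d : R) : 0 < d -> exists N, forall m, (N <= m)%N ->
    \sum_(j < J) (md (rs e (Posz j) m.+1 f x) + md (rs e (Negz j) m.+1 f x)) <= d.
  elim: J d => [|J IH] d d0; first by exists 0%N => m _; rewrite big_ord0 ltW.
  have d2 : 0 < d / 2 by rewrite divr_gt0.
  have d4 : 0 < d / 2 / 2 by rewrite divr_gt0.
  have [N1 H1] := IH _ d2; have [N2 H2] := small (Posz J) _ d4.
  have [N3 H3] := small (Negz J) _ d4.
  exists (maxn N1 (maxn N2 N3)) => m; rewrite !geq_max => /and3P[m1 m2 m3].
  rewrite big_ord_recr/= [d]splitr lerD//; first exact: H1.
  by rewrite [d / 2]splitr lerD//; [exact: H2|exact: H3].
have L1 : 0 < 2 * L + 1 by rewrite ltr_wpDl// mulr_ge0.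
have [J HJ] := invn_cvg0 (divr_gt0 e0 L1).
have {}HJ := HJ J (leqnn J).
have [N HN] := smalls J.+2 _ e0.
(* Large enough for the first J + 2 frequencies of each sign to fit and for 2 q nodes to lie in the
   range where their sum is at most [eps]; exactly N frequencies of each sign are left for the
   tail. *)
pose q := (J.+2 + N)%N; have q0 : (0 < q)%N by [].
rewrite (discrete_inversion e f x (m := q + q)) ?addn_gt0 ?q0//.
rewrite big_split_ord/=.
have -> : \sum_(i < q) rs e (q + i)%N (q + q) f x = \sum_(i < q) rs e (Negz i) (q + q) f x.
  rewrite (reindex_inj rev_ord_inj)/=; apply: eq_bigr => i _.
  rewrite -(@rsum_alias _ (Negz i)) ?addn_gt0 ?q0//; congr (rs e _ _ _ _).
  have := ltn_ord i; rewrite NegzE; lia.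
rewrite -big_split/=; apply: le_trans (md_sum _ _ _) _.
pose F (j : nat) := md (rs e (Posz j) (q + q) f x) + md (rs e (Negz j) (q + q) f x).
apply: le_trans (_ : \sum_(j < q) F j <= _); first by apply: ler_sum => j _; exact: mdD.
have HNq : \sum_(j < J.+2) F j <= eps.
  have Eq : (q + q).-1.+1 = (q + q)%N by rewrite prednK// addn_gt0 q0.
  have Nq : (N <= (q + q).-1)%N by rewrite /q; lia.
  by have := HN _ Nq; rewrite Eq.
have split_q : \sum_(j < q) F j = \sum_(j < J.+2) F j + \sum_(i < N) F (J.+2 + i)%N.
  by rewrite /q big_split_ord.
rewrite mulr_natr mulr2n split_q lerD//.
apply: le_trans (_ : \sum_(i < N) 2 * L * ((J.+1 + i).+1%:R^-1 * (J.+1 + i).+1%:R^-1) <= _).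
  apply: ler_sum => i _; rewrite /F.
  have iq : (J.+2 + i <= q)%N by have := ltn_ord i; rewrite /q; lia.
  have iq' : ((J.+2 + i).+1 <= q)%N by have := ltn_ord i; rewrite /q; lia.
  have P1 : md (rs e (Posz (J.+2 + i)) (q + q) f x) <= L * ((J.+2 + i)%:R^-1 * (J.+2 + i)%:R^-1).
    have := HL q (Posz (J.+2 + i)) q0 isT; rewrite -pmulrn ger0_norm// ler_nat.
    exact.
  have P2 : md (rs e (Negz (J.+2 + i)) (q + q) f x) <= L * ((J.+2 + i)%:R^-1 * (J.+2 + i)%:R^-1).
    have := HL q (Negz (J.+2 + i)) q0 isT; rewrite NegzE mulrNz normrN -pmulrn ger0_norm// ler_nat => H.
    apply: le_trans (H iq') _; rewrite ler_wpM2l//.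
    have H2 : ((J.+2 + i).+1%:R^-1 <= (J.+2 + i)%:R^-1 :> R).
      by rewrite lef_pV2 ?posrE ?ltr0n// ler_nat.
    by rewrite ler_pM// invr_ge0.
  by apply: le_trans (lerD P1 P2) _; rewrite -mulrA mulr_natl mulr2n.
rewrite -mulr_sumr; have := @sum_inv_sqr J.+1 N isT => H.
apply: le_trans (_ : (2 * L + 1) * (eps / (2 * L + 1)) <= _); last first.
  by rewrite mulrCA divff ?mulr1// gt_eqF.
apply: ler_pM; rewrite ?mulr_ge0//.
- by apply: sumr_ge0 => i _; rewrite mulr_ge0// invr_ge0.
- by rewrite lerDl.
- apply: le_trans H _; apply: le_trans HJ; rewrite gerBl invr_ge0//.
Qed.

End FourierUniqueness.

(** * Inversion of constant-coefficient operators on tori *)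

Section TorusSolution.
Context {R : realType} {n : nat}.
Local Notation V := (Cn R n).
Local Notation C := R[i].
Implicit Types (f : V -> C) (x v e : V) (es : seq V) (k : int) (eta s : seq int).
Implicit Types (W : set V) (g : seq int -> C) (w : nat -> C).
Local Notation sm := (@smooth R V setT).

Definition spanned W es := forall e, e \in es -> forall r : R, W (r *: e).
Definition periodic_along es f := forall e, e \in es -> forall x, f (x + e) = f x.

Fixpoint Aseq es eta f := match es, eta with
  | e :: es', k :: eta' => Aseq es' eta' (Acoef e k f)
  | _, _ => f
  end.

(* The operator with Fourier multiplier [g]. *)
Fixpoint multop es g : (V -> C) -> V -> C := match es with
  | [::] => fun f x => g [::] * f x
  | e :: es' => serop (fun i f x =>
      Acoef e (Posz i) (multop es' (fun s => g (Posz i :: s)) f) x +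
      Acoef e (Negz i) (multop es' (fun s => g (Negz i :: s)) f) x)
  end.

Definition wt k : R := (1 + (k%:~R) ^+ 2)^-1.

Lemma wt_ge0 k : 0 <= wt k.
Proof. by rewrite invr_ge0 addr_ge0// sqr_ge0. Qed.

(** Each sign contributes at most 4, by telescoping against 4 / (m + 1): the step needs (a + 1)(a +
    2) <= 4 (1 + a^2). *)
Lemma sum_wt m : \sum_(i < m) (wt (Posz i) + wt (Negz i)) <= 8.
Proof.
have H : \sum_(i < m) (1 + (i%:R : R) ^+ 2)^-1 <= 4 - 4 * m.+1%:R^-1.
  elim: m => [|m IH]; first by rewrite big_ord0 invr1 mulr1 subrr.
  rewrite big_ord_recr/=; apply: le_trans (lerD IH (lexx _)) _.
  have -> : m.+2%:R = m%:R + 2 :> R by rewrite -addn2 natrD.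
  have -> : m.+1%:R = m%:R + 1 :> R by rewrite -natr1.
  have : 0 <= (m%:R : R) by []. move: (m%:R : R) => a a0.
  rewrite -subr_ge0.
  have -> : 4 - 4 * (a + 2)^-1 - (4 - 4 * (a + 1)^-1 + (1 + a ^+ 2)^-1) =
     (3 * a ^+ 2 - 3 * a + 2) / ((a + 1) * (a + 2) * (1 + a ^+ 2)).
    by field; rewrite !gt_eqF//; nra.
  apply: divr_ge0; first by nra.
  by rewrite !mulr_ge0 ?addr_ge0// sqr_ge0.
rewrite big_split/=.
have H1 : \sum_(i < m) wt (Posz i) <= 4.
  apply: le_trans (_ : 4 - 4 * m.+1%:R^-1 <= _); last by rewrite gerBl mulr_ge0.
  by apply: le_trans H; apply: ler_sum => i _; rewrite /wt -pmulrn.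
have H2 : \sum_(i < m) wt (Negz i) <= \sum_(i < m) wt (Posz i).
  apply: ler_sum => i _; rewrite /wt NegzE mulrNz sqrrN -!pmulrn lef_pV2 ?posrE.
  - by rewrite lerD2l ler_pXn2r ?nnegrE// ler_nat.
  - by rewrite ltr_wpDr// sqr_ge0.
  - by rewrite ltr_wpDr// sqr_ge0.
by move: H1 H2; lra.
Qed.

Lemma good_Aseq W es eta : spanned W es ->
  good W 1 (\sum_(e <- es) `|e|) (Aseq es eta).
Proof.
elim: es eta => [|e es IH] eta sp; first by rewrite big_nil; exact: good_id.
case: eta => [|k eta]; first by apply: good_weaken (good_id W) => //; exact: sumr_ge0.
rewrite big_cons addrC -[X in good _ X](mulr1 1).
apply: (good_comp (T := Aseq es eta) (T' := Acoef e k)).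
  by apply: IH => e' ee; apply: sp; rewrite inE ee orbT.
by apply: good_A; apply: sp; rewrite inE eqxx.
Qed.

Lemma good_multop W es g (c : R) : spanned W es -> 0 <= c ->
  (forall s, size s = size es -> md (g s) <= c * \prod_(k <- s) wt k) ->
  good W (c * 8 ^+ size es) (\sum_(e <- es) `|e|) (multop es g).
Proof.
elim: es g c => [|e es IH] g c sp c0 Hg.
  rewrite big_nil expr0; apply: good_weaken (good_scale (g [::]) (good_id W)) => //.
  by apply: le_trans (ler_wpM2r ler01 (Hg [::] erefl)) _; rewrite big_nil mulr1.
have sp' : spanned W es by move=> e' ee; apply: sp; rewrite inE ee orbT.
pose b k := c * wt k.
have gk k : good W (b k * 8 ^+ size es) (`|e| + \sum_(e <- es) `|e|)
    (fun f x => Acoef e k (multop es (fun s => g (k :: s)) f) x).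
  rewrite -[X in good _ X](mul1r _).
  apply: (good_comp (T := Acoef e k) (T' := multop es (fun s => g (k :: s)))).
    by apply: good_A; apply: sp; rewrite inE eqxx.
  apply: IH => // [|s sz]; first by rewrite mulr_ge0// wt_ge0.
  apply: le_trans (Hg (k :: s) _) _; first by rewrite /= sz.
  by rewrite big_cons mulrA.
rewrite big_cons /=; apply: (good_serop (fun i => good_plus (gk (Posz i)) (gk (Negz i)))) => m.
rewrite (eq_bigr (fun i : 'I_m => c * 8 ^+ size es * (wt (Posz i) + wt (Negz i)))); last first.
  by move=> i _; rewrite /b; ring.
by rewrite -mulr_sumr exprSr mulrA ler_wpM2l ?sum_wt// mulr_ge0.
Qed.

Lemma periodic_cons e es f : periodic_along (e :: es) f ->
  (forall x, f (x + e) = f x) /\ periodic_along es f.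
Proof.
by move=> P; split=> [x|e' ee x]; apply: P; rewrite inE ?eqxx// ee orbT.
Qed.

Lemma periodic_reg W T es f : regop W T -> sm f -> periodic_along es f ->
  periodic_along es (T f).
Proof. by move=> rT Hf P e ee x; apply: (reg_periodic rT) => // y; exact: P. Qed.

Lemma reg_Acoef e k : regop setT (Acoef e k).
Proof. exact: good_reg (good_AT e k). Qed.

(** By orthogonality the component of frequency k meets a single term of the outer series.
    [Acoef e k] then moves past the inner operator, and the induction continues with the remaining
    vectors. *)
Lemma Aseq_multop es g (c : R) eta f : 0 <= c ->
  (forall s, size s = size es -> md (g s) <= c * \prod_(k <- s) wt k) ->
  sm f -> periodic_along es f -> size eta = size es ->
  Aseq es eta (multop es g f) = (fun x => g eta * Aseq es eta f x).
Proof.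
elim: es g c eta f => [|e es IH] g c eta f c0 Hg Hf Pf; first by case: eta.
case: eta => // k eta /= [sz].
have [Pe Pes] := periodic_cons Pf.
have Hgk j s : size s = size es -> md (g (j :: s)) <= c * wt j * \prod_(k <- s) wt k.
  by move=> ss; apply: le_trans (Hg (j :: s) _) _; rewrite /= ?ss// big_cons mulrA.
have cj j : 0 <= c * wt j by rewrite mulr_ge0// wt_ge0.
have gT j := good_multop (W := setT) (es := es) (fun _ _ _ => I) (cj j) (Hgk j).
pose G j := multop es (fun s => g (j :: s)) f.
have HG j : sm (G j) by exact: (good_smooth (gT j)).
have PG j x : G j (x + e) = G j x by exact: (reg_periodic (good_reg (gT j))).
have gS := good_multop (W := setT) (es := e :: es) (fun _ _ _ => I) c0 Hg.
have gAG j := good_comp (good_AT e j) (gT j).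
pose U (i : nat) f x := Acoef e (Posz i) (multop es (fun s => g (Posz i :: s)) f) x +
      Acoef e (Negz i) (multop es (fun s => g (Negz i :: s)) f) x.
have HU i : sm (U i f).
  by apply: smooth_add; [exact: openT|exact: (good_smooth (gAG (Posz i)))|exact: (good_smooth (gAG (Negz i)))].
have AU i : Acoef e k (U i f) = (fun x => if (k == Posz i) || (k == Negz i)
     then Acoef e k (G k) x else 0).
  rewrite /U (reg_add (reg_Acoef e k)); last 2 first.
  - exact: (good_smooth (gAG (Posz i))).
  - exact: (good_smooth (gAG (Negz i))).
  apply/funext => x; have [->|k1] := eqVneq k (Posz i).
    by rewrite (A_idem _ (HG (Posz i)) (PG _)) (A_orth (HG (Negz i)) (PG _))// addr0.
  have [->|k2] := eqVneq k (Negz i).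
    by rewrite (A_idem _ (HG (Negz i)) (PG _)) (A_orth (HG (Posz i)) (PG _))// add0r.
  by rewrite (A_orth (HG (Posz i)) (PG _))// (A_orth (HG (Negz i)) (PG _))// addr0.
have AS : Acoef e k (serop U f) = Acoef e k (G k).
  have HS : sm (serop U f) by exact: (good_smooth gS).
  have gUi i : good setT (c * 8 ^+ size es * (wt (Posz i) + wt (Negz i)))
       (`|e| + \sum_(e <- es) `|e|) (U i).
    apply: good_weaken (good_plus (gAG (Posz i)) (gAG (Negz i))) => //.
    rewrite le_eqVlt; apply/orP; left; apply/eqP; ring.
  have L : lucv (fun m => partial U m f) (serop U f).
    apply: (serop_lucv gUi (M := c * 8 ^+ size es * 8)) => // m.
    by rewrite -mulr_sumr ler_wpM2l ?sum_wt// mulr_ge0.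
  have Hp m : sm (partial U m f) by apply: smooth_sum => //; exact: openT.
  apply: (lucv_unique (good_lucv (good_AT e k) Hp HS L)).
  (* The index of the only term that survives; beyond it the partial sums no longer change. *)
  pose j := match k with Posz i => i | Negz i => i end.
  move=> rho eps e0; exists j.+1 => m jm x _.
  rewrite (reg_sum (reg_Acoef e k)) => [|i _]; last exact: HU.
  rewrite (bigD1 (Ordinal jm))//= AU.
  have -> : (k == Posz j) || (k == Negz j) by rewrite /j; case: (k) => i; rewrite eqxx ?orbT.
  rewrite big1 ?addr0 ?subrr ?md0 ?ltW// => i ij; rewrite AU.
  rewrite ifF//; apply: contraNF ij => /orP[]/eqP E; apply/eqP/val_inj => /=;
    by rewrite /j E.
rewrite -/U AS /G.
have [K kK] := @klip_ker R (iota_freq k).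
rewrite -[Acoef e k _](good_rop_comm e (gT k) kK Hf).
apply: (IH _ (c * wt k)) => //.
- exact: Hgk.
- exact: (reg_smooth (reg_Acoef e k)).
- exact: (periodic_reg (reg_Acoef e k)).
Qed.

Lemma Aseq_unique es f : sm f -> periodic_along es f ->
  (forall eta, size eta = size es -> Aseq es eta f = (fun=> 0)) -> f = (fun=> 0).
Proof.
elim: es f => [|e es IH] f Hf Pf H0; first exact: (H0 [::]).
have [Pe Pes] := periodic_cons Pf.
apply: (fourier_unique Hf Pe) => k; apply: IH.
- exact: (reg_smooth (reg_Acoef e k)).
- exact: (periodic_reg (reg_Acoef e k)).
- by move=> eta sz; apply: (H0 (k :: eta)); rewrite /= sz.
Qed.

Lemma reg_Aseq W es eta : spanned W es -> regop W (Aseq es eta).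
Proof. by move=> sp; exact: good_reg (good_Aseq eta sp). Qed.

Lemma reg_AseqT es eta : regop setT (Aseq es eta).
Proof. exact: reg_Aseq. Qed.

Lemma Aseq_derive es eta f j : sm f -> periodic_along es f -> size eta = size es ->
  (j < size es)%N ->
  Aseq es eta (deriveC es`_j f) = (fun x => freq eta`_j * Aseq es eta f x).
Proof.
elim: es eta f j => // e es IH [//|k eta] f [|j] Hf Pf /= [sz] js;
  have [Pe Pes] := periodic_cons Pf.
  by rewrite A_derive// (reg_scalar (reg_AseqT _ _))//; exact: (reg_smooth (reg_Acoef e k)).
rewrite -(reg_derive (reg_Acoef e k))//; apply: IH => //.
  exact: (reg_smooth (reg_Acoef e k)).
exact: (periodic_reg (reg_Acoef e k)).
Qed.

Lemma Aseq_zero es f : sm f -> (forall e, e \in es -> forall x (r : R), f (x + r *: e) = f x) ->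
  Aseq es (nseq (size es) 0) f = f.
Proof.
elim: es => //= e es IH Hf He.
have -> : Acoef e 0 f = f.
  rewrite /Acoef (_ : ker (iota_freq 0) = (fun=> 1)).
    by apply: rop_invariant => // x r; apply: He; rewrite inE eqxx.
  by apply/funext => r; rewrite /ker /iota_freq mulr0 mul0r oppr0 cis0.
by apply: IH => // e' ee; apply: He; rewrite inE ee orbT.
Qed.

Definition Dop es w f x : C := \sum_(j < size es) w j * deriveC es`_j f x.
Definition symb es w eta : C := \sum_(j < size es) w j * freq eta`_j.

Lemma deriveC_invariant (m : V -> C) v x : sm m -> (forall (r : R) x, m (x + r *: v) = m x) ->
  deriveC v m x = 0.
Proof.
move=> Hm mv.
have H (p : V -> R) : (forall (r : R) x, p (x + r *: v) = p x) -> 'D_v p x = 0.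
  move=> pv; have [_ ->//] : is_derive x v p 0; apply/is_derive_epsP => eps e0.
  by exists 1 => // h _; rewrite pv subrr mulr0 subr0 normr0 mulr_ge0// ltW.
by apply: ReIm_inj; rewrite /deriveC/= H// => r y; rewrite mv.
Qed.

Lemma smooth_Dop es w f : sm f -> sm (Dop es w f).
Proof.
move=> Hf; apply: smooth_sum => [|j _]; first exact: openT.
by apply: smooth_scale; [exact: openT|exact: smooth_deriveC].
Qed.

Lemma reg_Dop W es w : spanned W es -> regop W (Dop es w).
Proof.
move=> sp; have HD f j : sm f -> sm (fun x => w j * deriveC es`_j f x).
  by move=> Hf; apply: smooth_scale; [exact: openT|exact: smooth_deriveC].
split.
- by move=> f; exact: smooth_Dop.
- move=> f v Hf; apply/funext => x; rewrite /Dop.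
  rewrite (deriveC_sum _ v openT (I : setT x) (fun (j : 'I_(size es)) _ => HD f j Hf)).
  apply: eq_bigr => j _.
  rewrite (deriveCZ (w j) v openT (smooth_deriveC es`_j Hf) (I : setT x)).
  by rewrite deriveC_comm.
- move=> f g Hf Hg; apply/funext => x; rewrite /Dop -big_split/=.
  by apply: eq_bigr => j _; rewrite (deriveCD es`_j Hf Hg (I : setT x)) mulrDr.
- move=> m f Hm Wm Hf; apply/funext => x; rewrite /Dop mulr_sumr.
  apply: eq_bigr => j _; rewrite (deriveCM es`_j Hm Hf (I : setT x)).
  rewrite (deriveC_invariant (v := es`_j) x Hm) ?mul0r ?add0r; first by rewrite mulrCA.
  by move=> r y; apply: Wm; apply: sp; rewrite mem_nth.
- move=> f v Hf; apply/funext => x; rewrite /Dop.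
  by apply: eq_bigr => j _; rewrite deriveC_shift.
Qed.

Lemma Aseq_Dop es w eta f : sm f -> periodic_along es f -> size eta = size es ->
  Aseq es eta (Dop es w f) = (fun x => symb es w eta * Aseq es eta f x).
Proof.
move=> Hf Pf sz; rewrite /Dop.
rewrite (reg_sum (reg_AseqT es eta)) => [|j _]; last first.
  by apply: smooth_scale; [exact: openT|exact: smooth_deriveC].
apply/funext => x; rewrite /symb mulr_suml; apply: eq_bigr => j _.
rewrite (reg_scalar (reg_AseqT es eta)); last exact: smooth_deriveC.
by rewrite Aseq_derive// mulrA.
Qed.

(** The operator [p.1 + Dop p.2]. A list of such pairs encodes a product of first order operators,
    so that its symbol comes already factored. *)
Definition affop es (p : C * (nat -> C)) f x := p.1 * f x + Dop es p.2 f x.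
Definition Qop es (l : seq (C * (nat -> C))) f := foldr (affop es) f l.
Definition qsymb es (l : seq (C * (nat -> C))) eta := \prod_(p <- l) (p.1 + symb es p.2 eta).

Lemma reg_affop W es p : spanned W es -> regop W (affop es p).
Proof.
move=> /(reg_Dop p.2)[h1 h2 h3 h4 h5].
have HS f : sm f -> sm (fun x => p.1 * f x).
  by move=> Hf; apply: smooth_scale => //; exact: openT.
split.
- by move=> f Hf; apply: smooth_add; [exact: openT|exact: HS|exact: h1].
- move=> f v Hf; apply/funext => x; rewrite (deriveCD v (HS f Hf) (h1 f Hf) (I : setT x)).
  by rewrite (deriveCZ p.1 v openT Hf (I : setT x)) h2.
- by move=> f g Hf Hg; apply/funext => x; rewrite /affop h3// mulrDr addrACA.
- by move=> m f Hm Wm Hf; apply/funext => x; rewrite /affop h4// mulrDr mulrCA.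
- by move=> f v Hf; apply/funext => x; rewrite /affop h5.
Qed.

Lemma reg_id W : regop W id.
Proof. by split. Qed.

Lemma reg_Qop W es l : spanned W es -> regop W (Qop es l).
Proof.
move=> sp; elim: l => [|p l IH]; first exact: reg_id.
exact: (reg_comp (reg_affop p sp) IH).
Qed.

Lemma Aseq_Qop es l eta f : sm f -> periodic_along es f -> size eta = size es ->
  Aseq es eta (Qop es l f) = (fun x => qsymb es l eta * Aseq es eta f x).
Proof.
move=> Hf Pf sz; have sp : spanned setT es by [].
elim: l => [|p l IH]; first by apply/funext => x; rewrite /qsymb big_nil mul1r.
have HQ : sm (Qop es l f) by exact: (reg_smooth (reg_Qop l sp)).
rewrite /Qop /= -/(Qop es l f) /affop (reg_add (reg_AseqT es eta)); last 2 first.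
- by apply: smooth_scale => //; exact: openT.
- exact: smooth_Dop.
rewrite (reg_scalar (reg_AseqT es eta))// Aseq_Dop//; last exact: (periodic_reg (reg_Qop l sp)).
apply/funext => x; rewrite IH /qsymb big_cons; ring.
Qed.

(* Small divisors: dividing by the symbol of [Dop es w0] costs the derivatives
   in [Qop es l]. *)
Section Solve.
Variables (W : set V) (es : seq V) (w0 : nat -> C) (l : seq (C * (nat -> C))) (c : R).
Hypotheses (sp : spanned W es) (c0 : 0 <= c).
Let zeta := nseq (size es) (0 : int).
Hypothesis symb_neq0 : forall eta, size eta = size es -> eta != zeta ->
  symb es w0 eta * qsymb es l eta != 0.
Hypothesis symb_bound : forall eta, size eta = size es -> eta != zeta ->
  md (symb es w0 eta * qsymb es l eta)^-1 <= c * \prod_(k <- eta) wt k.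

(** The value 0 at the zero frequency selects the solution of mean zero, on which the uniqueness
    argument for equivariance rests. *)
Let g eta := if eta == zeta then 0 else (symb es w0 eta * qsymb es l eta)^-1.

Definition tmean := Aseq es zeta.
Definition tsolve f := multop es g (Qop es l f).

Let g_bound s : size s = size es -> md (g s) <= c * \prod_(k <- s) wt k.
Proof.
move=> sz; rewrite /g; case: eqVneq => [_|s0]; last exact: symb_bound.
by rewrite md0 mulr_ge0//; apply: prodr_ge0 => k _; exact: wt_ge0.
Qed.

Lemma reg_tsolve : regop W tsolve.
Proof. exact: (reg_comp (good_reg (good_multop sp c0 g_bound)) (reg_Qop l sp)). Qed.

Lemma reg_tmean : regop W tmean.
Proof. exact: reg_Aseq. Qed.

Lemma Aseq_tsolve eta f : sm f -> periodic_along es f -> size eta = size es ->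
  Aseq es eta (tsolve f) = (fun x => g eta * (qsymb es l eta * Aseq es eta f x)).
Proof.
move=> Hf Pf sz; rewrite /tsolve (Aseq_multop c0 g_bound) ?Aseq_Qop//.
  exact: (reg_smooth (reg_Qop l sp)).
exact: (periodic_reg (reg_Qop l sp)).
Qed.

Lemma tmean_tsolve f : sm f -> periodic_along es f -> tmean (tsolve f) = (fun=> 0).
Proof.
move=> Hf Pf; rewrite /tmean Aseq_tsolve ?size_nseq//; apply/funext => x.
by rewrite /g eqxx mul0r.
Qed.

Lemma derive_tmean e f : sm f -> periodic_along es f -> e \in es ->
  deriveC e (tmean f) = (fun=> 0).
Proof.
move=> Hf Pf ee; rewrite -(nth_index 0 ee) /tmean (reg_derive (reg_AseqT es _))//.
rewrite Aseq_derive ?size_nseq ?index_mem//; apply/funext => x.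
by rewrite /zeta nth_nseq if_same /freq /iota_freq mulr0 mulr0 mul0r.
Qed.

Lemma tmean_invariant f e x (r : R) : sm f -> periodic_along es f -> e \in es ->
  tmean f (x + r *: e) = tmean f x.
Proof.
move=> Hf Pf ee; apply: derive0_invariant; first exact: (reg_smooth reg_tmean).
exact: derive_tmean.
Qed.

Lemma tmean_id f : sm f -> (forall e, e \in es -> forall x (r : R), f (x + r *: e) = f x) ->
  tmean f = f.
Proof. by move=> Hf He; exact: Aseq_zero. Qed.

Lemma tmean_tmean f : sm f -> periodic_along es f -> tmean (tmean f) = tmean f.
Proof.
move=> Hf Pf; apply: tmean_id; first exact: (reg_smooth reg_tmean).
by move=> e ee x r; exact: tmean_invariant.
Qed.

Lemma Dop_tsolve f : sm f -> periodic_along es f ->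
  Dop es w0 (tsolve f) = (fun x => f x - tmean f x).
Proof.
move=> Hf Pf.
have HS : sm (tsolve f) by exact: (reg_smooth reg_tsolve).
have PS : periodic_along es (tsolve f) by exact: (periodic_reg reg_tsolve).
have HM : sm (tmean f) by exact: (reg_smooth reg_tmean).
have PM : periodic_along es (tmean f) by exact: (periodic_reg reg_tmean).
have HD := smooth_Dop es w0 HS.
have PD : periodic_along es (Dop es w0 (tsolve f)) by exact: (periodic_reg (reg_Dop w0 sp)).
pose h x := Dop es w0 (tsolve f) x - (f x - tmean f x).
have Hh : sm h by apply: smooth_subr => //; exact: smooth_subr.
suff h0 : h = (fun=> 0).
  by apply/funext => x; have /(congr1 (fun u => u x))/eqP := h0; rewrite subr_eq0 => /eqP.
apply: (Aseq_unique (es := es)) => //.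
  by move=> e ee x; rewrite /h PD// Pf// PM.
move=> eta sz; rewrite /h (reg_sub (reg_AseqT es eta))//; last exact: smooth_subr.
rewrite (reg_sub (reg_AseqT es eta))// Aseq_Dop// Aseq_tsolve//.
have AM : Aseq es eta (tmean f) = if eta == zeta then Aseq es eta f else (fun=> 0).
  case: eqVneq => [->|ez]; first exact: tmean_tmean.
  have [j js ej] : exists2 j, (j < size es)%N & eta`_j != 0.
    have : has (fun k => k != 0) eta.
      apply: contraNT ez; rewrite -all_predC => /allP H; apply/eqP.
      apply: (@eq_from_nth _ 0); rewrite /zeta ?size_nseq// => i ie.
      rewrite nth_nseq if_same; apply/eqP; have := H _ (mem_nth 0 ie).
      by rewrite /= negbK.
    by move=> /(has_nthP 0)[j]; rewrite sz => js ej; exists j.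
  have := Aseq_derive HM PM sz js; rewrite derive_tmean ?mem_nth//.
  rewrite (reg_zero (reg_AseqT es eta)) => E; apply/funext => x.
  have /(congr1 (fun u => u x))/esym/eqP := E; rewrite mulf_eq0 => /orP[|/eqP//].
  have i0 : iC != 0 :> C by rewrite eq_complex/= oner_eq0 andbF.
  rewrite /freq mulf_eq0 (negbTE i0)/= => /eqP/complexI/eqP.
  by rewrite /iota_freq mulf_eq0 mulrn_eq0/= gt_eqF ?pi_gt0//= intr_eq0 (negbTE ej).
apply/funext => x; rewrite AM /g; case: eqVneq => [ez|ez].
  by rewrite mul0r mulr0 subrr subr0.
have := symb_neq0 sz ez; move: (symb es w0 eta) (qsymb es l eta) => a b ab.
move: (mulVf ab); move: (a * b)^-1 => X XE; move: (Aseq es eta f x) => A.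
have -> : a * (X * (b * A)) = X * (a * b) * A by ring.
by rewrite XE mul1r subr0 subrr.
Qed.

End Solve.

End TorusSolution.

(** * The norm form of a number field *)

Section NumberField.
Context {R : realType} {K : fieldExtType rat}.
Local Notation C := R[i].
Local Notation N := (\dim {: K}).
Variable sigma : 'I_N -> {rmorphism K -> C}.
Hypothesis sigma_inj : forall i j, sigma i =1 sigma j -> i = j.

Lemma rmorph_scale (f : {rmorphism K -> C}) (a : rat) x : f (a *: x) = ratr a * f x.
Proof. by rewrite -mulr_algl rmorphM/= -[f a%:A]/((f \o in_alg K) a) fmorph_eq_rat. Qed.

(** The classical shortening: the relation at y0 y minus [sigma i0 y0] times the relation at y no
    longer involves [i0], and y0 is chosen to separate j from [i0]. *)
Lemma dedekind (A : {set 'I_N}) (c : 'I_N -> C) :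
  (forall y, \sum_(i in A) c i * sigma i y = 0) -> forall i, i \in A -> c i = 0.
Proof.
have [m] := ubnP #|A|; elim: m A c => // m IH A c Am Hc i0 iA.
have H j : j \in A -> j != i0 -> c j = 0.
  move=> jA ji.
  have [y0 y0P] : exists y0, sigma j y0 != sigma i0 y0.
    apply: contrapT => H; move/eqP: ji; apply; apply: sigma_inj => y.
    by apply/eqP; apply: contrapT => Hy; apply: H; exists y; apply/negP.
  have := IH (A :\ i0)%SET (fun i => c i * (sigma i y0 - sigma i0 y0)) _ _ j.
  rewrite (cardsD1 i0 A) iA add1n ltnS in Am.
  move=> /(_ Am) H; have : c j * (sigma j y0 - sigma i0 y0) = 0.
    apply: H; last by rewrite !inE ji.
    move=> y; have := Hc (y0 * y); have := Hc y.
    move=> /(congr1 (fun z => sigma i0 y0 * z)) H1 H2.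
    rewrite mulr0 mulr_sumr in H1.
    have : \sum_(i in A) c i * (sigma i y0 - sigma i0 y0) * sigma i y = 0.
      transitivity (\sum_(i in A) c i * sigma i (y0 * y) -
        \sum_(i in A) sigma i0 y0 * (c i * sigma i y)); last by rewrite H2 H1 subrr.
      by rewrite -sumrB; apply: eq_bigr => i _; rewrite rmorphM/=; ring.
    by rewrite (big_setD1 i0)//= subrr mulr0 mul0r add0r.
  by move/eqP; rewrite mulf_eq0 subr_eq0 (negbTE y0P) orbF => /eqP.
have := Hc 1; rewrite (big_setD1 i0)//= rmorph1 mulr1 big1 ?addr0// => j.
by rewrite !inE => /andP[ji jA]; rewrite H// mul0r.
Qed.

Lemma common_denominator (I : finType) (q : I -> rat) :
  exists2 m : int, m != 0 & forall i, exists z : int, m%:~R * q i = z%:~R.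
Proof.
exists (\prod_i denq (q i)).
  by apply/prodf_neq0 => i _; exact: denq_neq0.
move=> i; exists (numq (q i) * \prod_(j | j != i) denq (q j)).
by rewrite (bigD1 i)//= !rmorphM/= mulrAC numqE [_ * q i]mulrC.
Qed.

Local Notation vb := (vbasis {: K}).
Let v (j : 'I_N) : K := tnth vb j.

Let coordE y : y = \sum_j coord vb j y *: v j.
Proof.
rewrite {1}(coord_vbasis (memvf y)); apply: eq_bigr => j _.
by rewrite /v (tnth_nth 0).
Qed.

(* [beta] is dual to [b], so the product over [i] is the norm of a non-zero
   element of K whose denominator divides the discriminant [\det G0]. *)
Theorem integral_dual_basis : exists b : 'I_N -> K, exists beta : 'M[C]_N, exists2 d : R, 0 < d &
  [/\ forall j, ring_of_integers (b j),
      forall i i', \sum_j beta j i * sigma i' (b j) = (i == i')%:R &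
      forall xi : 'I_N -> int, (exists j, xi j != 0) ->
        d <= md (\prod_i \sum_j beta j i * (xi j)%:~R)].
Proof.
(* Once [m] clears the denominators of the structure constants of the basis [v], the multiples m v_j
   have integral structure constants, namely [z]. *)
have [m m0 Hm] := @common_denominator ('I_N * 'I_N * 'I_N)%type
  (fun p => coord vb p.2 (v p.1.1 * v p.1.2)).
have [z Hz] := choice Hm.
pose b j := m%:~R *: v j.
have bM j k : b j * b k = \sum_l (z (j, k, l))%:~R *: b l.
  rewrite /b -scalerAl -scalerAr scalerA (coordE (v j * v k)) scaler_sumr.
  apply: eq_bigr => l _; rewrite !scalerA; congr (_ *: _).
  by have := Hz (j, k, l) => /= <-; rewrite mulrAC.
(* [Z xi] is the matrix of the multiplication by [elt xi] in the basis [b], so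
   its determinant and trace are the norm and the trace of [elt xi]. *)
pose Z (xi : 'I_N -> int) : 'M[int]_N := \matrix_(j, l) \sum_k xi k * z (k, j, l).
pose elt (xi : 'I_N -> int) : K := \sum_k (xi k)%:~R *: b k.
have ZP xi j : elt xi * b j = \sum_l (Z xi j l)%:~R *: b l.
  rewrite /elt mulr_suml; under eq_bigr do rewrite -scalerAl bM scaler_sumr.
  rewrite exchange_big/=; apply: eq_bigr => l _.
  rewrite mxE rmorph_sum/= scaler_suml; apply: eq_bigr => k _.
  by rewrite scalerA rmorphM.
pose B : 'M[C]_N := \matrix_(j, i) sigma i (b j).
have sigmaZ i (a : int) x : sigma i (a%:~R *: x) = a%:~R * sigma i x.
  by rewrite rmorph_scale ratr_int.
have ZB xi : map_mx intr (Z xi) *m B = B *m diag_mx (\row_i sigma i (elt xi)).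
  apply/matrixP => j i; rewrite mul_mx_diag !mxE mulrC -rmorphM/= ZP rmorph_sum/=.
  by apply: eq_bigr => l _; rewrite !mxE [in RHS]sigmaZ.
have m0C : (m%:~R : C) != 0 by rewrite intr_eq0.
(* A vector in the kernel is a linear relation among the embeddings on a basis, hence on K, against
   Dedekind's lemma. *)
have BU : B \in unitmx.
  rewrite unitmxE -det_tr unitfE; apply/negP => /det0P[u u0 uB].
  case/negP: u0; apply/eqP/rowP => i; rewrite mxE.
  have := @dedekind [set: 'I_N]%SET (fun i => u 0 i) _ i; apply; last by rewrite inE.
  move=> y; rewrite (eq_bigl xpredT) => [|k]; last by rewrite inE.
  rewrite (coordE y).
  under eq_bigr do rewrite rmorph_sum/= mulr_sumr.
  rewrite exchange_big/= big1// => j _.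
  have /rowP/(_ j) := uB; rewrite !mxE => E.
  apply: (mulfI m0C); rewrite mulr0 mulr_sumr.
  have E' := congr1 (fun z => ratr (coord vb j y) * z) E.
  rewrite mulr0 mulr_sumr in E'; rewrite -[RHS]E'.
  by apply: eq_bigr => k _; rewrite !mxE /b sigmaZ rmorph_scale; ring.
have detZ xi : \prod_i sigma i (elt xi) = (\det (Z xi))%:~R.
  have := congr1 determinant (ZB xi); rewrite !det_mulmx det_diag det_map_mx mulrC.
  have dB : \det B != 0 by rewrite -unitfE -unitmxE.
  move=> /(mulfI dB) ->; by apply: eq_bigr => i _; rewrite mxE.
have trZ xi : \sum_i sigma i (elt xi) = (\tr (Z xi))%:~R.
  have : map_mx intr (Z xi) = B *m diag_mx (\row_i sigma i (elt xi)) *m invmx B.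
    by rewrite -ZB mulmxK.
  move=> /(congr1 mxtrace); rewrite mxtrace_mulC mulmxA mulVmx// mul1mx.
  rewrite mxtrace_diag => E; rewrite -(_ : \tr (map_mx intr (Z xi)) = (\tr (Z xi))%:~R).
    by rewrite E; apply: eq_bigr => i _; rewrite mxE.
  by rewrite /mxtrace rmorph_sum/=; apply: eq_bigr => i _; rewrite mxE.
pose G0 : 'M[int]_N := \matrix_(j, k) \tr (Z (fun l => z (j, k, l))).
have G0P : map_mx intr G0 = B *m B^T.
  apply/matrixP => j k; rewrite !mxE -trZ; apply: eq_bigr => i _.
  by rewrite !mxE -rmorphM/= bM.
have dG0 : \det G0 != 0.
  rewrite -(intr_eq0 C) -det_map_mx G0P det_mulmx det_tr mulf_neq0//;
    by rewrite -unitfE -unitmxE.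
pose D : C := (\det G0)%:~R; have D0 : D != 0 by rewrite intr_eq0.
pose beta : 'M[C]_N := D^-1 *: (map_mx intr (\adj G0) *m B).
have betaB : beta *m B^T = 1%:M.
  rewrite /beta -scalemxAl -mulmxA -G0P -map_mxM mul_adj_mx map_scalar_mx scale_scalar_mx.
  by rewrite mulVf.
have Bbeta : B^T *m beta = 1%:M by exact: mulmx1C.
(* Each of the N factors of the product is [D^-1] times the conjugate of an element with integral
   coordinates, whose norm is a non-zero integer. *)
exists b, beta, (md D ^- N).
  rewrite invr_gt0 exprn_gt0// lt_neqAle md_ge0 andbT eq_sym.
  by apply: contra D0 => /eqP/md_eq0/eqP.
split.
- move=> j; pose xi k : int := (k == j)%:Z.
  have ej : elt xi = b j.
    rewrite /elt (bigD1 j)//= big1 ?addr0 => [|k kj].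
      by rewrite /xi eqxx scale1r.
    by rewrite /xi (negbTE kj) scale0r.
  (* The row of the [b l] is an eigenvector of the transposed multiplication matrix, with eigenvalue
     [b j]; so [b j] is a root of a monic integral polynomial. *)
  exists (char_poly (Z xi)^T); first exact: char_poly_monic.
  rewrite map_char_poly -eigenvalue_root_char; apply/eigenvalueP.
  exists (\row_l b l).
    apply/rowP => k; rewrite !mxE -ej ZP; apply: eq_bigr => l _.
    by rewrite !mxE mulrzr scaler_int.
  apply/eqP => /rowP/(_ j); rewrite !mxE => /eqP; rewrite scaler_eq0 intr_eq0 (negbTE m0)/=.
  by apply/negP/(free_not0 (basis_free (vbasisP _)) (mem_tnth _ _)).
- move=> i i'; have /matrixP/(_ i' i) := Bbeta; rewrite !mxE eq_sym => <-.
  by apply: eq_bigr => j _; rewrite !mxE mulrC.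
- move=> xi [j0 xij0].
  pose xi' k := \sum_j xi j * (\adj G0) j k.
  have y_elt i : \sum_j beta j i * (xi j)%:~R = D^-1 * sigma i (elt xi').
    rewrite /elt rmorph_sum/= mulr_sumr.
    under eq_bigr do rewrite mxE mulrAC mxE mulr_sumr.
    rewrite exchange_big/=; apply: eq_bigr => k _.
    rewrite sigmaZ /xi' rmorph_sum/= mulr_suml mulr_sumr; apply: eq_bigr => j _.
    rewrite [map_mx _ _ j k]mxE [B k i]mxE rmorphM/=; ring.
  under eq_bigr do rewrite y_elt.
  rewrite big_split/= prodr_const card_ord detZ mdM -exprVn -mdV.
  have -> : md D^-1 ^+ N = md (D^-1 ^+ N).
    by rewrite mdX.
  rewrite ler_peMr ?md_ge0//.
  (* A zero norm means that [elt xi'] vanishes, and then so do all the forms in xi; since [beta] is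
     invertible, xi would be 0. *)
  have Z0 : \det (Z xi') != 0.
    apply/eqP => dZ; move/eqP: xij0; apply.
    have : \prod_i sigma i (elt xi') == 0 by rewrite detZ dZ.
    move=> /prodf_eq0[i _]; rewrite fmorph_eq0 => /eqP e0.
    pose X : 'rV[C]_N := \row_j (xi j)%:~R.
    have X0 : X *m beta = 0.
      apply/rowP => k; rewrite mxE [RHS]mxE.
      transitivity (\sum_j beta j k * (xi j)%:~R); last by rewrite y_elt e0 rmorph0 mulr0.
      by apply: eq_bigr => j _; rewrite [X 0 j]mxE mulrC.
    have : X = 0 by rewrite -[X]mulmx1 -betaB mulmxA X0 mul0mx.
    by move=> /rowP/(_ j0)/eqP; rewrite !mxE intr_eq0 => /eqP.
  rewrite -(rmorph_int (real_complex R)) md_real -intr_norm ler1z.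
  by move: Z0; lia.
Qed.

End NumberField.

(** * Logarithmic coordinates *)

Section TorusFibres.
Context {R : realType} {s t : nat} {K : fieldExtType rat}.
Local Notation C := R[i].
Local Notation n := (s + t)%N.
Local Notation N := (s + t + t)%N.
Local Notation V := (Cn R n).
Variable sigma : 'I_N -> {rmorphism K -> C}.
Hypotheses (ht : (0 < t)%N) (hK : \dim {: K} = N) (hsigma : is_enum_embeddings sigma).
Local Notation sm := (@smooth R V setT).
Implicit Types (F : V -> C) (v w x : V).

Definition tau (b : K) : V :=
  (\row_k complex.Re (sigma (lshift t k) b), \row_k complex.Im (sigma (lshift t k) b)).

(** The directions that leave lambda fixed, that is, those tangent to the tori given by the
    translations [tau b]. *)
Definition flat_dir (w : V) : Prop := forall k : 'I_n, (k < s)%N -> w.2 0 k = 0.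

(* In the coordinates of [log_chart] below, [theta j] is the action of dzbar_j
   on the coefficients with respect to the frame in which dwbar_j is divided by
   Im w_j for [j < s]. *)
Definition theta (j : 'I_n) F v : C :=
  ((if (j < s)%N then (expR (v.2 0 j))%:C%C else 1) * deriveC (bas (inl j)) F v +
   iC * deriveC (bas (inr j)) F v) / 2.

Definition l0 : 'I_n := rshift s (Ordinal ht).
(** The embedding conjugate to that of the place [l0]: it is the one to which the derivative d/dzbar
    at [l0] belongs. *)
Definition i0 : 'I_N := rshift (s + t) (Ordinal ht).

Definition conj_index (k : 'I_n) : 'I_N :=
  match fintype.split k with inl _ => lshift t k | inr l => rshift (s + t) l end.

Lemma splitK_lt (k : 'I_n) : (k < s)%N -> exists i : 'I_s, k = lshift t i.
Proof. by move=> ks; exists (Ordinal ks); apply: val_inj. Qed.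

Lemma splitK_ge (k : 'I_n) : (s <= k)%N -> exists i : 'I_t, k = rshift s i.
Proof.
move=> sk; have kt : (k - s < t)%N by have := ltn_ord k; lia.
by exists (Ordinal kt); apply: val_inj => /=; lia.
Qed.

Lemma sigma_conj_index k b : sigma (conj_index k) b = conjc (sigma (lshift t k) b).
Proof.
have [_ h1 _ h3] := hsigma; rewrite /conj_index.
case: (ltnP k s) => ks.
  have [i ->] := splitK_lt ks.
  case: fintype.splitP => [j _|j /= ij]; last by have := ltn_ord i; lia.
  have := h1 i b; by case: (sigma _ b) => a c /= ->; rewrite oppr0.
have [i ->] := splitK_ge ks.
case: fintype.splitP => [j /= ij|j /= ij]; first by have := ltn_ord j; lia.
have -> : j = i by apply: val_inj; move: ij => /=; lia.
by have := h3 i b => ->; rewrite conjcK.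
Qed.

Lemma sigma_inj i j : sigma i =1 sigma j -> i = j.
Proof.
have [h0 _ _ _] := hsigma; move=> ij; have [k [_ kU]] := h0 (sigma i).
by rewrite -(kU i)// -(kU j).
Qed.

Lemma conj_index_lt (k : 'I_n) : (k < s)%N -> conj_index k = lshift t k.
Proof.
move=> ks; rewrite /conj_index; case: fintype.splitP => [//|j kj].
by move: ks; rewrite kj ltnNge leq_addr.
Qed.

Lemma conj_index_ge (k : 'I_n) : (s <= k)%N -> conj_index k = (k + t)%N :> nat.
Proof.
move=> ks; rewrite /conj_index; case: fintype.splitP => [j kj|j /= ->]; last by lia.
by move: ks; rewrite kj leqNgt ltn_ord.
Qed.

Lemma lshift_conj_index (k k' : 'I_n) : (lshift t k == conj_index k') = (k' < s)%N && (k == k').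
Proof.
case: (ltnP k' s) => ks /=; first by rewrite (conj_index_lt ks) (inj_eq (@lshift_inj _ _)).
by apply/negP => /eqP/(congr1 val); rewrite /= conj_index_ge//; have := ltn_ord k; lia.
Qed.

Lemma conj_index_lshift (k k' : 'I_n) : (s <= k)%N -> (conj_index k == lshift t k') = false.
Proof. by move=> ks; rewrite eq_sym lshift_conj_index ltnNge ks. Qed.

Lemma conj_index_inj : injective conj_index.
Proof.
move=> k k' /(congr1 val) /=; case: (ltnP k s) => ks; case: (ltnP k' s) => ks'.
- by rewrite !conj_index_lt//= => kk; apply: val_inj.
- by rewrite conj_index_lt// conj_index_ge//=; have := ltn_ord k; lia.
- by rewrite conj_index_ge// conj_index_lt//=; have := ltn_ord k'; lia.
- by rewrite !conj_index_ge// => kk; apply: val_inj => /=; lia.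
Qed.

Lemma i0_lshift (k : 'I_n) : (i0 == lshift t k) = false.
Proof. by apply/negP => /eqP/(congr1 val) /=; have := ltn_ord k; lia. Qed.

Lemma i0_conj_index (k : 'I_n) : (i0 == conj_index k) = (k == l0).
Proof.
rewrite eq_sym -(inj_eq conj_index_inj); congr (_ == _); apply: val_inj => /=.
by rewrite conj_index_ge /= ?leq_addr//; lia.
Qed.

Lemma deriveC_coords F v w : sm F -> deriveC w F v =
  \sum_(k < n) ((w.1 0 k)%:C%C * deriveC (bas (inl k)) F v +
                (w.2 0 k)%:C%C * deriveC (bas (inr k)) F v).
Proof.
move=> HF; rewrite {1}(sum_crd w).
have H (J : Type) (r : seq J) (c : J -> R) (u : J -> V) :
    deriveC (\sum_(i <- r) c i *: u i) F v = \sum_(i <- r) (c i)%:C%C * deriveC (u i) F v.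
  elim: r => [|i r IH].
    rewrite !big_nil; have := deriveC_scale_dir v (0 : V) 0 HF.
    by rewrite scale0r mul0r.
  rewrite !big_cons -IH -[X in c i *: u i + X]scale1r (deriveC_lin _ _ _ _ openT HF (I : setT v)).
  by rewrite mul1r.
rewrite H big_sumType/= -big_split/=.
by apply: eq_bigr => k _.
Qed.

(** [M] is the mean over the torus through a point and [S] the solution of mean zero. The chosen
    vectors [tau (b j)] form a real basis of the flat directions, so periodicity along them suffices
    for the construction. *)
Lemma torus_solution : exists S M : (V -> C) -> V -> C,
  [/\ regop flat_dir S, regop flat_dir M,
     forall F, sm F -> (forall w v, flat_dir w -> F (v + w) = F v) -> M F = F &
     forall F, sm F -> (forall b v, ring_of_integers b -> F (v + tau b) = F v) ->
     [/\ theta l0 (S F) = (fun v => F v - M F v),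
         forall w v, flat_dir w -> M F (v + w) = M F v &
         M (S F) = (fun=> 0)]].
Proof.
have [b [beta [d d0 [bO betaP normP]]]] :
  exists b : 'I_N -> K, exists beta : 'M[C]_N, exists2 d : R, 0 < d &
  [/\ forall j, ring_of_integers (b j),
      forall i i', \sum_j beta j i * sigma i' (b j) = (i == i')%:R &
      forall xi : 'I_N -> int, (exists j, xi j != 0) ->
        d <= md (\prod_i \sum_j beta j i * (xi j)%:~R)].
  have sI := sigma_inj; move: (sigma) sI; rewrite -hK => sg sI.
  exact: integral_dual_basis.
pose es : seq V := [seq tau (b j) | j <- enum 'I_N].
have szes : size es = N by rewrite size_map size_enum_ord.
have nthes (j : 'I_N) : es`_j = tau (b j).
  by rewrite (nth_map j) ?size_enum_ord// nth_ord_enum.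
pose w (i : 'I_N) (j : nat) : C := oapp (fun j : 'I_N => beta j i) 0 (insub j).
have wE i (j : 'I_N) : w i j = beta j i by rewrite /w valK.
pose dl (e : C) (i : 'I_N) (j : nat) : C := if (i : nat) == j then e else 0.
have sum_es (G : nat -> C) : \sum_(j < size es) G j = \sum_(j < N) G j.
  by rewrite szes.
have sp : spanned flat_dir es.
  move=> e /mapP[j _ ->] r k ks; rewrite !mxE.
  have [i ->] := splitK_lt ks; have [_ h1 _ _] := hsigma.
  by rewrite h1 mulr0.
pose rI := index_enum 'I_N.
(* [theta l0] is [Dop es (w i0)].  The operators [Dop es (w i)] at the other
   embeddings complete its symbol to the norm form, and the operators
   [1 +- Dop es (dl 1 j)] make the inverse symbol summable. *)
pose l := [seq ((0 : C), w i) | i <- rI & i != i0] ++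
  ([seq ((1 : C), dl 1 i) | i <- rI] ++ [seq ((1 : C), dl (-1) i) | i <- rI]).
pose z (eta : seq int) (j : 'I_N) := eta`_j.
have symbw i eta : symb es (w i) eta = freq 1 * \sum_j beta j i * (z eta j)%:~R.
  rewrite /symb (sum_es (fun j => w i j * freq eta`_j)) mulr_sumr.
  apply: eq_bigr => j _; rewrite wE /freq /iota_freq /z mulr1 rmorphM/= rmorph_int; ring.
have symbd e i eta : symb es (dl e i) eta = e * freq (z eta i).
  rewrite /symb (sum_es (fun j => dl e i j * freq eta`_j)) (bigD1 i)//= /dl eqxx.
  rewrite big1 ?addr0// => j ji; rewrite ifF ?mul0r//.
  by rewrite eq_sym; apply: negbTE.
(* The factors at all embeddings make up the norm form, and the factors 1 + i a and 1 - i a pair up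
   to 1 + a^2, with a = 2 pi k at each coordinate k of the frequency. *)
have total eta : symb es (w i0) eta * qsymb es l eta =
    freq 1 ^+ N * (\prod_i \sum_j beta j i * (z eta j)%:~R) *
    \prod_i (1 + (iota_freq (z eta i) ^+ 2)%:C%C).
  rewrite /qsymb /l !big_cat !big_map big_filter /= -big_split/= mulrA; congr (_ * _).
    under eq_bigr do rewrite add0r symbw.
    rewrite symbw -(bigD1 (P := xpredT) i0 (F := fun i => freq 1 * \sum_j beta j i * (z eta j)%:~R))//=.
    by rewrite big_split/= prodr_const card_ord.
  apply: eq_bigr => i _; rewrite !symbd /freq.
  have -> : (iota_freq (z eta i) ^+ 2)%:C%C = (iota_freq (z eta i))%:C%C ^+ 2 :> C.
    by rewrite rmorphXn.
  have ii : iC * iC = -1 :> C by apply: ReIm_inj; rewrite ?(cReM, cImM)/=; ring.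
  have -> : (1 + 1 * (iC * (iota_freq (z eta i))%:C%C)) * (1 + -1 * (iC * (iota_freq (z eta i))%:C%C))
    = 1 - (iC * iC) * (iota_freq (z eta i))%:C%C ^+ 2 :> C by ring.
  by rewrite ii mulN1r opprK.
have totalB eta : size eta = size es -> eta != nseq (size es) 0 ->
    d * \prod_(k <- eta) (wt k)^-1 <= md (symb es (w i0) eta * qsymb es l eta).
  move=> sz ez.
  have zn : exists j, z eta j != 0.
    apply: contrapT => H; move/eqP: ez; apply; apply: (@eq_from_nth _ 0).
      by rewrite size_nseq.
    move=> j je; rewrite nth_nseq if_same; have jN : (j < N)%N by rewrite -szes -sz.
    by apply: contrapT => /eqP Hj; apply: H; exists (Ordinal jN).
  have -> : \prod_(k <- eta) (wt k)^-1 = \prod_(j < N) (wt (z eta j))^-1 :> R.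
    by rewrite (big_nth 0) sz szes big_mkord.
  rewrite total !mdM; apply: ler_pM.
  - exact: ltW.
  - by apply: prodr_ge0 => j _; rewrite invr_ge0 wt_ge0.
  - rewrite -[X in X <= _]mul1r; apply: ler_pM => //; [exact: ltW| |exact: normP].
    rewrite mdX; apply: exprn_ege1; rewrite /freq mdM md_real.
    have -> : md (iC : C) = 1 by rewrite /md/= expr0n/= add0r expr1n sqrtr1.
    rewrite mul1r /iota_freq mulr1 ger0_norm; last by rewrite mulrn_wge0// pi_ge0.
    by have := @pi_ge2 R; rewrite [pi *+ 2]mulr2n; lra.
  - rewrite (big_morph _ (@mdM R) (@md1 R)); apply: ler_prod => j _; rewrite invr_ge0 wt_ge0 andTb.
    have -> : 1 + (iota_freq (z eta j) ^+ 2)%:C%C = (1 + iota_freq (z eta j) ^+ 2)%:C%C :> C.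
      by rewrite rmorphD.
    rewrite md_real ger0_norm ?addr_ge0 ?sqr_ge0// /wt invrK lerD2l /iota_freq exprMn.
    rewrite ler_peMl ?sqr_ge0// exprn_ege1//.
    by have := @pi_ge2 R; rewrite [pi *+ 2]mulr2n; lra.
have prod_wt eta : 0 < \prod_(k <- eta) (wt k)^-1 :> R.
  by apply: prodr_gt0 => k _; rewrite /wt invrK ltr_wpDr// sqr_ge0.
have neq0 eta : size eta = size es -> eta != nseq (size es) 0 ->
    symb es (w i0) eta * qsymb es l eta != 0.
  move=> sz ez; apply/eqP => E; have := totalB eta sz ez; rewrite E md0 leNgt.
  by rewrite mulr_gt0.
have bound eta : size eta = size es -> eta != nseq (size es) 0 ->
    md (symb es (w i0) eta * qsymb es l eta)^-1 <= d^-1 * \prod_(k <- eta) wt k.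
  move=> sz ez; rewrite mdV.
  have -> : d^-1 * \prod_(k <- eta) wt k = (d * \prod_(k <- eta) (wt k)^-1)^-1 :> R.
    by rewrite invfM -prodfV; congr (_ * _); apply: eq_bigr => k _; rewrite invrK.
  rewrite lef_pV2 ?posrE ?totalB//; last by rewrite mulr_gt0.
  apply: lt_le_trans (totalB eta sz ez); by rewrite mulr_gt0.
have d0' : 0 <= d^-1 by rewrite invr_ge0 ltW.
(* The derivative along [tau (b j)] is the sum over i of [sigma i (b j)] times the derivative
   d/dx_k, d/dz_k or d/dzbar_k attached to the embedding i; duality of [beta] and [b] isolates that
   derivative. The indicators cover the three cases at once. *)
have DopE i F v : sm F -> Dop es (w i) F v = \sum_(k < n)
    ((((i == lshift t k)%:R + (i == conj_index k)%:R) / 2) * deriveC (bas (inl k)) F v +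
     (- iC * ((i == lshift t k)%:R - (i == conj_index k)%:R) / 2) * deriveC (bas (inr k)) F v).
  move=> HF; rewrite /Dop (sum_es (fun j => w i j * deriveC es`_j F v)).
  under eq_bigr do rewrite wE nthes (deriveC_coords _ _ HF) mulr_sumr.
  rewrite exchange_big/=; apply: eq_bigr => k _.
  rewrite -!betaP -big_split/= -sumrB mulr_sumr !mulr_suml -big_split/=.
  apply: eq_bigr => j _; rewrite sigma_conj_index !mxE.
  have eR (u : C) : (complex.Re u)%:C%C = (u + conjc u) / 2.
    by rewrite ReJ_add.
  have eI (u : C) : (complex.Im u)%:C%C = - iC * (u - conjc u) / 2.
    rewrite ImJ_sub; have -> : ('i)%C = iC :> C by []. ring.
  rewrite eR eI; move: (conjc _) (deriveC _ _ _) (deriveC (bas (inr k)) _ _) => z0 X Y; ring.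
exists (tsolve es (w i0) l), (tmean es); split.
- exact: (reg_tsolve sp d0' bound).
- exact: reg_tmean.
- move=> F HF Fw; apply: (tmean_id HF) => e ee x r; apply: Fw.
  exact: sp.
- move=> F HF Fb.
  have Fp : periodic_along es F by move=> _ /mapP[j _ ->] x; exact: Fb.
  have HS : sm (tsolve es (w i0) l F) by exact: (reg_smooth (reg_tsolve sp d0' bound)).
  split.
  + rewrite -(Dop_tsolve sp d0' neq0 bound HF Fp); apply/funext => v.
    rewrite (DopE i0 _ _ HS) (bigD1 l0)//= big1 ?addr0 => [|k kl].
      rewrite i0_lshift i0_conj_index eqxx /theta ltnNge leq_addr/=.
      move: (deriveC _ _ _) (deriveC (bas (inr l0)) _ _) => X Y; ring.
    by rewrite i0_lshift i0_conj_index (negbTE kl) subrr addr0 mulr0 !mul0r addr0.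
  + move=> u v Wu; have HM : sm (tmean es F) by exact: (reg_smooth (reg_tmean sp)).
    rewrite -[u in LHS]scale1r; apply: derive0_invariant => //; apply/funext => x.
    (* Letting i run over all embeddings gives d/dx_k at real places and both d/dz_k and d/dzbar_k
       at the others, so every flat derivative of the mean vanishes. *)
    have D0 i : Dop es (w i) (tmean es F) x = 0.
      rewrite /Dop big1// => j _; rewrite (derive_tmean HF Fp) ?mulr0// mem_nth//.
    rewrite (deriveC_coords _ _ HM) big1// => k _.
    have := D0 (lshift t k); rewrite (DopE _ _ _ HM) (bigD1 k)//= big1 => [|k' kk]; last first.
      by rewrite lshift_conj_index (inj_eq (@lshift_inj _ _)) eq_sym (negbTE kk) andbF subrr addr0 mulr0 !mul0r addr0.
    rewrite addr0 lshift_conj_index !eqxx andbT; case: ltnP => ks.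
      rewrite subrr mulr0 !mul0r addr0 (_ : (1 + 1) / 2 = 1 :> C) ?mul1r => [->|].
        by rewrite Wu// mulr0 mul0r addr0.
      by rewrite divff// pnatr_eq0.
    move=> E1; have := D0 (conj_index k); rewrite (DopE _ _ _ HM) (bigD1 k)//= big1 => [|k' kk]; last first.
      by rewrite (conj_index_lshift _ ks) (inj_eq conj_index_inj) eq_sym (negbTE kk) subrr addr0 mulr0 !mul0r addr0.
    rewrite addr0 conj_index_lshift// eqxx => E2.
    have i2 : iC * iC = -1 :> C by apply: ReIm_inj; rewrite ?(cReM, cImM)/=; ring.
    move: E1 E2; move: (deriveC (bas (inl k)) _ _) (deriveC (bas (inr k)) _ _) => X Y.
    rewrite /= !(addr0, add0r, subr0, sub0r) => E1 E2.
    have X0 : X = 0.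
      transitivity (1 / 2 * X + - iC * 1 / 2 * Y + (1 / 2 * X + - iC * -1 / 2 * Y)).
        by field.
      by rewrite E1 E2 addr0.
    have Y0 : Y = 0.
      transitivity (iC * (1 / 2 * X + - iC * 1 / 2 * Y) * 2 - iC * X - (iC * iC + 1) * 0 * Y).
        rewrite X0; transitivity (- (iC * iC) * Y); first by rewrite i2 opprK mul1r.
        by field.
      by rewrite E1 X0 !mulr0 !mul0r !subr0.
    by rewrite X0 Y0 !mulr0 addr0.
  + exact: (tmean_tsolve sp d0' bound).
Qed.

End TorusFibres.

(** * The operators theta and the action of units *)

Section LogChart.
Context {R : realType} {s t : nat} {K : fieldExtType rat}.
Local Notation C := R[i].
Local Notation n := (s + t)%N.
Local Notation N := (s + t + t)%N.
Local Notation V := (Cn R n).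
Variable sigma : 'I_N -> {rmorphism K -> C}.
Hypothesis hsigma : is_enum_embeddings sigma.
Local Notation sm := (@smooth R V setT).
Local Notation sg k := (sigma (lshift t k)).
Local Notation theta := (@theta R s t).
Local Notation flat_dir := (@flat_dir R s t).
Implicit Types (F G : V -> C) (v w x : V) (j k : 'I_n) (u : K).

Lemma smooth_exp_crd b : sm (fun v => (expR (crd b v))%:C%C).
Proof.
pose P (f : V -> C) := exists c : R, f = (fun v => (c * expR (crd b v))%:C%C).
apply: (@smooth_coind _ _ P); last by exists 1; apply/funext => v; rewrite mul1r.
move=> _ [c ->].
have D (v w : V) : is_derive v w (fun v => c * expR (crd b v)) (c * crd b w * expR (crd b v)).
  have := is_derive_scale_dir (crd b w) (is_derive_expR (crd b v)).
  move=> /is_derive_epsP H.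
  have dE : is_derive v w (fun v => expR (crd b v)) (crd b w * expR (crd b v)).
    apply/is_derive_epsP => e /H[d d0 Hd]; exists d => // h /Hd.
    by rewrite (_ : h *: (crd b w *: (1 : R)) = h * crd b w) ?crdD ?crdZ//; congr (_ * _); exact: mulr1.
  have := is_deriveZ c dE; rewrite -mulrA.
  exact.
have cE (c' : R) (x : V) : {for x, continuous (fun v => c' * expR (crd b v))}.
  have ce : {for x, continuous (expR \o crd b)}.
    by apply: continuous_comp; [exact: crd_continuous|exact: continuous_expR].
  exact: (@cvgM _ _ (nbhs x) _ (fun=> c') (expR \o crd b) _ _ (cvg_cst c') ce).
split=> [x|v]; first by split; [exact: cE|exact: cst_continuous].
split=> [x|]; first by split; [have [] := D x v|exact: derivable_cst].
exists (c * crd b v); apply/funext => x; rewrite /deriveC/= derive_cst.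
by have [_ ->] := D x v.
Qed.

Definition thcoef j v : C := if (j < s)%N then (expR (v.2 0 j))%:C%C else 1.

Lemma smooth_thcoef j : sm (thcoef j).
Proof.
rewrite /thcoef; case: (j < s)%N; last by apply: smooth_cst; exact: openT.
exact: (smooth_exp_crd (inr j)).
Qed.

Lemma thcoef_flat j w v : flat_dir w -> thcoef j (v + w) = thcoef j v.
Proof.
by move=> Ww; rewrite /thcoef; case: ltnP => // js; rewrite mxE (Ww j js) addr0.
Qed.

Lemma thetaE j F : theta j F = (fun v => 2^-1 * (thcoef j v * deriveC (bas (inl j)) F v +
  iC * deriveC (bas (inr j)) F v)).
Proof. by apply/funext => v; rewrite mulrC. Qed.

Lemma smooth_theta_aux j F : sm F ->
  sm (fun v => thcoef j v * deriveC (bas (inl j)) F v) /\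
  sm (fun v => iC * deriveC (bas (inr j)) F v).
Proof.
move=> HF; split; first by apply: smooth_mul; [exact: openT|exact: smooth_thcoef|exact: smooth_deriveC].
by apply: smooth_scale; [exact: openT|exact: smooth_deriveC].
Qed.

Lemma smooth_theta j F : sm F -> sm (theta j F).
Proof.
move=> /(smooth_theta_aux j)[h1 h2]; rewrite thetaE.
exact: (smooth_scale _ openT (smooth_add openT h1 h2)).
Qed.

(** The coefficient [thcoef j] depends on lambda only, so it is invariant under flat directions and
    passes through [T]. *)
Lemma theta_reg T j F : regop flat_dir T -> sm F -> theta j (T F) = T (theta j F).
Proof.
move=> rT HF; have [h1 h2] := smooth_theta_aux j HF.
rewrite !thetaE (reg_scalar rT) ?(reg_add rT h1 h2); last exact: (smooth_add openT h1 h2).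
apply/funext => v.
rewrite (reg_mul rT (smooth_thcoef j) _ (smooth_deriveC _ HF)); last first.
  by move=> w x; exact: thcoef_flat.
by rewrite (reg_scalar rT) ?(reg_derive rT)//; exact: smooth_deriveC.
Qed.

Lemma theta_add j F G v : sm F -> sm G ->
  theta j (fun x => F x + G x) v = theta j F v + theta j G v.
Proof.
move=> HF HG; rewrite /theta !(deriveCD _ HF HG (I : setT v)).
move: (deriveC _ F v) (deriveC (bas (inr j)) F v) (deriveC _ G v) (deriveC (bas (inr j)) G v).
by move=> X Y X' Y'; ring.
Qed.

Lemma theta_scale j (c : C) F v : sm F -> theta j (fun x => c * F x) v = c * theta j F v.
Proof.
move=> HF; rewrite /theta !(deriveCZ c _ openT HF (I : setT v)); ring.
Qed.

Lemma theta_zero j : theta j (fun=> 0) = (fun=> 0).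
Proof. by apply/funext => v; rewrite /theta !deriveC_cst !mulr0 addr0 mul0r. Qed.

Lemma theta_cst j (c : C) : theta j (fun=> c) = (fun=> 0).
Proof. by apply/funext => v; rewrite /theta !deriveC_cst !mulr0 addr0 mul0r. Qed.

Lemma theta_sub j F G v : sm F -> sm G ->
  theta j (fun x => F x - G x) v = theta j F v - theta j G v.
Proof.
move=> HF HG; rewrite (_ : (fun x => F x - G x) = (fun x => F x + (-1) * G x)).
  by rewrite theta_add ?theta_scale ?mulN1r//; apply: smooth_scale => //; exact: openT.
by apply/funext => x; rewrite mulN1r.
Qed.

Lemma theta_sum j (I : Type) (r : seq I) (P : pred I) (F : I -> V -> C) v :
  (forall i, P i -> sm (F i)) ->
  theta j (fun x => \sum_(i <- r | P i) F i x) v = \sum_(i <- r | P i) theta j (F i) v.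
Proof.
move=> HF; elim: r => [|i r IH].
  rewrite big_nil (_ : (fun x => _) = (fun=> 0)) ?theta_zero//.
  by apply/funext => x; rewrite big_nil.
case Pi : (P i); last first.
  by rewrite big_cons Pi -IH; congr (theta j _ v); apply/funext => x; rewrite big_cons Pi.
rewrite big_cons Pi -IH -theta_add; [|exact: HF|by apply: smooth_sum => //; exact: openT].
by congr (theta j _ v); apply/funext => x; rewrite big_cons Pi.
Qed.

Definition isflat F := forall w v, flat_dir w -> F (v + w) = F v.

Lemma bas_flat (b : 'I_n + 'I_n) : (if b is inr k then (s <= k)%N else true) -> flat_dir (bas b).
Proof.
case: b => j H k ks; rewrite /bas/= ?mxE ?eqxx//=.
by case: eqP => // kj; move: ks; rewrite kj ltnNge H.
Qed.

Lemma flat_derive F w v : sm F -> isflat F -> flat_dir w -> deriveC w F v = 0.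
Proof.
move=> HF fF Ww; apply: deriveC_invariant => // r x; apply: fF => k ks.
by rewrite mxE Ww// mulr0.
Qed.

Lemma theta_flat_ge j F : (s <= j)%N -> sm F -> isflat F -> theta j F = (fun=> 0).
Proof.
move=> sj HF fF; apply/funext => v; rewrite /theta !(flat_derive v HF fF).
- by rewrite !mulr0 addr0 mul0r.
- exact: bas_flat.
- exact: bas_flat.
Qed.

Lemma theta_flat_lt j F v : (j < s)%N -> sm F -> isflat F ->
  theta j F v = iC / 2 * deriveC (bas (inr j)) F v.
Proof.
move=> js HF fF; rewrite /theta (flat_derive v HF fF (bas_flat (b := inl j) isT)).
by rewrite mulr0 add0r mulrAC.
Qed.

(* The action of a unit in the logarithmic coordinates. *)
Definition uact u v : V :=
  (\row_k complex.Re (sg k u * zcoord v k),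
   \row_k (if (k < s)%N then v.2 0 k + ln (complex.Re (sg k u))
           else complex.Im (sg k u * zcoord v k))).

Definition ulin u v : V :=
  (\row_k complex.Re (sg k u * zcoord v k),
   \row_k (if (k < s)%N then v.2 0 k else complex.Im (sg k u * zcoord v k))).

(** The logarithmic embedding of u as a vector of the chart: up to a flat vector, u acts as the
    translation by [lvec u], so on functions of lambda units do act by translations. *)
Definition lvec u : V := (0, \row_(k < n) (if (k < s)%N then ln (complex.Re (sg k u)) else 0)).

Lemma zcoordD v w k : zcoord (v + w) k = zcoord v k + zcoord w k.
Proof. by apply: ReIm_inj; rewrite ?(cReD, cImD) /zcoord/= mxE. Qed.

Lemma uactD u v w : uact u (v + w) = uact u v + ulin u w.
Proof.
congr (_, _); apply/rowP => k; rewrite !mxE zcoordD mulrDr ?cReD//.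
by case: ifP => _; [rewrite addrAC|rewrite cImD].
Qed.

Lemma ulinZ u v (h : R) : ulin u (h *: v) = h *: ulin u v.
Proof.
have E k : sg k u * zcoord (h *: v) k = h%:C%C * (sg k u * zcoord v k).
  have -> : zcoord (h *: v) k = h%:C%C * zcoord v k.
    by apply: ReIm_inj; rewrite ?(cReM, cImM) /zcoord/= !mxE; ring.
  by rewrite mulrCA.
congr (_, _); apply/rowP => k; rewrite !mxE E.
  by rewrite cReM/= mul0r subr0.
by case: ifP => _ //; rewrite cImM/= mul0r addr0.
Qed.

Lemma uact_line u v w (h : R) : uact u (v + h *: w) = uact u v + h *: ulin u w.
Proof. by rewrite uactD ulinZ. Qed.

Lemma ulin_flat u w : flat_dir w -> flat_dir (ulin u w).
Proof. by move=> Ww k ks; rewrite mxE ks Ww. Qed.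

Lemma uact_continuous u : continuous (uact u).
Proof.
move=> v; apply: continuous_crd => b; apply/continuous_epsP => e e0.
pose L := `|complex.Re (sg (match b with inl k => k | inr k => k end) u)| +
          `|complex.Im (sg (match b with inl k => k | inr k => k end) u)| + 1.
have L1 : 1 <= L by rewrite lerDr addr_ge0.
have L0 : 0 < L by apply: lt_le_trans L1.
exists (e / L); first exact: divr_gt0.
move=> y yv; have -> : crd b (uact u y) - crd b (uact u v) = crd b (ulin u (y - v)).
  by rewrite -{1}(subrK v y) [_ + v]addrC uactD crdD [_ + crd b (ulin _ _)]addrC addrK.
move: (y - v) yv => w yv.
have H : `|crd b (ulin u w)| <= L * `|w|.
  have n1 k : `|w.1 0 k| <= `|w| := crd_norm (inl k) w.
  have n2 k : `|w.2 0 k| <= `|w| := crd_norm (inr k) w.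
  case: (b) @L L1 L0 yv => k L L1 L0 yv; rewrite /ulin /crd/= mxE.
    rewrite cReM/= /L !mulrDl mul1r; apply: le_trans (ler_normB _ _) _.
    by rewrite !normrM -[X in X <= _]addr0 lerD// lerD// ler_wpM2l.
  case: ifP => _.
    apply: le_trans (n2 k) _; rewrite ler_peMl//.
  rewrite cImM/= /L !mulrDl mul1r; apply: le_trans (ler_normD _ _) _.
  by rewrite !normrM -[X in X <= _]addr0 lerD// lerD// ler_wpM2l.
apply: le_trans H _; rewrite mulrC -ler_pdivlMr//; exact: ltW.
Qed.

Lemma smooth_uact u F : sm F -> sm (F \o uact u).
Proof.
by apply: smooth_line; [exact: uact_continuous|move=> x v h; exact: uact_line].
Qed.

Lemma uact_flat u v : exists2 w, flat_dir w & uact u v = v + lvec u + w.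
Proof.
exists (uact u v - (v + lvec u)); last by rewrite addrC subrK.
by move=> k ks; rewrite !mxE ks subrr.
Qed.

Lemma flat_uact F u v : isflat F -> F (uact u v) = F (v + lvec u).
Proof. by move=> fF; have [w Ww ->] := uact_flat u v; exact: fF. Qed.

Lemma sg_real k u : (k < s)%N -> complex.Im (sg k u) = 0.
Proof. by move=> ks; have [_ h1 _ _] := hsigma; have [i ->] := splitK_lt ks; exact: h1. Qed.

Let inE4 : ((forall a c : 'I_n, (inl a == inr c :> 'I_n + 'I_n) = false) *
  (forall a c : 'I_n, (inr a == inl c :> 'I_n + 'I_n) = false) *
  (forall a c : 'I_n, (inl a == inl c :> 'I_n + 'I_n) = (a == c)) *
  (forall a c : 'I_n, (inr a == inr c :> 'I_n + 'I_n) = (a == c)))%type.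
Proof. by []. Qed.

Lemma ulin_bas_l u k : ulin u (bas (inl k)) =
  complex.Re (sg k u) *: bas (inl k) + complex.Im (sg k u) *: bas (inr k).
Proof.
apply: crdP => -[j|j]; rewrite crdD !crdZ !crd_bas !inE4 /crd/= !mxE /=.
  rewrite cReM/= !mxE/=; case: (eqVneq j k) => [->|jk] /=; ring.
rewrite cImM/= !mxE/=; case: (eqVneq j k) => [->|jk] /=; last by rewrite !mulr0 addr0 if_same.
by case: ltnP => ks; [rewrite sg_real//|]; ring.
Qed.

Lemma ulin_bas_r u k : ulin u (bas (inr k)) =
  (if (k < s)%N then bas (inr k)
   else - complex.Im (sg k u) *: bas (inl k) + complex.Re (sg k u) *: bas (inr k)).
Proof.
case: ltnP => ks; apply: crdP => -[j|j]; rewrite ?crdD ?crdZ !crd_bas !inE4 /crd/= !mxE /=.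
- rewrite cReM/= !mxE/=; case: (eqVneq j k) => [->|jk] /=; last ring.
  by rewrite sg_real//; ring.
- rewrite cImM/= !mxE/=; case: (eqVneq j k) => [->|jk] /=; first by rewrite ks.
  by rewrite !mulr0 addr0 if_same.
- rewrite cReM/= !mxE/=; case: (eqVneq j k) => [->|jk] /=; ring.
- rewrite cImM/= !mxE/=; case: (eqVneq j k) => [->|jk] /=.
    by rewrite ltnNge ks/=; ring.
  by rewrite !mulr0 addr0 if_same.
Qed.

(** The factor by which u multiplies the j-th vector of the antiholomorphic frame; it is 1 at real
    places because division by Im w_j makes the frame invariant there. *)
Definition thmul j u : C := if (j < s)%N then 1 else conjc (sg j u).

(** At a real place the factor [sg j u] produced by d/dx is absorbed by e^lambda_j at the image
    point, where lambda_j has grown by the logarithm of that factor. At a non-real place d/dzbar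
    acquires the conjugate of [sg j u]. *)
Lemma theta_uact j u F v : 0 < sg j u \/ (s <= j)%N -> sm F ->
  theta j (F \o uact u) v = thmul j u * theta j F (uact u v).
Proof.
move=> pos HF; rewrite /theta.
rewrite !(@deriveC_line _ _ (uact u) (ulin u) F); last 2 first.
- by move=> h; exact: uact_line.
- by move=> h; exact: uact_line.
rewrite ulin_bas_l ulin_bas_r /thmul; case: ltnP => js.
  have {}pos : 0 < sg j u by case: pos => //; rewrite leqNgt js.
  have rp : 0 < complex.Re (sg j u) by move: pos; rewrite ltcE => /andP[].
  rewrite sg_real// scale0r addr0 deriveC_scale_dir// mul1r mxE js expRD lnK ?posrE// rmorphM/=.
  by rewrite mulrA.
rewrite !(deriveC_lin _ _ _ _ openT HF (I : setT (uact u v))).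
have -> : conjc (sg j u) = (complex.Re (sg j u))%:C%C - iC * (complex.Im (sg j u))%:C%C.
  by apply: ReIm_inj; case: (sg j u) => a b /=; ring.
have i2 : iC * iC = -1 :> C by apply: ReIm_inj; rewrite ?(cReM, cImM)/=; ring.
rewrite rmorphN/=; move: (deriveC (bas (inl j)) _ _) (deriveC (bas (inr j)) _ _) => X Y.
move: (complex.Re _)%:C%C (complex.Im _)%:C%C => a b.
rewrite [in RHS]mulrA !mul1r; congr (_ / 2); apply/eqP; rewrite -subr_eq0; apply/eqP.
transitivity ((iC * iC + 1) * b * Y); first ring.
by rewrite i2 addNr !mul0r.
Qed.

End LogChart.

(** * Koszul homotopies *)

Section Koszul.
Context {R : realType} {s t : nat}.
Local Notation C := R[i].
Local Notation n := (s + t)%N.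
Local Notation V := (Cn R n).
Local Notation sm := (@smooth R V setT).
Local Notation theta := (@theta R s t).
Local Notation flat_dir := (@flat_dir R s t).
Local Notation family := ({set 'I_n} -> V -> C).
Implicit Types (F : family) (J : {set 'I_n}) (v w : V) (j k l : 'I_n) (f : V -> C).

Definition sgn j J : C := (-1) ^+ #|[set k in J | (k < j)%N]|%SET.

Definition dfam F : family := fun J v =>
  \sum_(j in J) sgn j J * theta j (F (J :\ j)%SET) v.

(** Interior product with the l-th frame vector followed by [S]. The operator may depend on J, since
    different components have different multipliers under U. *)
Definition contract l (S : {set 'I_n} -> (V -> C) -> V -> C) F : family := fun J v =>
  if l \in J then 0 else sgn l J * S J (F (l |: J)%SET) v.

Lemma sgn_sqr j J : sgn j J * sgn j J = 1.
Proof. by rewrite /sgn -expr2 sqrr_sign. Qed.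

Lemma sgn_D1 l j J : j \in J -> sgn l (J :\ j)%SET = sgn l J * (-1) ^+ (j < l)%N.
Proof.
move=> jJ; rewrite /sgn; set A := [set k in J | (k < l)%N]%SET.
have -> : [set k in (J :\ j)%SET | (k < l)%N]%SET = (A :\ j)%SET.
  by apply/setP => k; rewrite !inE andbA.
rewrite (cardsD1 j A) !inE jJ exprD mulrAC -expr2 sqrr_sign mul1r.
by [].
Qed.

Lemma sgn_U1 l j J : l \notin J -> sgn j (l |: J)%SET = sgn j J * (-1) ^+ (l < j)%N.
Proof.
move=> lJ; have := @sgn_D1 j l (l |: J)%SET; rewrite !inE eqxx setU1K// => /(_ isT) ->.
by rewrite -mulrA -expr2 sqrr_sign mulr1.
Qed.

Lemma sgn_U1_id l J : l \notin J -> sgn l (l |: J)%SET = sgn l J.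
Proof. by move=> lJ; rewrite sgn_U1// ltnn mulr1. Qed.

Lemma sgn_D1_id l J : l \in J -> sgn l (J :\ l)%SET = sgn l J.
Proof. by move=> lJ; rewrite sgn_D1// ltnn mulr1. Qed.

(** The sign behind the anticommutation of the exterior product by j with the contraction by l. *)
Lemma sgn_swap j l J : j \in J -> l \notin J ->
  sgn j J * sgn l (J :\ j)%SET = - (sgn l J * sgn j (l |: J)%SET).
Proof.
move=> jJ lJ; rewrite sgn_D1// sgn_U1//.
have : (-1) ^+ (j < l)%N = - (-1) ^+ (l < j)%N :> C.
  have : j != l by apply: contraNneq lJ => <-.
  rewrite -val_eqE neq_ltn => /orP[] H; rewrite H ltnNge (ltnW H)/= ?expr0 ?expr1 ?opprK//.
by move=> ->; rewrite !mulrN mulrCA mulrA.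
Qed.

(** The Cartan homotopy formula on a closed family. If l is in J, only the term j = l of the
    differential is non-zero; if not, closedness at [l |: J] expresses the sum of the terms by the
    single one with [theta l]. *)
Lemma koszul l (S : {set 'I_n} -> (V -> C) -> V -> C) F J v :
  (forall J, sm (F J)) -> (forall J, regop setT (S J)) ->
  (forall J v, dfam F J v = 0) ->
  (forall J j, j \in J -> l \notin J ->
    theta j (S (J :\ j)%SET (F (l |: (J :\ j))%SET)) = S J (theta j (F (l |: (J :\ j))%SET))) ->
  dfam (contract l S F) J v =
  if l \in J then theta l (S (J :\ l)%SET (F J)) v else S J (theta l (F J)) v.
Proof.
move=> HF rS closed comm.
have HS J' J'' : sm (S J' (F J'')) by exact: (reg_smooth (rS J')).
have E0 j : l \in (J :\ j)%SET -> contract l S F (J :\ j)%SET = (fun=> 0).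
  by move=> lj; apply/funext => x; rewrite /contract lj.
have E1 j : l \notin (J :\ j)%SET -> contract l S F (J :\ j)%SET =
    (fun x => sgn l (J :\ j)%SET * S (J :\ j)%SET (F (l |: (J :\ j))%SET) x).
  by move=> lj; apply/funext => x; rewrite /contract (negbTE lj).
rewrite /dfam; case: ifP => lJ.
  rewrite (bigD1 l)//= big1 ?addr0 => [|j /andP[jJ jl]]; last first.
    by rewrite E0 ?theta_zero ?mulr0// !inE eq_sym jl.
  rewrite E1 ?inE ?eqxx// finset.setD1K// theta_scale// sgn_D1_id// mulrA sgn_sqr mul1r.
  by [].
have lJ' : l \notin J by rewrite lJ.
have := closed (l |: J)%SET; rewrite /dfam => cl.
have H : S J (fun x => \sum_(j in (l |: J)%SET) sgn j (l |: J)%SET * theta j (F ((l |: J) :\ j)%SET) x) v = 0.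
  by rewrite (_ : (fun x => _) = (fun=> 0)) ?(reg_zero (rS J))//; apply/funext => x; rewrite cl.
have Hth j : sm (theta j (F ((l |: J) :\ j)%SET)) by exact: smooth_theta.
rewrite (reg_sum (rS J)) in H; last first.
  by move=> j _; apply: smooth_scale => //; exact: openT.
rewrite big_setU1//= (reg_scalar (rS J))// setU1K// sgn_U1_id// in H.
have -> : S J (theta l (F J)) v = sgn l J * (sgn l J * S J (theta l (F J)) v).
  by rewrite mulrA sgn_sqr mul1r.
move/eqP: H; rewrite addr_eq0 => /eqP ->; rewrite mulrN mulr_sumr -sumrN.
apply: eq_bigr => j jJ.
have lj : l \notin (J :\ j)%SET by rewrite inE negb_and lJ' orbT.
rewrite E1// theta_scale// mulrA sgn_swap// (reg_scalar (rS J))// comm//.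
have -> : ((l |: J) :\ j = l |: (J :\ j))%SET.
  apply/setP => k; rewrite !inE; case: (eqVneq k l) => [->|]//=.
  by rewrite andbT; apply: contraNneq lJ' => ->.
by rewrite mulNr mulrA.
Qed.

Lemma dfam_add F G J v : (forall J, sm (F J)) -> (forall J, sm (G J)) ->
  dfam (fun J x => F J x + G J x) J v = dfam F J v + dfam G J v.
Proof.
move=> HF HG; rewrite /dfam -big_split/=; apply: eq_bigr => j _.
by rewrite theta_add// mulrDr.
Qed.

Lemma dfam_scale (c : C) F J v : (forall J, sm (F J)) ->
  dfam (fun J x => c * F J x) J v = c * dfam F J v.
Proof.
move=> HF; rewrite /dfam mulr_sumr; apply: eq_bigr => j _.
by rewrite theta_scale// mulrCA.
Qed.

Lemma dfam_sum (I : Type) (r : seq I) (P : pred I) (F : I -> family) J v :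
  (forall i J, P i -> sm (F i J)) ->
  dfam (fun J x => \sum_(i <- r | P i) F i J x) J v = \sum_(i <- r | P i) dfam (F i) J v.
Proof.
move=> HF; rewrite /dfam exchange_big/=; apply: eq_bigr => j _.
rewrite theta_sum => [|i Pi]; last exact: HF.
by rewrite mulr_sumr.
Qed.

Lemma smooth_contract l S F J : (forall J, sm (F J)) -> (forall J, regop setT (S J)) ->
  sm (contract l S F J).
Proof.
move=> HF rS; rewrite /contract; case: (l \in J).
  by apply: smooth_cst; exact: openT.
apply: smooth_scale; first exact: openT.
exact: (reg_smooth (rS J)).
Qed.

End Koszul.

(** * Averages and primitives along a direction *)

Section Averages.
Context {R : realType} {n : nat}.
Local Notation C := R[i].
Local Notation V := (Cn R n).
Local Notation sm := (@smooth R V setT).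
Implicit Types (f : V -> C) (e v w : V) (c : C).

Lemma reg_setT W (T : (V -> C) -> V -> C) : regop W T -> regop setT T.
Proof. by move=> [h1 h2 h3 h4 h5]; split=> // m f Hm Wm Hf; apply: h4 => // w x _; apply: Wm. Qed.

Lemma klip_cst1 : klip 1 (fun=> 1 : C).
Proof. by split=> [r _|r q _ _]; rewrite ?md1// subrr md0 mul1r. Qed.

Lemma klip_cst0 : klip 1 (fun=> 0 : C).
Proof. by split=> [r _|r q _ _]; rewrite ?md0// subrr md0 mul1r. Qed.

Lemma klip_ramp : klip 1 (fun r : R => (r - 1)%:C%C).
Proof.
split=> [r /andP[r0 r1]|r q _ _]; first by rewrite md_real ler_norml; lra.
by rewrite -rmorphB md_real mul1r opprB addrA subrK.
Qed.

Definition avg e : (V -> C) -> V -> C := rop (fun=> 1) e.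
(** The kernel r - 1 is 0 at r = 1 and -1 at r = 0 and has derivative 1, so integration by parts
    makes the derivative of [ramp e f] equal to [f] minus its average. *)
Definition ramp e : (V -> C) -> V -> C := rop (fun r : R => (r - 1)%:C%C) e.

Lemma reg_avg e : regop setT (avg e).
Proof. by apply: good_reg; apply: (good_rop (c := 1) klip_cst1) => // r _; rewrite md1. Qed.

Lemma reg_ramp e : regop setT (ramp e).
Proof.
apply: good_reg; apply: (good_rop (c := 1) klip_ramp) => // r /andP[r0 r1].
by rewrite md_real ler_norml; lra.
Qed.

Lemma derive_avg e f : sm f -> deriveC e (avg e f) = (fun v => f (v + e) - f v).
Proof.
move=> Hf; rewrite (reg_derive (reg_avg e))//; apply/funext => v.
have := @rop_by_parts _ _ 1 (fun=> 1) (fun=> 0) e f v klip_cst1 klip_cst0 _ Hf.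
rewrite !mul1r => <- => [|r h _ h0 _]; last first.
  by rewrite subrr mulr0 subr0 md0 mul1r mulr_ge0.
have := rop_scale_kernel 0 e klip_cst1 Hf.
rewrite (_ : (fun r : R => 0 * 1) = (fun=> 0)); last by apply/funext => r; rewrite mul0r.
by move=> ->; rewrite mul0r addr0.
Qed.

Lemma derive_ramp e f : sm f -> deriveC e (ramp e f) = (fun v => f v - avg e f v).
Proof.
move=> Hf; rewrite (reg_derive (reg_ramp e))//; apply/funext => v.
have := @rop_by_parts _ _ 1 (fun r : R => (r - 1)%:C%C) (fun=> 1) e f v klip_ramp klip_cst1 _ Hf.
rewrite subrr mul0r !sub0r rmorphN1 mulN1r opprK => <- => [|r h _ h0 _]; last first.
  rewrite mulr1 -!rmorphB (_ : _ - h = 0) ?rmorph0 ?md0 ?mul1r ?mulr_ge0//; ring.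
by rewrite addrK.
Qed.

Lemma avg_invariant e f : sm f -> (forall v (r : R), f (v + r *: e) = f v) -> avg e f = f.
Proof. exact: rop_invariant. Qed.

(* [Hop c e] inverts the derivative along [e] on the functions multiplied by
   [c] under translation by [e], up to the average [Mop c e]. *)
Definition Hop c e : (V -> C) -> V -> C :=
  if c == 1 then ramp e else fun f v => (c - 1)^-1 * avg e f v.
Definition Mop c e : (V -> C) -> V -> C :=
  if c == 1 then avg e else fun _ _ => 0.

Lemma reg_cscale W (T : (V -> C) -> V -> C) c : regop W T -> regop W (fun f v => c * T f v).
Proof.
move=> rT; have [h1 h2 h3 h4 h5] := rT; split.
- by move=> f Hf; apply: smooth_scale; [exact: openT|exact: h1].
- move=> f v Hf; apply/funext => x.
  by rewrite (deriveCZ c v openT (h1 f Hf) (I : setT x)) h2.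
- by move=> f g Hf Hg; apply/funext => x; rewrite h3// mulrDr.
- by move=> m f Hm Wm Hf; apply/funext => x; rewrite h4// mulrCA.
- by move=> f w Hf; apply/funext => x; rewrite h5.
Qed.

Lemma reg_0 W : regop W (fun (_ : V -> C) (_ : V) => 0).
Proof. by have := good_zero W (lexx (0 : R)) => /good_reg. Qed.

Lemma reg_Hop c e : regop setT (Hop c e).
Proof.
rewrite /Hop; case: ifP => _; first exact: reg_ramp.
exact: reg_cscale (reg_avg e).
Qed.

Lemma reg_Mop c e : regop setT (Mop c e).
Proof. rewrite /Mop; case: ifP => _; [exact: reg_avg|exact: reg_0]. Qed.

Lemma derive_Hop c e f : sm f -> (forall v, f (v + e) = c * f v) ->
  deriveC e (Hop c e f) = (fun v => f v - Mop c e f v).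
Proof.
move=> Hf fc; rewrite /Hop /Mop; case: eqP => [_|/eqP c1]; first exact: derive_ramp.
apply/funext => v; rewrite (deriveCZ _ e openT (reg_smooth (reg_avg e) Hf) (I : setT v)).
rewrite derive_avg// fc subr0 -{2}[f v]mul1r -mulrBl mulrA mulVf ?mul1r//.
by rewrite subr_eq0.
Qed.

Lemma derive_Mop c e f : sm f -> (forall v, f (v + e) = c * f v) ->
  deriveC e (Mop c e f) = (fun=> 0).
Proof.
move=> Hf fc; apply/funext => v; rewrite /Mop; case: eqP => [c1|_]; last exact: deriveC_cst.
by rewrite derive_avg// fc c1 mul1r subrr.
Qed.

End Averages.

(** * Cohomology in logarithmic coordinates *)

Section LogHodge.
Context {R : realType} {s t : nat} {K : fieldExtType rat}.
Local Notation C := R[i].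
Local Notation n := (s + t)%N.
Local Notation N := (s + t + t)%N.
Local Notation V := (Cn R n).
Variables (sigma : 'I_N -> {rmorphism K -> C}) (U : set K).
Hypotheses (ht : (0 < t)%N) (hK : \dim {: K} = N) (hsigma : is_enum_embeddings sigma).
Hypothesis hU : admissible sigma U.
Local Notation sm := (@smooth R V setT).
Local Notation sg k := (sigma (lshift t k)).
Local Notation theta := (@theta R s t).
Local Notation flat_dir := (@flat_dir R s t).
Local Notation isflat := (@isflat R s t).
Local Notation dfam := (@dfam R s t).
Local Notation family := ({set 'I_n} -> V -> C).
Local Notation uact := (uact sigma).
Local Notation lvec := (lvec sigma).
Local Notation tau := (tau sigma).
Local Notation thmul := (thmul sigma).
Local Notation l0 := (@l0 s t ht).
Implicit Types (F G H : V -> C) (v w x : V) (j k : 'I_n) (c : set_type U -> C).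

Definition inv F := forall b v, ring_of_integers b -> F (v + tau b) = F v.

Definition adm c F := [/\ sm F, inv F &
  forall (u : set_type U) v, F (uact (val u) v) = c u * F v].

Lemma U_pos (u : set_type U) k : (k < s)%N -> 0 < sg k (val u).
Proof.
move=> ks; have [h1 _ _ _] := hU; have [_ _ _ h] := h1 _ (set_valP u).
by have [i ->] := splitK_lt ks; exact: h.
Qed.

Lemma U_pos' (u : set_type U) k : 0 < sg k (val u) \/ (s <= k)%N.
Proof. by case: (ltnP k s) => ks; [left; exact: U_pos|right]. Qed.

Lemma U_neq0 (u : set_type U) : val u != 0.
Proof. by have [h1 _ _ _] := hU; have [h _ _ _] := h1 _ (set_valP u). Qed.

Lemma thmul_neq0 j (u : set_type U) : thmul j (val u) != 0.
Proof.
rewrite /thmul; case: ifP => _; first exact: oner_neq0.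
by rewrite conjc_eq0 fmorph_eq0 U_neq0.
Qed.

Lemma integers_mulU (u : set_type U) b : ring_of_integers b -> ring_of_integers (val u * b).
Proof.
move=> bO; have [h1 _ _ _] := hU; have [_ h _ _] := h1 _ (set_valP u).
exact: integral_mul.
Qed.

Lemma ulin_tau u b : ulin sigma u (tau b) = tau (u * b) .
Proof.
congr (_, _); apply/rowP => k; rewrite !mxE rmorphM/=;
  (have -> : zcoord (tau b) k = sg k b by apply: ReIm_inj; rewrite /zcoord/= !mxE) => //.
case: ltnP => // ks; rewrite cImM !(sg_real hsigma)//; ring.
Qed.

Lemma inv_uact (u : set_type U) F : inv F -> inv (F \o uact (val u)).
Proof.
move=> iF b v bO /=; rewrite uactD ulin_tau iF//.
exact: integers_mulU.
Qed.

Lemma reg_inv W (T : (V -> C) -> V -> C) F : regop W T -> sm F -> inv F -> inv (T F).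
Proof.
by move=> rT HF iF b v bO; apply: (reg_periodic rT HF) => x; exact: iF.
Qed.

Lemma reg_isflat W (T : (V -> C) -> V -> C) F : regop W T -> sm F -> isflat F -> isflat (T F).
Proof.
by move=> rT HF fF w v Ww; apply: (reg_periodic rT HF) => x; exact: fF.
Qed.

Lemma adm_flat c F : isflat F ->
  (forall (u : set_type U) v, F (uact (val u) v) = c u * F v) <->
  (forall (u : set_type U) v, F (v + lvec (val u)) = c u * F v).
Proof.
move=> fF; split=> h u v; have := h u v; rewrite (flat_uact sigma _ _ fF) //; exact.
Qed.

(** On functions of lambda the units act by translations, with which every regular operator
    commutes; no uniqueness argument is called for at this stage. *)
Lemma reg_adm_flat (T : (V -> C) -> V -> C) c F : regop setT T -> isflat F ->
  adm c F -> adm c (T F) /\ isflat (T F).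
Proof.
move=> rT fF [HF iF eF]; have fT := reg_isflat rT HF fF.
split=> //; split; [exact: (reg_smooth rT HF)|exact: (reg_inv rT HF iF)|].
apply/adm_flat => // u v; have /(congr1 (fun h => h v)) <- := reg_shift rT (lvec (val u)) HF.
rewrite -[RHS]/((fun x => c u * T F x) v) -(reg_scalar rT)//.
congr (T _ v); apply/funext => x; exact: (adm_flat c fF).1.
Qed.

Lemma adm_add c F G : adm c F -> adm c G -> adm c (fun v => F v + G v).
Proof.
move=> [h1 h2 h3] [k1 k2 k3]; split.
- by apply: smooth_add => //; exact: openT.
- by move=> b v bO; rewrite h2// k2.
- by move=> u v; rewrite h3 k3 mulrDr.
Qed.

Lemma adm_scale c a F : adm c F -> adm c (fun v => a * F v).
Proof.
move=> [h1 h2 h3]; split.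
- by apply: smooth_scale => //; exact: openT.
- by move=> b v bO; rewrite h2.
- by move=> u v; rewrite h3 mulrCA.
Qed.

Lemma adm0 c : adm c (fun=> 0).
Proof.
split=> [|b v _|u v] //; last by rewrite mulr0.
by apply: smooth_cst; exact: openT.
Qed.

Lemma adm_sum c (I : Type) (r : seq I) (P : pred I) (F : I -> V -> C) :
  (forall i, P i -> adm c (F i)) -> adm c (fun v => \sum_(i <- r | P i) F i v).
Proof.
move=> aF; elim: r => [|i r IH].
  rewrite (_ : (fun v => _) = (fun=> 0)); first exact: adm0.
  by apply/funext => v; rewrite big_nil.
case Pi : (P i).
  rewrite (_ : (fun v => _) = (fun v => F i v + \sum_(j <- r | P j) F j v)).
    by apply: adm_add => //; exact: aF.
  by apply/funext => v; rewrite big_cons Pi.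
rewrite (_ : (fun v => _) = (fun v => \sum_(j <- r | P j) F j v))//.
by apply/funext => v; rewrite big_cons Pi.
Qed.

Section Torus.
Variables S M : (V -> C) -> V -> C.
Hypotheses (rS : regop flat_dir S) (rM : regop flat_dir M).
Hypothesis M_flat : forall F, sm F -> isflat F -> M F = F.
Hypothesis SM : forall F, sm F -> inv F ->
  [/\ theta l0 (S F) = (fun v => F v - M F v), isflat (M F) & M (S F) = (fun=> 0)].

Let l0s : (s <= l0)%N. Proof. exact: leq_addr. Qed.

(** Writing F = theta (S F) + M F at [l0]: the pullback of M F is flat, hence fixed by [M]; the
    pullback of the first term is a multiple of [theta l0] of a function, and [M] kills it because
    [theta l0] vanishes on flat functions. *)
Lemma M_uact (u : set_type U) F : sm F -> inv F ->
  M (F \o uact (val u)) = M F \o uact (val u).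
Proof.
move=> HF iF; have [SF fM MS] := SM HF iF.
have HM : sm (M F) by exact: (reg_smooth rM).
have HS : sm (S F) by exact: (reg_smooth rS).
have iS : inv (S F) by exact: (reg_inv rS).
have HSu := smooth_uact sigma (val u) HS.
have [_ fMS _] := SM HSu (inv_uact u iS).
have E1 : M (theta l0 (S F) \o uact (val u)) = (fun=> 0).
  have -> : theta l0 (S F) \o uact (val u) = (fun v => (thmul l0 (val u))^-1 * theta l0 (S F \o uact (val u)) v).
    apply/funext => v; rewrite /= (theta_uact hsigma _ (U_pos' u l0) HS) mulKf//.
    exact: thmul_neq0.
  rewrite (reg_scalar rM); last exact: smooth_theta.
  rewrite -(theta_reg _ rM HSu) (theta_flat_ge l0s (reg_smooth rM HSu) fMS).
  by apply/funext => v; rewrite mulr0.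
have HMu := smooth_uact sigma (val u) HM.
have fMu : isflat (M F \o uact (val u)).
  by move=> w v Ww /=; rewrite uactD fM//; exact: ulin_flat.
transitivity (M (fun v => (theta l0 (S F) \o uact (val u)) v + (M F \o uact (val u)) v)).
  by congr (M _); apply/funext => v; rewrite /= SF subrK.
rewrite (reg_add rM) ?E1 ?(M_flat HMu fMu)//.
  by apply/funext => v; rewrite add0r.
by apply: smooth_uact; exact: smooth_theta.
Qed.

Lemma M_adm c F : adm c F -> adm c (M F).
Proof.
move=> [HF iF eF]; split; [exact: (reg_smooth rM)|exact: (reg_inv rM)|].
move=> u v; rewrite -[LHS]/((M F \o uact (val u)) v) -M_uact//.
transitivity (M (fun x => c u * F x) v); last by rewrite (reg_scalar rM).
by congr (M _ v); apply/funext => x; exact: eF.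
Qed.

(** The defect Z of equivariance satisfies theta Z = 0 at [l0] and M Z = 0. Since Z = theta (S Z) +
    M Z and S commutes with theta, Z = 0. *)
Lemma S_adm c F : adm c F -> adm (fun u => c u * thmul l0 (val u)) (S F).
Proof.
move=> aF; have [HF iF eF] := aF; have [_ _ eM] := M_adm aF.
have HS : sm (S F) by exact: (reg_smooth rS).
have iS : inv (S F) by exact: (reg_inv rS).
split=> // u v; have [SF fM MS] := SM HF iF.
pose q := thmul l0 (val u); pose a := c u * q.
pose Z x := (S F \o uact (val u)) x - a * S F x.
have HSu := smooth_uact sigma (val u) HS.
have HaS : sm (fun x => a * S F x) by apply: smooth_scale => //; exact: openT.
have HZ : sm Z by exact: smooth_subr.
have iSu := inv_uact u iS.
have iZ : inv Z by move=> b x bO; rewrite /Z iSu// iS.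
have tZ : theta l0 Z = (fun=> 0).
  apply/funext => x; rewrite theta_sub// theta_scale//.
  rewrite (theta_uact hsigma _ (U_pos' u l0) HS) SF eF eM -/q /a; ring.
have MZ : M Z = (fun=> 0).
  rewrite (reg_sub rM)// M_uact// (reg_scalar rM)// MS.
  by apply/funext => x /=; rewrite mulr0 subr0.
have [E _ _] := SM HZ iZ.
have : theta l0 (S Z) = (fun=> 0) by rewrite (theta_reg _ rS HZ) tZ (reg_zero rS).
rewrite E MZ => /(congr1 (fun h => h v)) /eqP.
by rewrite subr0 subr_eq0 => /eqP.
Qed.

End Torus.

(** The multiplier of the component J under U. The relation [ccP] below matches the factor [thmul j]
    in [theta_uact], so that [contract] sends components of one multiplier to those of the right
    one. *)
Variable cc : {set 'I_n} -> set_type U -> C.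
Hypothesis ccP : forall (J : {set 'I_n}) j, j \notin J -> forall u,
  cc J u = cc (j |: J)%SET u * thmul j (val u).
Hypothesis cc_neq0 : forall J u, cc J u != 0.
Hypothesis ccM : forall J (u v w : set_type U), val w = val u * val v ->
  cc J w = cc J u * cc J v.

Definition fam_adm (F : family) := forall J, adm (cc J) (F J).
Definition dclosed (F : family) := forall J v, dfam F J v = 0.
Definition cohom (F G : family) := exists2 eta, fam_adm eta &
  forall J v, F J v - G J v = dfam eta J v.

Lemma fam_adm_smooth (F : family) J : fam_adm F -> sm (F J).
Proof. by move=> aF; have [] := aF J. Qed.

Lemma cohom_trans (F G H : family) : cohom F G -> cohom G H -> cohom F H.
Proof.
move=> [e1 a1 h1] [e2 a2 h2]; exists (fun J v => e1 J v + e2 J v).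
  by move=> J; apply: adm_add.
move=> J v; rewrite dfam_add; [|by move=> ?; exact: fam_adm_smooth..].
by rewrite -h1 -h2 addrA subrK.
Qed.

Lemma step_torus (F : family) : fam_adm F -> dclosed F ->
  exists G : family, [/\ fam_adm G, dclosed G, cohom F G & forall J, isflat (G J)].
Proof.
move=> aF cF; have HF J : sm (F J) by exact: fam_adm_smooth.
have [S [M [rS rM Mf SM]]] := torus_solution ht hK hsigma.
exists (fun J => M (F J)); split.
- by move=> J; apply: M_adm SM _ _ (aF J).
- move=> J v; rewrite -[RHS](_ : M (dfam F J) v = 0); last first.
    by rewrite (_ : dfam F J = (fun=> 0)) ?(reg_zero rM)//; apply/funext => x; exact: cF.
  rewrite /dfam (reg_sum rM) => [|j _]; last first.
    by apply: smooth_scale; [exact: openT|exact: smooth_theta].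
  by apply: eq_bigr => j _; rewrite (reg_scalar rM) ?(theta_reg _ rM)//; exact: smooth_theta.
- exists (contract l0 (fun=> S) F).
    move=> J; rewrite /contract; case: (boolP (l0 \in J)) => lJ; first exact: adm0.
    have := adm_scale (sgn l0 J) (S_adm rS rM Mf SM (aF (l0 |: J)%SET)).
    by rewrite (_ : (fun u => _) = cc J)//; apply/funext => u; rewrite -ccP.
  move=> J v; rewrite koszul//.
  + have [E _ _] := SM _ (HF J) (let: And3 _ h _ := aF J in h).
    by rewrite -(theta_reg _ rS (HF J)) E if_same.
  + by move=> _; exact: reg_setT rS.
  + by move=> J' j _ _; exact: theta_reg.
- by move=> J; have [_ h _] := aF J; have [_ fM _] := SM _ (HF J) h.
Qed.

(** On functions of lambda the derivative along log u is a constant combination of the [theta k] at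
    real places. Hence the Koszul homotopies at these places add up to one for this derivative. *)
Lemma derive_lvec u F v : sm F -> isflat F ->
  deriveC (lvec u) F v = \sum_(k < n) ((lvec u).2 0 k)%:C%C * (2 / iC * theta k F v).
Proof.
move=> HF fF; rewrite (deriveC_coords _ _ HF); apply: eq_bigr => k _.
rewrite mxE rmorph0 mul0r add0r; case: (ltnP k s) => ks.
  rewrite (theta_flat_lt v ks HF fF); congr (_ * _).
  have i0 : iC != 0 :> C by rewrite eq_complex/= oner_eq0 andbF.
  by field.
by rewrite mxE ltnNge ks/= !mul0r.
Qed.

Lemma adm_shift c F (u : set_type U) v : adm c F -> isflat F ->
  F (v + lvec (val u)) = c u * F v.
Proof. by move=> [_ _ eF] fF; exact: (adm_flat c fF).1. Qed.

Lemma cc_theta (J : {set 'I_n}) j (u : set_type U) : j \in J -> (j < s)%N -> cc (J :\ j)%SET u = cc J u.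
Proof.
move=> jJ js; rewrite (ccP (j := j)) ?inE ?eqxx// finset.setD1K//.
by rewrite /thmul js mulr1.
Qed.

(** The homotopy contracts [Hop] with the coordinates of log u. It joins F to its average along log
    u if the multiplier at u is 1, and to 0 otherwise, where dividing by c - 1 is possible. *)
Lemma step_unit (F : family) (u : set_type U) : fam_adm F -> dclosed F ->
  (forall J, isflat (F J)) ->
  let G := fun J => Mop (cc J u) (lvec (val u)) (F J) in
  [/\ fam_adm G, dclosed G, cohom F G & forall J, isflat (G J)].
Proof.
move=> aF cF fF G; have HF J : sm (F J) by exact: fam_adm_smooth.
pose e := lvec (val u).
have rM J : regop setT (Mop (cc J u) e) by exact: reg_Mop.
have rH J : regop setT (Hop (cc J u) e) by exact: reg_Hop.
(* [T] is chosen by the multiplier, which differs between J without j and J only for non-real j;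
   there [theta j] kills both sides. *)
have thM (T : C -> (V -> C) -> V -> C) (J J' : {set 'I_n}) j : (forall a, regop setT (T a)) -> j \in J ->
    theta j (T (cc (J :\ j)%SET u) (F J')) = T (cc J u) (theta j (F J')).
  move=> rT jJ; case: (ltnP j s) => js.
    apply/funext => v; rewrite cc_theta//.
    have fT := reg_isflat (rT (cc J u)) (HF J') (fF J').
    rewrite (theta_flat_lt v js (reg_smooth (rT _) (HF J')) fT).
    rewrite (reg_derive (rT _))// -[LHS]/((fun x => iC / 2 * T (cc J u) (deriveC (bas (inr j)) (F J')) x) v).
    rewrite -(reg_scalar (rT (cc J u))); last exact: smooth_deriveC.
    by congr (T _ _ v); apply/funext => x; rewrite (theta_flat_lt x js (HF J') (fF J')).
  rewrite (theta_flat_ge js (HF J') (fF J')) (reg_zero (rT _)).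
  apply: theta_flat_ge => //; first exact: (reg_smooth (rT _)).
  exact: (reg_isflat (rT _)).
split.
- by move=> J; have [] := reg_adm_flat (rM J) (fF J) (aF J).
- move=> J v; rewrite -[RHS](_ : Mop (cc J u) e (dfam F J) v = 0); last first.
    by rewrite (_ : dfam F J = (fun=> 0)) ?(reg_zero (rM J))//; apply/funext => x; exact: cF.
  rewrite /dfam (reg_sum (rM J)) => [|j _]; last first.
    by apply: smooth_scale; [exact: openT|exact: smooth_theta].
  apply: eq_bigr => j jJ; rewrite (reg_scalar (rM J)); last exact: smooth_theta.
  by rewrite -(thM (fun a => Mop a e))// => a; exact: reg_Mop.
- exists (fun J v => \sum_(k < n | (k < s)%N)
    (e.2 0 k)%:C%C * (2 / iC) * contract k (fun J => Hop (cc J u) e) F J v).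
    move=> J; apply: adm_sum => k ks; apply: adm_scale.
    rewrite /contract; case: (boolP (k \in J)) => kJ; first exact: adm0.
    apply: adm_scale; have [aH _] := reg_adm_flat (rH J) (fF _) (aF (k |: J)%SET).
    suff E : cc J = cc (k |: J)%SET by rewrite -E in aH.
    by apply/funext => u'; rewrite (ccP kJ) /thmul ks mulr1.
  move=> J v; rewrite dfam_sum => [|k J' _]; last first.
    apply: smooth_scale; first exact: openT.
    by apply: smooth_contract => // J''; exact: reg_Hop.
  transitivity (deriveC e (Hop (cc J u) e (F J)) v).
    by rewrite derive_Hop// => x; exact: adm_shift.
  rewrite derive_lvec; last 2 first.
  + exact: (reg_smooth (rH J)).
  + exact: (reg_isflat (rH J)).
  rewrite (bigID (fun k : 'I_n => (k < s)%N))/= [X in _ + X]big1 ?addr0 => [|k]; last first.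
    by rewrite -leqNgt => sk; rewrite mxE ltnNge sk/= mul0r.
  apply: eq_bigr => k ks; rewrite dfam_scale => [|J']; last first.
    by apply: smooth_contract => // J''; exact: reg_Hop.
  rewrite mulrA; congr (_ * _); rewrite koszul//; last first.
    by move=> J' j jJ kJ; apply: (thM (fun a => Hop a e)) => // a; exact: reg_Hop.
  have thk : theta k (Hop (cc J u) e (F J)) = Hop (cc J u) e (theta k (F J)).
    apply/funext => x.
    rewrite (theta_flat_lt x ks (reg_smooth (rH J) (HF J)) (reg_isflat (rH J) (HF J) (fF J))).
    rewrite (reg_derive (rH J))// -[LHS]/((fun y => iC / 2 * Hop (cc J u) e (deriveC (bas (inr k)) (F J)) y) x).
    rewrite -(reg_scalar (rH J)); last exact: smooth_deriveC.
    by congr (Hop _ _ _ x); apply/funext => y; rewrite (theta_flat_lt y ks (HF J) (fF J)).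
  by case: ifP => kJ; [rewrite cc_theta|rewrite thk].
- by move=> J; have [] := reg_adm_flat (rM J) (fF J) (aF J).
Qed.

End LogHodge.

(** * Harmonic representatives *)

Section HodgeTheorem.
Context {R : realType} {s t : nat} {K : fieldExtType rat}.
Local Notation C := R[i].
Local Notation n := (s + t)%N.
Local Notation N := (s + t + t)%N.
Local Notation V := (Cn R n).
Variables (sigma : 'I_N -> {rmorphism K -> C}) (U : set K).
Hypotheses (ht : (0 < t)%N) (hK : \dim {: K} = N) (hsigma : is_enum_embeddings sigma).
Hypothesis hU : admissible sigma U.
Local Notation sm := (@smooth R V setT).
Local Notation sg k := (sigma (lshift t k)).
Local Notation theta := (@theta R s t).
Local Notation flat_dir := (@flat_dir R s t).
Local Notation isflat := (@isflat R s t).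
Local Notation dfam := (@dfam R s t).
Local Notation family := ({set 'I_n} -> V -> C).
Local Notation lvec := (lvec sigma).
Implicit Types (F G H : V -> C) (v w x : V) (j k : 'I_n) (u : set_type U).

(** Induction over products and inverses of generators, which spares integer exponents in the
    sequel. *)
Lemma units_ind : exists e : 'I_s -> set_type U, forall P : K -> Prop,
  P 1 -> (forall a b, U a -> U b -> P a -> P b -> P (a * b)) ->
  (forall a, U a -> P a -> P a^-1) -> (forall i, P (val (e i))) -> forall a, U a -> P a.
Proof.
have [_ [U1 UM UV] [e Ue Ugen] _] := hU.
exists (fun i => SigSub (mem_set (Ue i))) => P P1 PM PV Pe a /Ugen[m [-> _]].
suff [] : U (\prod_i e i ^ m i) /\ P (\prod_i e i ^ m i) by [].
apply: (big_ind (fun b => U b /\ P b)) => // [b c [? ?] [? ?]|i _].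
  by split; [exact: UM|exact: PM].
have H (k : nat) : U (e i ^+ k) /\ P (e i ^+ k).
  elim: k => [|k [Uk Pk]]; first by rewrite expr0.
  by rewrite exprS; split; [exact: UM|apply: PM => //; exact: (Pe i)].
case: (m i) => k; rewrite ?NegzE -?exprnN -?exprnP; first exact: H.
by have [? ?] := H k.+1; split; [exact: UV|exact: PV].
Qed.

Lemma ln_sigmaM (i : 'I_s) a b : U a -> U b ->
  ln (complex.Re (sg (lshift t i) (a * b))) =
  ln (complex.Re (sg (lshift t i) a)) + ln (complex.Re (sg (lshift t i) b)).
Proof.
move=> Ua Ub; have is_ : (lshift t i < s)%N by exact: (ltn_ord i).
have pos c : U c -> 0 < complex.Re (sg (lshift t i) c).
  move=> Uc; have [h _ _ _] := hU; have [_ _ _ /(_ i)] := h _ Uc.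
  by rewrite ltcE => /andP[].
by rewrite rmorphM cReM !(sg_real hsigma)// mulr0 subr0 lnM ?posrE ?pos.
Qed.

(** The generators of U and the basis [B] of the lattice are given separately. All rows of [B] lie
    in the row space of the logarithms of the s generators, so their square matrix is invertible and
    they span the lambda directions. *)
Lemma units_span : exists e : 'I_s -> set_type U,
  (forall P : K -> Prop,
  P 1 -> (forall a b, U a -> U b -> P a -> P b -> P (a * b)) ->
  (forall a, U a -> P a -> P a^-1) -> (forall i, P (val (e i))) -> forall a, U a -> P a) /\
  forall k, (k < s)%N -> exists c : 'I_s -> R, bas (inr k) = \sum_i c i *: lvec (val (e i)).
Proof.
have [e eP] := units_ind; exists e; split=> //.
have [_ [U1 UM UV] _ [B uB logU]] := hU.
have logM a b : U a -> U b ->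
    log_embedding sigma (a * b) = log_embedding sigma a + log_embedding sigma b.
  by move=> Ua Ub; apply/rowP => i; rewrite !mxE ln_sigmaM.
pose L := \matrix_i log_embedding sigma (val (e i)).
have span a : U a -> exists m : 'rV[R]_s, log_embedding sigma a = m *m L.
  have log1 : log_embedding sigma 1 = 0.
    by apply/rowP => i; rewrite !mxE rmorph1/= ln1.
  move: a; apply: eP.
  - by exists 0; rewrite mul0mx log1.
  - by move=> a b Ua Ub [m E] [m' E']; exists (m + m'); rewrite mulmxDl -E -E' logM.
  - move=> a Ua [m E]; exists (- m); rewrite mulNmx -E; apply/eqP; rewrite -addr_eq0 addrC.
    have a0 : a != 0 by have [h _ _ _] := hU; have [] := h _ Ua.
    by rewrite -logM ?divff ?log1//; exact: UV.
  - by move=> i; exists (delta_mx 0 i); rewrite -rowE rowK.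
have uL : L \in unitmx.
  have /choice[X XP] (i : 'I_s) : exists m : 'rV[R]_s, row i B = m *m L.
    have : [set log_embedding sigma u | u in U] (row i B).
      rewrite logU; exists (delta_mx 0 i) => //.
      by rewrite map_delta_mx -rowE.
    by move=> [a Ua <-]; exact: span.
  suff E : B = (\matrix_i X i) *m L by move: uB; rewrite E unitmx_mul => /andP[].
  by apply/row_matrixP => i; rewrite XP row_mul rowK.
move=> k ks; have [k' kk'] := splitK_lt ks.
pose c : 'rV[R]_s := delta_mx 0 k' *m invmx L.
have cL : c *m L = delta_mx 0 k' by rewrite mulmxKV.
have lv1 b i : crd (inl b) (lvec (val (e i))) = 0 by rewrite /crd/= mxE.
have lv2 b i : crd (inr b) (lvec (val (e i))) =
    if (b < s)%N then ln (complex.Re (sg b (val (e i)))) else 0 by rewrite /crd/= mxE.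
exists (fun i => c 0 i); apply: crdP => -[b|b]; rewrite crd_sum crd_bas.
  by rewrite big1// => i _; rewrite crdZ lv1 mulr0.
under eq_bigr do rewrite crdZ lv2.
case: (ltnP b s) => bs; last first.
  rewrite big1 => [|i _]; last by rewrite mulr0.
  by case: eqP => // -[bk]; move: ks; rewrite -bk ltnNge bs.
have [b' bb'] := splitK_lt bs.
transitivity ((c *m L) 0 b'); last first.
  by rewrite [LHS]mxE; apply: eq_bigr => i _; rewrite [L _ _]mxE [log_embedding _ _ _ _]mxE bb'.
have -> : (inr b == inr k :> 'I_n + 'I_n) = (b' == k').
  by rewrite kk' bb' -[LHS]/(lshift t b' == lshift t k') (inj_eq (@lshift_inj _ _)).
by rewrite cL mxE eqxx.
Qed.

Variable cc : {set 'I_n} -> set_type U -> C.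
Hypothesis ccP : forall (J : {set 'I_n}) j, j \notin J -> forall u,
  cc J u = cc (j |: J)%SET u * thmul sigma j (val u).
Hypothesis cc_neq0 : forall J u, cc J u != 0.
Hypothesis ccM : forall J (u v w : set_type U), val w = val u * val v ->
  cc J w = cc J u * cc J v.

Lemma cc_triv J (e : 'I_s -> set_type U) : (forall P : K -> Prop,
  P 1 -> (forall a b, U a -> U b -> P a -> P b -> P (a * b)) ->
  (forall a, U a -> P a -> P a^-1) -> (forall i, P (val (e i))) -> forall a, U a -> P a) ->
  (forall i, cc J (e i) = 1) -> forall u, cc J u = 1.
Proof.
move=> eP ce u.
have [_ [U1 UM UV] _ _] := hU.
have triv1 (z : set_type U) : val z = 1 -> cc J z = 1.
  move=> z1; have := @ccM J z z z; rewrite z1 mulr1 => /(_ erefl) E.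
  by apply: (mulfI (cc_neq0 J z)); rewrite mulr1 -E.
apply: (eP (fun a => forall z : set_type U, val z = a -> cc J z = 1)) erefl; last exact: set_valP.
- exact: triv1.
- move=> a b Ua Ub Pa Pb z zE.
  rewrite (@ccM J (SigSub (mem_set Ua)) (SigSub (mem_set Ub)))//.
  by rewrite (Pa (SigSub (mem_set Ua)))// (Pb (SigSub (mem_set Ub)))// mulr1.
- move=> a Ua Pa z zE.
  have a0 : a != 0 by have [h _ _ _] := hU; have [] := h _ Ua.
  have := @ccM J z (SigSub (mem_set Ua)) (SigSub (mem_set U1)).
  by rewrite zE/= mulVf// (Pa (SigSub (mem_set Ua)))// mulr1 triv1// => <-.
- by move=> i z /val_inj ->.
Qed.

Lemma const_flat G e : (forall k, (k < s)%N ->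
    exists c : 'I_s -> R, bas (inr k) = \sum_i c i *: lvec (val (e i : set_type U))) ->
  sm G -> isflat G -> (forall i, deriveC (lvec (val (e i))) G = (fun=> 0)) ->
  forall k, deriveC (bas (inr k)) G = (fun=> 0).
Proof.
move=> eP HG fG dG k; apply/funext => v; case: (ltnP k s) => ks; last first.
  by apply: (flat_derive v HG fG); exact: bas_flat.
have [c ->] := eP k ks.
elim: (index_enum _) => [|i r IH].
  by rewrite big_nil; have := deriveC_scale_dir v (0 : V) 0 HG; rewrite scale0r mul0r.
rewrite big_cons -[X in c i *: _ + X]scale1r (deriveC_lin _ _ _ _ openT HG (I : setT v)).
by rewrite IH mulr0 addr0 dG mulr0.
Qed.

(** After the torus step, one averaging per generator removes the dependence on lambda. A component
    whose multiplier is not 1 at some generator becomes 0, so the remaining constants have trivial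
    multiplier. *)
Theorem hodge_exists (F : family) : fam_adm sigma cc F -> dclosed F ->
  exists (kappa : {set 'I_n} -> C) (eta : family),
  [/\ forall J, kappa J != 0 -> forall u, cc J u = 1, fam_adm sigma cc eta &
      forall J v, F J v = kappa J + dfam eta J v].
Proof.
move=> aF cF.
have [G [aG cG FG fG]] := step_torus ht hK hsigma hU ccP aF cF.
have [e [eP eb]] := units_span.
(* What earlier generators achieved persists: [Mop] commutes with derivatives and maps 0 to 0. *)
have H (r : seq 'I_s) : exists G : family,
    [/\ fam_adm sigma cc G, dclosed G, cohom sigma cc F G & forall J, isflat (G J)] /\
    forall i J, i \in r -> deriveC (lvec (val (e i))) (G J) = (fun=> 0) /\
      (cc J (e i) != 1 -> G J = (fun=> 0)).
  elim: r => [|i r [G' [[a1 a2 a3 a4] a5]]]; first by exists G.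
  have [b1 b2 b3 b4] := step_unit ccP (e i) a1 a2 a4.
  exists (fun J => Mop (cc J (e i)) (lvec (val (e i))) (G' J)); split.
    by split=> //; exact: (cohom_trans a3 b3).
  move=> i' J; have sG : sm (G' J) by exact: (fam_adm_smooth J a1).
  have rM := reg_Mop (cc J (e i)) (lvec (val (e i))).
  rewrite inE => /predU1P[->|/(a5 _ J)[d0 n1]].
    split; first by apply: derive_Mop => // v; exact: adm_shift.
    by move=> c1; rewrite /Mop (negbTE c1).
  split; first by rewrite (reg_derive rM) // d0 (reg_zero rM).
  by move=> /n1 ->; rewrite (reg_zero rM).
have [{aG cG FG fG}G [[aG cG [eta aeta FG] fG] dG]] := H (enum 'I_s).
have HG J : sm (G J) by exact: (fam_adm_smooth J aG).
have dG' i J : deriveC (lvec (val (e i))) (G J) = (fun=> 0).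
  by have [] := dG i J (mem_enum _ i).
have Gc J v : G J v = G J 0.
  rewrite -[v]add0r -[X in 0 + X]scale1r; apply: derive0_invariant => //.
  apply/funext => x; rewrite (deriveC_coords _ _ (HG J)) big1// => k _.
  rewrite (const_flat eb (HG J) (fG J)) // mulr0 addr0 (flat_derive _ (HG J) (fG J)) ?mulr0//.
  exact: bas_flat.
exists (fun J => G J 0), eta; split=> //; last first.
  by move=> J v; rewrite -(Gc J v) -FG addrC subrK.
move=> J GJ; apply: (cc_triv eP) => i; apply/eqP; apply: contraNT GJ => c1.
by have [_ ->] := dG i J (mem_enum _ i).
Qed.

Lemma multi_avg (r : seq V) : exists T, [/\ regop setT T,
   forall a : C, T (fun=> a) = (fun=> a) &
   forall (f : V -> C), sm f -> (forall e, e \in r -> forall v, f (v + e) = f v) ->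
     forall e, e \in r -> deriveC e (T f) = (fun=> 0)].
Proof.
elim: r => [|e r [T [rT Ta dT]]].
  by exists (avg (0 : V)); split=> //; [exact: reg_avg|move=> a; apply: avg_invariant => //; apply: smooth_cst; exact: openT].
have rA := reg_avg e; exists (avg e \o T); split.
- exact: reg_comp.
- by move=> a /=; rewrite Ta avg_invariant//; apply: smooth_cst; exact: openT.
- move=> f Hf fp e'; have HT : sm (T f) by exact: (reg_smooth rT).
  rewrite inE => /predU1P[->|er] /=.
    rewrite derive_avg//; apply/funext => v; apply/eqP; rewrite subr_eq0; apply/eqP.
    by apply: (reg_periodic rT Hf) => x; apply: fp; rewrite mem_head.
  rewrite (reg_derive rA)// dT// ?(reg_zero rA)// => e2 e2r; apply: fp.
  by rewrite inE e2r orbT.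
Qed.

(** Applying [M] makes the primitive flat, which removes [theta j] at non-real places. If the
    constant were non-zero, the multiplier 1 would make the components at real j invariant under log
    U, and averaging along the generators would kill their lambda derivatives. The constant itself
    is fixed by both averages. *)
Theorem hodge_unique (kappa : {set 'I_n} -> C) (eta : family) J :
  (kappa J != 0 -> forall u, cc J u = 1) -> fam_adm sigma cc eta ->
  (forall v, kappa J = dfam eta J v) -> kappa J = 0.
Proof.
move=> kc aeta E; apply/eqP; apply/negPn/negP => kJ.
have {kc} c1 := kc kJ.
have [S [M [rS rM Mf SM]]] := torus_solution ht hK hsigma.
have [e [eP eb]] := units_span.
have [T [rT Ta dT]] := multi_avg [seq lvec (val (e i)) | i <- enum 'I_s].
have Heta J' : sm (eta J') by exact: (fam_adm_smooth J' aeta).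
have aM J' : adm sigma (cc J') (M (eta J')) by exact: (M_adm hsigma hU rS rM Mf SM).
have fM J' : isflat (M (eta J')).
  by have [_ iF _] := aeta J'; have [_ h _] := SM _ (Heta J') iF.
have HM J' : sm (M (eta J')) by exact: (reg_smooth rM).
have dM v : kappa J = dfam (fun J' => M (eta J')) J v.
  have Hc : sm (fun=> kappa J) by apply: smooth_cst; exact: openT.
  have := Mf (fun=> kappa J) Hc (fun _ _ _ => erefl).
  rewrite {1}(_ : (fun=> kappa J) = dfam eta J); last by apply/funext.
  move=> /(congr1 (fun f => f v)) <-.
  rewrite /dfam (reg_sum rM) => [|j _]; last first.
    by apply: smooth_scale; [exact: openT|exact: smooth_theta].
  by apply: eq_bigr => j _; rewrite (reg_scalar rM) ?(theta_reg _ rM)//; exact: smooth_theta.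
have : kappa J = T (fun v => dfam (fun J' => M (eta J')) J v) 0.
  by rewrite (_ : (fun v => _) = (fun=> kappa J)) ?Ta//; apply/funext => v.
rewrite /dfam (reg_sum rT) => [|j _]; last first.
  by apply: smooth_scale; [exact: openT|exact: smooth_theta].
rewrite big1 => [/eqP|j jJ]; first by rewrite (negbTE kJ).
rewrite (reg_scalar rT); last exact: smooth_theta.
case: (ltnP j s) => js; last by rewrite (theta_flat_ge js)// (reg_zero rT) mulr0.
have -> : theta j (M (eta (J :\ j)%SET)) =
    (fun v => iC / 2 * deriveC (bas (inr j)) (M (eta (J :\ j)%SET)) v).
  by apply/funext => v; exact: theta_flat_lt.
rewrite (reg_scalar rT); last exact: smooth_deriveC.
rewrite -(reg_derive rT)// (const_flat eb) ?mulr0//.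
- exact: (reg_smooth rT).
- exact: (reg_isflat rT).
- move=> i; apply: dT => //; last by apply: map_f; rewrite mem_enum.
  move=> _ /mapP[i' _ ->] v; rewrite (adm_shift _ v (aM _) (fM _)).
  by rewrite (cc_theta ccP)// c1 mul1r.
Qed.

End HodgeTheorem.

(** * Forms on H^s x C^t *)

Lemma open_pos {R : realType} (W : normedModType R) (I : finType) (P : pred I) (f : I -> W -> R) :
  (forall i, continuous (f i)) -> open [set y | forall i, P i -> 0 < f i y].
Proof.
move=> cf; rewrite openE => x /= fx.
apply: filter_forall => i; case Pi : (P i); last by apply: filterE.
apply: filterS (cvgr_gt _ (@cf i x) _ (fx i Pi)) => y /= y0 _.
exact: y0.
Qed.

Section LogChartMap.
Context {R : realType} {s t : nat}.
Local Notation C := R[i].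
Local Notation n := (s + t)%N.
Local Notation V := (Cn R n).
Local Notation sm := (@smooth R V setT).
Local Notation Om := (HsCt R s t).
Local Notation theta := (@theta R s t).
Local Notation thcoef := (@thcoef R s t).
Local Notation dfam := (@dfam R s t).
Implicit Types (F f : V -> C) (v w x : V) (j k : 'I_n) (b : 'I_n + 'I_n) (J : {set 'I_n}).

Let isH b : bool := if b is inr k then (k < s)%N else false.
Let psiE b (r : R) := if isH b then expR r else r.
Let dpsiE b (r : R) := if isH b then expR r else 1.
Let psiL b (r : R) := if isH b then ln r else r.
Let dpsiL b (r : R) := if isH b then r^-1 else 1.

Definition exp_chart v : V := (v.1, \row_k (if (k < s)%N then expR (v.2 0 k) else v.2 0 k)).
Definition log_chart v : V := (v.1, \row_k (if (k < s)%N then ln (v.2 0 k) else v.2 0 k)).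

Let crd_exp b v : crd b (exp_chart v) = psiE b (crd b v).
Proof. by case: b => k; rewrite /crd /psiE /isH//= mxE. Qed.

Let crd_log b v : crd b (log_chart v) = psiL b (crd b v).
Proof. by case: b => k; rewrite /crd /psiL /isH//= mxE. Qed.

Lemma HsCtP v : Om v <-> forall b, isH b -> 0 < crd b v.
Proof.
split=> [Ov [//|k] /= ks|H i].
  by have [i ki] := splitK_lt ks; have := Ov i; rewrite /crd ki.
by apply: (H (inr (lshift t i))) => /=; exact: (ltn_ord i).
Qed.

Lemma exp_chart_in v : Om (exp_chart v).
Proof. by apply/HsCtP => b Hb; rewrite crd_exp /psiE Hb expR_gt0. Qed.

Lemma exp_chartK : cancel exp_chart log_chart.
Proof.
by move=> v; apply: crdP => b; rewrite crd_log crd_exp /psiL /psiE; case: (isH b); rewrite ?expRK.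
Qed.

Lemma log_chartK x : Om x -> exp_chart (log_chart x) = x.
Proof.
move=> /HsCtP Ox; apply: crdP => b; rewrite crd_exp crd_log /psiL /psiE.
by case Hb : (isH b) => //; rewrite lnK ?posrE ?Ox.
Qed.

Lemma openHsCt : open Om.
Proof.
rewrite (_ : Om = [set y | forall b, isH b -> 0 < crd b y]); last first.
  by apply/seteqP; split=> y /HsCtP.
by apply: (open_pos (I := ('I_n + 'I_n)%type)) => b; exact: crd_continuous.
Qed.

Let exp_diff b v : setT v -> is_derive (crd b v) (1 : R) (psiE b) (dpsiE b (crd b v)).
Proof.
move=> _; rewrite /psiE /dpsiE; case: (isH b); first exact: is_derive_expR.
exact: is_derive_id.
Qed.

Let log_diff b v : Om v -> is_derive (crd b v) (1 : R) (psiL b) (dpsiL b (crd b v)).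
Proof.
move=> /HsCtP Ov; rewrite /psiL /dpsiL; case Hb: (isH b); last exact: is_derive_id.
by apply: is_derive1_ln; exact: Ov.
Qed.

Lemma Ck_crd D b m : open D -> Ck D m (crd b : V -> R).
Proof.
move=> oD.
have D1 x v : is_derive x v (crd b : V -> R) (crd b v).
  apply/is_derive_epsP => e e0; exists 1 => // h _.
  rewrite crdD crdZ [crd b x + _]addrC addrK subrr normr0.
  by rewrite mulr_ge0// ltW.
case: m => [|m]; first by split=> // x _; exact: crd_continuous.
split=> [x _|v]; first exact: crd_continuous.
split=> [x _|]; first by have [] := D1 x v.
apply: Ck_eq (Ck_cst m (crd b v) oD) => // x _.
by have [_ ->] := D1 x v.
Qed.

Lemma smooth_exp_chart f : smooth Om f -> sm (f \o exp_chart).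
Proof.
move=> Hf k.
have H g : (forall m, Ck Om m g) -> Ck setT k (g \o exp_chart).
  move=> Hg; apply: (@Ck_coordinatewise _ _ setT Om exp_chart psiE dpsiE
    (fun b v => if isH b then crd b v else 1)) => //.
  - exact: openT.
  - exact: openHsCt.
  - by move=> x _; exact: exp_chart_in.
  - move=> b m; case: (isH b); first by apply: Ck_crd; exact: openHsCt.
    by apply: Ck_cst; exact: openHsCt.
  - by move=> b x _; rewrite /dpsiE crd_exp /psiE; case: (isH b).
by split; [apply: (H (fun x => complex.Re (f x)))|apply: (H (fun x => complex.Im (f x)))] => m;
  have [] := Hf m.
Qed.

Lemma smooth_log_chart F : sm F -> smooth Om (F \o log_chart).
Proof.
move=> HF k.
have H g : (forall m, Ck setT m g) -> Ck Om k (g \o log_chart).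
  (* The slope 1/y of the logarithm at y is the exponential of minus the image coordinate. *)
  move=> Hg; apply: (@Ck_coordinatewise _ _ Om setT log_chart psiL dpsiL
    (fun b v => if isH b then (expR (crd b (- v))) else 1)) => //.
  - exact: openHsCt.
  - exact: openT.
  - move=> b m; case: (isH b); last by apply: Ck_cst; exact: openT.
    have : smooth setT ((fun v : V => (expR (crd b v))%:C%C) \o -%R).
      apply: (@smooth_line _ _ -%R -%R); last exact: smooth_exp_crd.
        exact: opp_continuous.
      by move=> x v h; rewrite opprD scalerN.
    by move=> /(_ m)[].
  - move=> b x /HsCtP Ox; rewrite /dpsiL -scaleN1r crdZ crd_log mulN1r /psiL.
    by case Hb : (isH b) => //; rewrite expRN lnK ?posrE ?Ox.
by split; [apply: (H (fun x => complex.Re (F x)))|apply: (H (fun x => complex.Im (F x)))] => m;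
  have [] := HF m.
Qed.

Lemma deriveC_exp_chart b f v : smooth Om f ->
  deriveC (bas b) (f \o exp_chart) v = (dpsiE b (crd b v))%:C%C * deriveC (bas b) f (exp_chart v).
Proof.
move=> Hf; have [d1 d2] := smooth_derivable (bas b) Hf (exp_chart_in v).
have H g := @is_derive_coordinatewise _ _ setT exp_chart psiE dpsiE crd_exp exp_diff b g v I.
have [_ e1] := H _ d1; have [_ e2] := H _ d2.
apply: ReIm_inj; rewrite ?(cReM, cImM) /deriveC/= ?mul0r ?subr0 ?addr0.
  exact: e1.
exact: e2.
Qed.

Lemma theta_exp_chart j f v : smooth Om f ->
  theta j (f \o exp_chart) v = thcoef j v * dzbar j f (exp_chart v).
Proof.
move=> Hf; rewrite /theta !deriveC_exp_chart// /dzbar /thcoef /dpsiE /isH.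
have -> : (0 +i* 1)%C = iC :> C by [].
rewrite /crd; move: (deriveC _ _ _) (deriveC _ _ (exp_chart v)) => X Y.
by case: (j < s)%N; rewrite !mul1r ?mulrA//; ring.
Qed.

Definition frame J v : C := \prod_(j in J) thcoef j v.

Lemma thcoef_neq0 j v : thcoef j v != 0.
Proof.
rewrite /thcoef; case: ifP => _; last exact: oner_neq0.
by rewrite eq_complex/= eqxx andbT gt_eqF// expR_gt0.
Qed.

Lemma frame_neq0 J v : frame J v != 0.
Proof. by apply/prodf_neq0 => j _; exact: thcoef_neq0. Qed.

Lemma smooth_frame J : sm (frame J).
Proof.
rewrite /frame; elim: (index_enum _) => [|j r IH].
  apply: (smooth_eq openT) (smooth_cst 1 openT) => v _; by rewrite big_nil.
case jJ : (j \in J).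
  apply: (smooth_eq openT) (smooth_mul openT (smooth_thcoef j) IH) => v _.
  by rewrite big_cons jJ.
by apply: (smooth_eq openT) IH => v _; rewrite big_cons jJ.
Qed.

(** Evaluating at [- v] provides the inverse of the frame as a visibly smooth function. *)
Lemma frameN J v : frame J (- v) = (frame J v)^-1.
Proof.
rewrite /frame -prodfV; apply: eq_bigr => j _; rewrite /thcoef.
case: (j < s)%N; last by rewrite invr1.
by rewrite mxE expRN fmorphV.
Qed.

(** The frame factors other than the j-th do not involve the j-th coordinates, so [theta j] treats
    them as constants. Therefore rescaling the frame turns dbar into the Koszul differential without
    lower order terms. *)
Lemma theta_frame j J F v : j \in J -> sm F ->
  theta j (fun x => frame (J :\ j)%SET x * F x) v = frame (J :\ j)%SET v * theta j F v.
Proof.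
move=> jJ HF; have HP := smooth_frame (J :\ j)%SET.
have P0 b : (b = inl j \/ b = inr j) -> deriveC (bas b) (frame (J :\ j)%SET) v = 0.
  move=> bj; apply: deriveC_invariant => // r x; apply: eq_bigr => k; rewrite !inE => /andP[kj _].
  rewrite /thcoef; case: (k < s)%N => //; rewrite !mxE.
  by case: bj => ->; rewrite /bas/= mxE ?(negbTE kj) ?andbF ?mulr0 ?addr0.
rewrite /theta !(deriveCM _ HP HF (I : setT v)) !P0; [|by right|by left].
rewrite !mul0r !add0r; move: (deriveC _ _ _) (deriveC (bas (inr j)) _ _) => X Y; ring.
Qed.

(* The coefficients, in the frame where dwbar_j is divided by Im w_j, of the
   form with coefficients [f]. *)
Definition to_log (f : {set 'I_n} -> V -> C) J v : C := frame J v * f J (exp_chart v).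
Definition of_log (F : {set 'I_n} -> V -> C) J x : C := frame J (- log_chart x) * F J (log_chart x).

Lemma smooth_to_log (f : {set 'I_n} -> V -> C) J : smooth Om (f J) -> sm (to_log f J).
Proof.
by move=> Hf; apply: (smooth_mul openT); [exact: smooth_frame|exact: smooth_exp_chart].
Qed.

Lemma smooth_of_log (F : {set 'I_n} -> V -> C) J : sm (F J) -> smooth Om (of_log F J).
Proof.
move=> HF; apply: (@smooth_log_chart (fun v => frame J (- v) * F J v)).
apply: (smooth_mul openT) => //; apply: (@smooth_line _ _ -%R -%R) (smooth_frame J).
  exact: opp_continuous.
by move=> x v h; rewrite opprD scalerN.
Qed.

Lemma of_logK (F : {set 'I_n} -> V -> C) J : to_log (of_log F) J = F J.
Proof.
apply/funext => v; rewrite /to_log /of_log exp_chartK frameN mulrA mulfV ?mul1r//.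
exact: frame_neq0.
Qed.

Lemma dfam_to_log (f : {set 'I_n} -> V -> C) J v : (forall J, smooth Om (f J)) ->
  dfam (to_log f) J v = frame J v * \sum_(j in J) (-1) ^+ #|[set k in J | (k < j)%N]|%SET *
    dzbar j (f (J :\ j)%SET) (exp_chart v).
Proof.
move=> Hf; rewrite /dfam mulr_sumr; apply: eq_bigr => j jJ.
rewrite [theta _ _ _](theta_frame v jJ); last exact: smooth_exp_chart.
rewrite theta_exp_chart//.
have -> : frame J v = thcoef j v * frame (J :\ j)%SET v by rewrite /frame (big_setD1 j).
by rewrite /sgn; move: (_ ^+ _) => e; ring.
Qed.

End LogChartMap.

(** * Forms with values in the flat line bundle *)

Section Forms.
Context {R : realType} {s t : nat} {K : fieldExtType rat}.
Local Notation C := R[i].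
Local Notation n := (s + t)%N.
Local Notation N := (s + t + t)%N.
Local Notation V := (Cn R n).
Variables (sigma : 'I_N -> {rmorphism K -> C}) (U : set K).
Hypotheses (ht : (0 < t)%N) (hK : \dim {: K} = N) (hsigma : is_enum_embeddings sigma).
Hypothesis hU : admissible sigma U.
Variable rho : set_type U -> C.
Hypothesis rhoP : characters R U rho.
Local Notation sm := (@smooth R V setT).
Local Notation Om := (HsCt R s t).
Local Notation sg k := (sigma (lshift t k)).
Local Notation dfam := (@dfam R s t).
Local Notation uact := (uact sigma).
Local Notation tau := (tau sigma).
Local Notation thmul := (thmul sigma).
Implicit Types (F G : V -> C) (v w x : V) (j k : 'I_n) (u : set_type U) (I J : {set 'I_n}).
Implicit Types (omega eta : cform R n) (p q : int).

Definition chi I J (a : K) : C := (\prod_(i in I) sg i a) * \prod_(j in J) thmul j a.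
Definition cc I J u : C := rho u / chi I J (val u).

Lemma sg_neq0 j u : sg j (val u) != 0.
Proof. by rewrite fmorph_eq0 (U_neq0 hU). Qed.

Lemma chi_neq0 I J u : chi I J (val u) != 0.
Proof.
rewrite /chi mulf_neq0//; apply/prodf_neq0 => j _; first exact: sg_neq0.
exact: (thmul_neq0 hU).
Qed.

Lemma cc_neq0 I J u : cc I J u != 0.
Proof. by rewrite /cc mulf_neq0 ?invr_eq0 ?chi_neq0//; have [h _] := rhoP. Qed.

Lemma thmulM j (a b : K) : thmul j (a * b) = thmul j a * thmul j b.
Proof. by rewrite /thmul; case: (j < s)%N; rewrite ?mulr1// !rmorphM. Qed.

Lemma chiM I J (a b : K) : chi I J (a * b) = chi I J a * chi I J b.
Proof.
rewrite /chi (eq_bigr (fun i => sg i a * sg i b)) => [|i _]; last by rewrite rmorphM.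
rewrite (eq_bigr (P := fun j => j \in J) (fun j => thmul j a * thmul j b)) => [|j _]; last exact: thmulM.
by rewrite !big_split/= mulrACA.
Qed.

Lemma ccM I J (u u' u'' : set_type U) : val u'' = val u * val u' ->
  cc I J u'' = cc I J u * cc I J u'.
Proof.
move=> E; have [_ /(_ _ _ _ E) rM] := rhoP.
by rewrite /cc rM E chiM invfM mulrACA.
Qed.

Lemma ccP I J j : j \notin J -> forall u, cc I J u = cc I (j |: J)%SET u * thmul j (val u).
Proof.
move=> jJ u; rewrite /cc /chi big_setU1//= -!mulrA; congr (_ * _).
have := thmul_neq0 hU j u; have /mulfVK H := chi_neq0 I J u.
move: (\prod_(i in I) _) (\prod_(i in J) _) (thmul j _) => a b c c0.
by rewrite !invfM mulrA -[LHS]mulr1 -(mulVf c0); ring.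
Qed.

Lemma cc1 I J u : (cc I J u = 1) <-> chi I J (val u) = rho u.
Proof.
rewrite /cc; split=> [/(congr1 (fun z => z * chi I J (val u)))|<-]; last first.
  by rewrite divff ?chi_neq0.
by rewrite mulfVK ?chi_neq0// mul1r.
Qed.

Lemma uact1 v : uact 1 v = v.
Proof.
apply: crdP => -[k|k]; rewrite /uact /crd/= mxE rmorph1 mul1r//.
by case: (k < s)%N => //=; rewrite ln1 addr0.
Qed.

Lemma tau0 : tau 0 = 0.
Proof. by congr (_, _); apply/rowP => k; rewrite !mxE rmorph0. Qed.

Lemma ring_of_integers0 : ring_of_integers (0 : K).
Proof. by exists 'X; rewrite ?monicX ?map_polyX ?rootX. Qed.

Lemma admP (c : set_type U -> C) F :
  (forall u u' u'' : set_type U, val u'' = val u * val u' -> c u'' = c u * c u') ->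
  (forall u, c u != 0) ->
  adm sigma c F <-> sm F /\ forall u b v, ring_of_integers b ->
    F (uact (val u) v + tau b) = c u * F v.
Proof.
move=> cM c0; split=> [[HF iF eF]|[HF eF]].
  by split=> // u b v bO; rewrite iF// eF.
have [_ [U1 _ _] _ _] := hU; pose u1 : set_type U := SigSub (mem_set U1).
have c1 : c u1 = 1.
  by apply: (mulfI (c0 u1)); rewrite mulr1 -(cM u1 u1 u1)//= mulr1.
split=> // [b v bO|u v].
  by have := eF u1 b v bO; rewrite c1 mul1r /= uact1.
by have := eF u 0 v ring_of_integers0; rewrite tau0 addr0.
Qed.

(** The conjugate of [sg j a] splits as [thmul] times [hmul] for units of U; this part, from the
    real places, is absorbed by the change of frame. *)
Definition hmul j (a : K) : C := if (j < s)%N then sg j a else 1.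

Lemma frame_uact J u b v :
  frame J (uact (val u) v + tau b) = frame J v * \prod_(j in J) hmul j (val u).
Proof.
rewrite /frame -big_split/=; apply: eq_bigr => j _; rewrite /thcoef /hmul.
case: ltnP => js; last by rewrite mulr1.
have := U_pos hU u js; rewrite ltcE/= => /andP[_ r0].
rewrite !mxE js (sg_real hsigma)// addr0 expRD lnK ?posrE// rmorphM/=; congr (_ * _).
by apply: ReIm_inj => //=; rewrite (sg_real hsigma).
Qed.

Lemma conj_prod J u : \prod_(j in J) conjc (sg j (val u)) =
  (\prod_(j in J) thmul j (val u)) * \prod_(j in J) hmul j (val u).
Proof.
rewrite -big_split/=; apply: eq_bigr => j _; rewrite /hmul /thmul.
case: ltnP => js; last by rewrite mulr1.
by rewrite mul1r; have := sg_real hsigma (val u) js; case: (sg j _) => a c /= ->; rewrite oppr0.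
Qed.

Lemma act_exp_chart u b v : Defs.act sigma (val u) b (exp_chart v) =
  exp_chart (uact (val u) v + tau b).
Proof.
apply: crdP => -[k|k]; rewrite /Defs.act /exp_chart /crd/= !mxE.
  rewrite cReD !cReM /zcoord/= !mxE; case: ltnP => // ks.
  by rewrite (sg_real hsigma)// !mul0r.
case: ltnP => ks; rewrite cImD !cImM /zcoord/= ?mxE ?ks//; last by rewrite ltnNge ks.
have := U_pos hU u ks; rewrite ltcE/= => /andP[_ r0].
by rewrite !(sg_real hsigma)// mul0r !addr0 expRD lnK ?posrE// mulrC.
Qed.

Lemma equivariantP I J (f : {set 'I_n} -> V -> C) :
  (forall u b x, ring_of_integers b -> Om x ->
     f J (Defs.act sigma (val u) b x) * (\prod_(i in I) sg i (val u)) *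
       (\prod_(j in J) conjc (sg j (val u))) = rho u * f J x) <->
  forall u b v, ring_of_integers b ->
    to_log f J (uact (val u) v + tau b) = cc I J u * to_log f J v.
Proof.
have E u b v : to_log f J (uact (val u) v + tau b) * chi I J (val u) =
    frame J v * (f J (Defs.act sigma (val u) b (exp_chart v)) * (\prod_(i in I) sg i (val u)) *
       (\prod_(j in J) conjc (sg j (val u)))).
  rewrite /to_log frame_uact conj_prod act_exp_chart /chi; ring.
split=> H u b v bO.
  apply: (mulIf (chi_neq0 I J u)); rewrite E H//; last exact: exp_chart_in.
  by rewrite /cc /to_log mulrAC mulfVK ?chi_neq0//; ring.
move=> Ov; have := E u b (log_chart v); rewrite log_chartK// H// => E'.
apply: (mulfI (frame_neq0 J (log_chart v))); rewrite -E' /cc mulrAC mulfVK ?chi_neq0//.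
by rewrite /to_log log_chartK// mulrCA.
Qed.

Lemma form_fam p q omega I : is_form sigma rho p q omega ->
  fam_adm sigma (cc I) (to_log (fun J x => omega x I J)).
Proof.
move=> [so _ eo] J; apply/(admP _ (@ccM I J) (cc_neq0 I J)); split.
  by apply: smooth_to_log; exact: so.
by apply/equivariantP => u b x bO Ox; exact: eo.
Qed.

Lemma fam_form p q (F : {set 'I_n} -> {set 'I_n} -> V -> C) :
  (forall I, fam_adm sigma (cc I) (F I)) ->
  (forall I J v, F I J v != 0 -> #|I|%:Z = p /\ #|J|%:Z = q) ->
  is_form sigma rho p q (fun x I J => of_log (F I) J x).
Proof.
move=> aF dF; split.
- by move=> I J; apply: smooth_of_log; exact: (fam_adm_smooth J (aF I)).
- by move=> x I J _; rewrite mulf_eq0 negb_or => /andP[_ /dF].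
- move=> u b x I J bO Ox; apply: (equivariantP I J (of_log (F I))).2 => // {}u {}b v {}bO.
  by rewrite !of_logK; have /(admP _ (@ccM I J) (cc_neq0 I J))[_ ->] := aF I J.
Qed.

Lemma dbar_to_log omega I J v : (forall I J, smooth Om (fun x => omega x I J)) ->
  dfam (to_log (fun J x => omega x I J)) J v =
  (-1) ^+ #|I| * (frame J v * dbar omega (exp_chart v) I J).
Proof.
move=> so; rewrite dfam_to_log// /dbar [RHS]mulrCA; congr (_ * _).
by rewrite mulrA -expr2 sqrr_sign mul1r.
Qed.

(** On H^s x C^t the coefficient of dz_I dzbar_J is [kappa I J] divided by the product of Im w_j
    over the real places j in J. *)
Definition const_form (kappa : {set 'I_n} -> {set 'I_n} -> C) : cform R n :=
  fun x I J => of_log (fun J _ => kappa I J) J x.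

Definition harmonic p q (kappa : {set 'I_n} -> {set 'I_n} -> C) :=
  forall I J, kappa I J != 0 -> [/\ #|I|%:Z = p, #|J|%:Z = q & forall u, chi I J (val u) = rho u].

Lemma dfam_cst (kappa : {set 'I_n} -> C) J v : dfam (fun J _ => kappa J) J v = 0.
Proof. by rewrite /dfam big1// => j _; rewrite theta_cst mulr0. Qed.

Lemma dbar_const_form p q kappa omega x : is_form sigma rho p q omega -> Om x ->
  (forall I J v, to_log (fun J x => omega x I J) J v = kappa I J) -> dbar omega x = 0.
Proof.
move=> [so _ _] Ox E; apply/funext => I; apply/funext => J /=.
have := dbar_to_log I J (log_chart x) so; rewrite log_chartK//.
rewrite (_ : to_log _ = fun J _ => kappa I J); last by apply/funext => J'; apply/funext => v; exact: E.
rewrite dfam_cst => /esym/eqP; rewrite mulf_eq0 signr_eq0 mulf_eq0 (negbTE (frame_neq0 _ _)).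
by move=> /eqP.
Qed.

Lemma const_closed p q kappa : harmonic p q kappa ->
  closed_forms sigma rho p q (const_form kappa).
Proof.
move=> hk; have isf : is_form sigma rho p q (const_form kappa).
  apply: fam_form => [I J|I J v /hk[]//].
  have [->|k0] := eqVneq (kappa I J) 0; first exact: adm0.
  split=> [|b v _//|u v]; first by apply: smooth_cst; exact: openT.
  by have [_ _ /(_ u)/cc1 ->] := hk _ _ k0; rewrite mul1r.
split=> // x Ox; apply: (dbar_const_form (kappa := kappa) isf Ox) => I J v.
by rewrite -[LHS]/(to_log (of_log (fun J _ => kappa I J)) J v) of_logK.
Qed.

Lemma const_exact0 p q kappa : harmonic p q kappa ->
  exact_forms sigma rho p q (const_form kappa) -> forall I J, kappa I J = 0.
Proof.
move=> hk [eta feta E] I J; have [seta _ _] := feta.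
have aeta := form_fam I feta.
apply: (@hodge_unique _ _ _ _ _ _ ht hK hsigma hU (cc I) (@ccP I) (kappa I)
   (fun J v => (-1) ^+ #|I| * to_log (fun J x => eta x I J) J v)) => [/hk[_ _ h] u|J'|v].
- by apply/cc1.
- exact: adm_scale.
- rewrite dfam_scale => [|J']; last exact: (fam_adm_smooth J' aeta).
  rewrite dbar_to_log// mulrA -expr2 sqrr_sign mul1r -E; last exact: exp_chart_in.
  by rewrite -[RHS]/(to_log (of_log (fun J _ => kappa I J)) J v) of_logK.
Qed.

Lemma closed_harmonic p q omega : closed_forms sigma rho p q omega ->
  exists2 kappa, harmonic p q kappa &
    exact_forms sigma rho p q (omega - const_form kappa).
Proof.
move=> [fo co]; have [so deg _] := fo.
have /choice[kap /choice[et H]] I : exists (kappa : {set 'I_n} -> C) (eta : {set 'I_n} -> V -> C),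
  [/\ forall J, kappa J != 0 -> forall u, cc I J u = 1, fam_adm sigma (cc I) eta &
      forall J v, to_log (fun J x => omega x I J) J v = kappa J + dfam eta J v].
  apply: (hodge_exists ht hK hsigma hU (@ccP I) (cc_neq0 I) (@ccM I)); first exact: form_fam fo.
  by move=> J v; rewrite dbar_to_log// co ?mulr0//; exact: exp_chart_in.
(* The decomposition found for each I mixes all degrees. Since the differential raises the degree of
   J by one, cutting the constants to (p, q) and the primitive to (p, q - 1) keeps the identity. *)
pose dg I J : bool := (#|I|%:Z == p) && (#|J|%:Z == q).
pose dg' I J : bool := (#|I|%:Z == p) && (#|J|%:Z == q - 1).
pose kappa I J := if dg I J then kap I J else 0.
pose F I J v := if dg' I J then (-1) ^+ #|I| * et I J v else 0.
exists kappa.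
  move=> I J; rewrite /kappa; case: ifP => [/andP[/eqP h1 /eqP h2] k0|_]; last by rewrite eqxx.
  by split=> // u; apply/cc1; have [h _ _] := H I; exact: h.
have aF I : fam_adm sigma (cc I) (F I).
  move=> J; rewrite /F; case: (dg' I J); last exact: adm0.
  by apply: adm_scale; have [_ h _] := H I; exact: h.
have fF : is_form sigma rho p (q - 1) (fun x I J => of_log (F I) J x).
  apply: fam_form => // I J v; rewrite /F; case: ifP => [/andP[/eqP ? /eqP ?]//|_].
  by rewrite eqxx.
exists (fun x I J => of_log (F I) J x) => // x Ox; have [sF _ _] := fF.
apply/funext => I; apply/funext => J; apply: (mulfI (frame_neq0 J (log_chart x))).
have := dbar_to_log I J (log_chart x) sF; rewrite log_chartK//.
move=> /(congr1 (fun z => (-1) ^+ #|I| * z)); rewrite mulrA -expr2 sqrr_sign mul1r => <-.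
rewrite (_ : to_log _ = F I); last by apply/funext => J'; rewrite of_logK.
have [_ aet E] := H I; have := E J (log_chart x).
have -> : (omega - const_form kappa) x I J = omega x I J - const_form kappa x I J by [].
rewrite mulrBr -[frame J _ * const_form _ _ _ _]/(frame J (log_chart x) * (frame J (- log_chart x) * kappa I J)).
rewrite frameN mulrA mulfV ?frame_neq0// mul1r /to_log log_chartK// => E'.
case dIJ : (dg I J); rewrite /kappa dIJ; last first.
  have -> : omega x I J = 0.
    by apply: contraFeq dIJ => /(deg _ _ _ Ox)[h1 h2]; rewrite /dg h1 h2 !eqxx.
  rewrite mulr0 subr0 /dfam big1 ?mulr0// => j jJ.
  suff -> : F I (J :\ j)%SET = (fun=> 0) by rewrite theta_zero mulr0.
  apply/funext => v; rewrite /F ifF//; apply: contraFF dIJ => /andP[/eqP h1 /eqP h2].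
  rewrite /dg h1 eqxx (cardsD1 j) jJ PoszD h2; apply/eqP; lia.
rewrite E' [kap I J + _]addrC addrK.
transitivity ((-1) ^+ #|I| * dfam (fun J v => (-1) ^+ #|I| * et I J v) J (log_chart x)).
  rewrite dfam_scale => [|J']; last exact: (fam_adm_smooth J' aet).
  by rewrite mulrA -expr2 sqrr_sign mul1r.
congr (_ * _); apply: eq_bigr => j jJ; congr (_ * theta _ _ _).
apply/funext => v; rewrite /F ifT//; move: dIJ => /andP[/eqP h1 /eqP h2].
rewrite /dg' h1 eqxx/=; move: h2; rewrite (cardsD1 j) jJ PoszD => <-; by rewrite [X in X - 1]addrC addrK.
Qed.

Lemma dzbarD j f g x (a : C) : smooth Om f -> smooth Om g -> Om x ->
  dzbar j (fun y => a * f y + g y) x = a * dzbar j f x + dzbar j g x.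
Proof.
move=> Hf Hg Ox; have Haf := smooth_scale a openHsCt Hf.
rewrite /dzbar !(deriveCD _ Haf Hg Ox) !(deriveCZ a _ openHsCt Hf Ox).
move: (deriveC _ f x) (deriveC (0, _) f x) (deriveC _ g x) (deriveC (0, _) g x).
by move=> X Y X' Y'; ring.
Qed.

Lemma exact_linear p q a omega omega' : exact_forms sigma rho p q omega ->
  exact_forms sigma rho p q omega' -> exact_forms sigma rho p q (a *: omega + omega').
Proof.
move=> [e fe E] [e' fe' E']; have [s1 d1 q1] := fe; have [s2 d2 q2] := fe'.
exists (fun x I J => a * e x I J + e' x I J).
  split.
  - move=> I J; apply: smooth_add; [exact: openHsCt| |exact: s2].
    by apply: smooth_scale; [exact: openHsCt|exact: s1].
  - move=> x I J Ox; have [e0|/(d1 _ _ _ Ox)//] := eqVneq (e x I J) 0.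
    by rewrite e0 mulr0 add0r => /(d2 _ _ _ Ox).
  - move=> u b x I J bO Ox; rewrite !mulrDl -!(mulrA a) q1// q2// mulrDr; ring.
move=> x Ox; apply/funext => I; apply/funext => J.
have -> : (a *: omega + omega') x I J = a * omega x I J + omega' x I J by [].
rewrite E// E'// /dbar mulrCA -mulrDr; congr (_ * _); rewrite mulr_sumr -big_split/=.
apply: eq_bigr => j _; rewrite dzbarD//; ring.
Qed.

Lemma exact0 p q : exact_forms sigma rho p q 0.
Proof.
exists (fun x I J => of_log (fun J (v : V) => 0) J x).
  apply: (@fam_form p (q - 1) (fun _ _ _ => 0)) => [I J|I J v]; first exact: adm0.
  by rewrite eqxx.
move=> x Ox; have h0 : harmonic p q (fun _ _ => 0) by move=> I J; rewrite eqxx.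
by have [_ /(_ x Ox)/esym] := const_closed h0.
Qed.

End Forms.

(** * Dimensions *)

Section DimMod.
Context {R : realType} {V : lmodType R[i]}.
Local Notation C := R[i].

(** For the upper bound, m > N vectors have an m by N coefficient matrix modulo [B]; a non-zero row
    in its kernel is a relation among them modulo [B]. *)
Lemma dim_mod_basis (Z B : set V) (N : nat) (w : 'I_N -> V) :
  (forall i, Z (w i)) ->
  (forall c : 'I_N -> C, B (\sum_i c i *: w i) -> forall i, c i = 0) ->
  (forall z, Z z -> exists c : 'I_N -> C, B (z - \sum_i c i *: w i)) ->
  B 0 -> (forall a x y, B x -> B y -> B (a *: x + y)) ->
  dim_mod Z B = (N%:R)%:E.
Proof.
move=> Zw iw gw B0 BD; apply/eqP; rewrite eq_le; apply/andP; split; last first.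
  by apply: ereal_sup_ubound; exists N => //; exists w.
apply: ge_ereal_sup => _ [m [v [Zv iv]] <-]; rewrite lee_fin ler_nat leqNgt; apply/negP => Nm.
have /choice[a aP] i : exists c : 'I_N -> C, B (v i - \sum_j c j *: w j) by exact: gw.
pose A := \matrix_(i, j) a i j.
have kA0 : nz_row (kermx A) != 0.
  rewrite nz_row_eq0 -mxrank_eq0 mxrank_ker -lt0n subn_gt0.
  exact: leq_ltn_trans (rank_leq_col A) Nm.
pose u := nz_row (kermx A).
have uA : u *m A = 0 by apply/sub_kermxP; exact: nz_row_sub.
have Bsum (I : Type) (r : seq I) (c : I -> C) (x : I -> V) :
    (forall i, B (x i)) -> B (\sum_(i <- r) c i *: x i).
  move=> Bx; elim: r => [|i r IH]; first by rewrite big_nil.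
  by rewrite big_cons; apply: BD.
have /iv u0 : B (\sum_i u 0 i *: v i).
  have := Bsum _ (index_enum 'I_m) (fun i => u 0 i) _ aP.
  under eq_bigr do rewrite scalerBr scaler_sumr.
  rewrite sumrB exchange_big/= [X in _ - X]big1 ?subr0// => j _.
  under eq_bigr do rewrite scalerA.
  rewrite -scaler_suml; have := congr1 (fun M : 'rV_N => M 0 j) uA; rewrite !mxE => uAj.
  by rewrite (_ : \sum_i _ = 0) ?scale0r// -[RHS]uAj; apply: eq_bigr => i _; rewrite mxE.
by move/eqP: kA0; apply; apply/rowP => i; rewrite [RHS]mxE; exact: u0.
Qed.

End DimMod.

(** * Bases of exterior powers *)

Section ExteriorPowers.
Context {R : realType} {n : nat}.
Local Notation C := R[i].
Implicit Types (k : nat) (I J : {set 'I_n}) (p : int).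
Variable x0 : 'I_n.

Definition listing k I : {ffun 'I_k -> 'I_n} := [ffun a => nth x0 (enum I) (nat_of_ord a)].

Lemma listing_inj k I : #|I| = k -> injective (listing k I).
Proof.
move=> Ik a b; rewrite !ffunE => /eqP; rewrite nth_uniq ?enum_uniq -?cardE ?Ik//.
by move=> /eqP/val_inj.
Qed.

Lemma mem_listing k I a : #|I| = k -> listing k I a \in I.
Proof. by move=> Ik; rewrite ffunE -mem_enum mem_nth// -cardE Ik. Qed.

(** The antisymmetrisation of the tensor e_i1 x ... x e_ik over the increasing list of I, evaluated
    at the multi-index f. *)
Definition wedge k I (f : {ffun 'I_k -> 'I_n}) : C :=
  \det (\matrix_(a, b) (f a == listing k I b)%:R).

Definition antisym k (T : {ffun 'I_k -> 'I_n} -> C) := forall (f : {ffun 'I_k -> 'I_n}) (g : 'S_k),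
  T [ffun a => f (g a)] = (-1) ^+ (odd_perm g) * T f.

Lemma antisym_wedge k I : antisym (@wedge k I).
Proof.
move=> f g; rewrite /wedge -det_perm -det_mulmx -row_permE; congr (\det _).
by apply/matrixP => a b; rewrite !mxE ffunE.
Qed.

Lemma wedge_listing k I J : #|I| = k -> #|J| = k -> wedge I (listing k J) = (I == J)%:R.
Proof.
move=> Ik Jk; case: (eqVneq I J) => [->|IJ].
  rewrite -[RHS](det1 C k); congr (\det _); apply/matrixP => a b; rewrite !mxE.
  by rewrite (inj_eq (listing_inj Jk)).
have /subsetPn[x xJ xI] : ~~ (J \subset I).
  by apply: contra IJ => JI; rewrite eq_sym eqEcard JI Ik Jk leqnn.
have xk : (index x (enum J) < k)%N by rewrite -Jk cardE index_mem mem_enum.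
rewrite /wedge (expand_det_row _ (Ordinal xk)) big1// => b _.
rewrite !mxE ffunE/= nth_index ?mem_enum//.
case: eqP => [xE|_]; last by rewrite mul0r.
by have := mem_listing b Ik; rewrite -xE (negbTE xI).
Qed.

(** An injective multi-index is a permutation of the increasing list of its image; one with a
    repetition is fixed by a transposition, so the value of T there equals its own opposite. *)
Lemma antisym_eq0 k (T : {ffun 'I_k -> 'I_n} -> C) : antisym T ->
  (forall I, #|I| = k -> T (listing k I) = 0) -> forall f, T f = 0.
Proof.
move=> aT T0 f; case: (boolP (injectiveb f)) => [/injectiveP fi|].
  pose I := [set f a | a in 'I_k]%SET.
  have Ik : #|I| = k by rewrite card_imset// card_ord.
  have ex a : exists b, listing k I b == f a.
    have fI : f a \in enum I by rewrite mem_enum imset_f.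
    have bk : (index (f a) (enum I) < k)%N.
      by move: fI; rewrite -index_mem -cardE Ik.
    by exists (Ordinal bk); rewrite ffunE/= nth_index.
  pose g a := xchoose (ex a).
  have gE a : listing k I (g a) = f a by apply/eqP; exact: (xchooseP (ex a)).
  have gi : injective g by move=> a b gab; apply: fi; rewrite -!gE gab.
  have := aT (listing k I) (perm gi); rewrite T0// mulr0 => <-.
  by congr T; apply/ffunP => a; rewrite ffunE permE gE.
case/injectivePn => a [b ab fab].
have := aT f (tperm a b); rewrite odd_tperm ab expr1 mulN1r.
rewrite (_ : [ffun _ => _] = f); last first.
  by apply/ffunP => c; rewrite ffunE; case: tpermP => [->|->|].
by move=> /eqP; rewrite -addr_eq0 -mulr2n mulrn_eq0/= => /eqP.
Qed.

Lemma wedge_ext p I : #|I|%:Z = p -> ext_power R n p (@wedge `|p|%N I).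
Proof. by move=> Ip; split; [exact: antisym_wedge|rewrite -Ip ltNge]. Qed.

Lemma ext_expand p (T : {ffun 'I_(`|p|%N) -> 'I_n} -> C) f : ext_power R n p T ->
  T f = \sum_(I : {set 'I_n} | #|I|%:Z == p) T (listing `|p|%N I) * wedge I f.
Proof.
move=> [aT T0]; case: (ltP p 0) => p0.
  by rewrite T0//= big1// => I _; rewrite mul0r.
pose D f := T f - \sum_(I : {set 'I_n} | #|I|%:Z == p) T (listing `|p|%N I) * wedge I f.
have pE I : #|I|%:Z == p -> #|I| = `|p|%N by move=> /eqP <-.
apply/eqP; rewrite -subr_eq0; apply/eqP.
apply: (@antisym_eq0 _ D) f => [f g|J Jk].
  rewrite /D aT mulrBr mulr_sumr; congr (_ - _); apply: eq_bigr => I _.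
  by rewrite (@antisym_wedge _ I) mulrCA.
have Jp : #|J|%:Z == p by rewrite Jk gez0_abs.
rewrite /D (bigD1 J)//= wedge_listing// eqxx mulr1 big1 ?addr0 ?subrr// => I /andP[/pE Ik IJ].
by rewrite wedge_listing// (negbTE IJ) mulr0.
Qed.

Definition bidegree p q : {set {set 'I_n} * {set 'I_n}} :=
  [set IJ : {set 'I_n} * {set 'I_n} | (#|IJ.1|%:Z == p) && (#|IJ.2|%:Z == q)]%SET.

(** The products of two [wedge] tensors form a basis, and the coordinates of a tensor are its values
    at pairs of increasing lists. *)
Lemma vdim_tensor p q :
  vdim (tensor (ext_power R n p) (ext_power R n q)) = (#|bidegree p q|%:R)%:E.
Proof.
pose w (i : 'I_#|bidegree p q|) : {ffun 'I_(`|p|%N) -> 'I_n} * {ffun 'I_(`|q|%N) -> 'I_n} -> C :=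
  fun z => wedge (enum_val i).1 z.1 * wedge (enum_val i).2 z.2.
have dg (i : 'I_#|bidegree p q|) : #|(enum_val i).1|%:Z = p /\ #|(enum_val i).2|%:Z = q.
  by have := enum_valP i; rewrite inE => /andP[/eqP ? /eqP ?].
have sumE (c : 'I_#|bidegree p q| -> C) z : (\sum_i c i *: w i) z = \sum_i c i * w i z.
  by rewrite fct_sumE.
apply: (@dim_mod_basis _ _ _ _ _ w).
- move=> i; exists 1%N, (fun _ => @wedge `|p|%N (enum_val i).1), (fun _ => @wedge `|q|%N (enum_val i).2).
  split=> [_|z]; last by rewrite big_ord1.
  by have [h1 h2] := dg i; split; exact: wedge_ext.
- move=> c /= /(congr1 (fun h => h _)) E i.
  have := E (listing `|p|%N (enum_val i).1, listing `|q|%N (enum_val i).2).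
  rewrite sumE (bigD1 i)//= big1 => [|j ji].
    have [h1 h2] := dg i; have k1 := congr1 absz h1; have k2 := congr1 absz h2.
    by rewrite /w/= !wedge_listing// !eqxx !mulr1 addr0.
  have [h1 h2] := dg i; have k1 := congr1 absz h1; have k2 := congr1 absz h2.
  have [h3 h4] := dg j; have k3 := congr1 absz h3; have k4 := congr1 absz h4.
  rewrite /w/= !wedge_listing//; case: eqP => e1; last by rewrite mul0r mulr0.
  case: eqP => e2; last by rewrite !mulr0.
  case/eqP: ji; apply: enum_val_inj.
  by rewrite [enum_val j]surjective_pairing e1 e2 -surjective_pairing.
- move=> h [m [a [b [ab hE]]]].
  exists (fun i => h (listing `|p|%N (enum_val i).1, listing `|q|%N (enum_val i).2)).
  apply/eqP; rewrite subr_eq0; apply/eqP/funext => z; rewrite sumE.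
  transitivity (\sum_(IJ in bidegree p q)
      h (listing `|p|%N IJ.1, listing `|q|%N IJ.2) * (wedge IJ.1 z.1 * wedge IJ.2 z.2)); last first.
    by rewrite big_enum_val.
  under [RHS]eq_bigr do rewrite hE/= mulr_suml.
  rewrite exchange_big hE/=; apply: eq_bigr => i _; have [ai bi] := ab i.
  rewrite (ext_expand z.1 ai) (ext_expand z.2 bi) big_distrlr/= pair_big/=.
  apply: eq_big => [IJ|IJ _]; first by rewrite inE.
  by rewrite mulrACA.
- by [].
- by move=> a x y /= -> ->; rewrite scaler0 addr0.
Qed.

End ExteriorPowers.

(** * Counting pairs (I, J) by their characters *)

Section Count.
Context {R : realType} {s t : nat} {K : fieldExtType rat}.
Local Notation C := R[i].
Local Notation n := (s + t)%N.
Local Notation N := (s + t + t)%N.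
Variables (sigma : 'I_N -> {rmorphism K -> C}) (U : set K).
Hypotheses (ht : (0 < t)%N) (hK : \dim {: K} = N) (hsigma : is_enum_embeddings sigma).
Hypothesis hU : admissible sigma U.
Implicit Types (I J : {set 'I_n}) (p q : int) (rho : set_type U -> C).

Definition chiU (IJ : {set 'I_n} * {set 'I_n}) : set_type U -> C :=
  fun u => chi sigma IJ.1 IJ.2 (val u).

Lemma chiU_character IJ : characters R U (chiU IJ).
Proof.
split=> [u|u v w E]; first exact: (chi_neq0 hU).
by rewrite /chiU E chiM.
Qed.

Definition harmonic_types p q rho : {set {set 'I_n} * {set 'I_n}} :=
  [set IJ in bidegree p q | rho == chiU IJ]%SET.

(** The basis consists of constant forms with a single coefficient 1. Their combinations are again
    harmonic constant forms, for which exactness forces zero coefficients, and [closed_harmonic]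
    provides the spanning property. *)
Lemma dim_dolbeault_count p q rho : characters R U rho ->
  dim_dolbeault sigma p q rho = (#|harmonic_types p q rho|%:R)%:E.
Proof.
move=> rhoP; set X := harmonic_types p q rho.
pose kap (c : 'I_#|X| -> C) I J : C := \sum_i c i * ((I, J) == enum_val i)%:R.
have sumE (c : 'I_#|X| -> C) :
    \sum_i c i *: const_form (fun I J => ((I, J) == enum_val i)%:R) = const_form (kap c).
  apply/funext => x; apply/funext => I; apply/funext => J; rewrite !fct_sumE.
  rewrite [RHS]mulr_sumr; apply: eq_bigr => i _.
  by rewrite [LHS]mulrCA.
have XP IJ : IJ \in X -> [/\ #|IJ.1|%:Z = p, #|IJ.2|%:Z = q & rho = chiU IJ].
  by rewrite !inE => /andP[/andP[/eqP ? /eqP ?] /eqP].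
have hX IJ : IJ \in X -> harmonic sigma rho p q (fun I J => ((I, J) == IJ)%:R).
  move=> /XP[h1 h2 h3] I J; case: (eqVneq (I, J) IJ) => [E _|_]; last by rewrite eqxx.
  by rewrite -E in h1 h2 h3; split=> // u; rewrite h3.
have hkap c : harmonic sigma rho p q (kap c).
  move=> I J; case: (boolP ((I, J) \in X)) => [/XP[h1 h2 h3] _|IJX].
    by split=> // u; rewrite h3.
  rewrite /kap big1 ?eqxx// => i _; case: eqP => [E|_]; last by rewrite mulr0.
  by move: IJX; rewrite E enum_valP.
rewrite /dim_dolbeault; apply: (dim_mod_basis (w := fun i : 'I_#|X| =>
  const_form (fun I J => ((I, J) == enum_val i)%:R) : cform R n)).
- by move=> i; apply: (const_closed hsigma hU rhoP); apply: hX; exact: enum_valP.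
- move=> c; rewrite sumE => /(const_exact0 ht hK hsigma hU rhoP (hkap c)) k0 i.
  have := k0 (enum_val i).1 (enum_val i).2.
  rewrite /kap (bigD1 i)//= -surjective_pairing eqxx mulr1 big1 ?addr0// => j ji.
  by rewrite (inj_eq enum_val_inj) eq_sym (negbTE ji) mulr0.
- move=> omega /(closed_harmonic ht hK hsigma hU rhoP)[kappa hk ex].
  exists (fun i => kappa (enum_val i).1 (enum_val i).2); rewrite sumE.
  rewrite (_ : kap _ = kappa)//; apply/funext => I; apply/funext => J; rewrite /kap.
  case: (boolP ((I, J) \in X)) => IJX.
    rewrite (bigD1 (enum_rank_in IJX (I, J)))//= enum_rankK_in// eqxx mulr1 big1 ?addr0// => j ji.
    case: eqP => [E|_]; last by rewrite mulr0.
    by case/eqP: ji; apply: enum_val_inj; rewrite enum_rankK_in.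
  rewrite big1 => [|i _]; last first.
    case: eqP => [E|_]; last by rewrite mulr0.
    by move: IJX; rewrite E enum_valP.
  apply/esym/eqP; apply: contraNT IJX => /hk[h1 h2 h3].
  by rewrite !inE h1 h2 !eqxx/=; apply/eqP/funext => u; rewrite -h3.
- exact: (exact0 hsigma hU rhoP).
- by move=> a x y; exact: exact_linear.
Qed.

End Count.

Theorem theorem1p2 (R : realType) (s t : nat) (K : fieldExtType rat)
    (sigma : 'I_(s + t + t) -> {rmorphism K -> R[i]}) (U : set K)
    (hs : (0 < s)%N) (ht : (0 < t)%N)
    (hK : \dim {: K} = (s + t + t)%N)
    (hsigma : is_enum_embeddings sigma)
    (hU : admissible sigma U)
    (p q : int) :
  vdim (tensor (ext_power R (s + t) p) (ext_power R (s + t) q)) =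
  \esum_(rho in characters R U) dim_dolbeault sigma p q rho.
Proof.
have n0 : (0 < s + t)%N by rewrite addn_gt0 hs.
rewrite (vdim_tensor (Ordinal n0)).
(* All terms are non-negative, so the two sums can be exchanged; each pair (I, J) is then counted
   for one character only, namely [chiU sigma IJ]. *)
transitivity (\esum_(rho in characters R U) \sum_(IJ in bidegree p q)
    (if rho \in [set chiU (U := U) sigma IJ] then (1%:E : \bar R) else 0%E))%E; last first.
  apply: eq_esum => rho rhoP; rewrite (dim_dolbeault_count ht hK hsigma hU)//.
  rewrite -sum1_card natr_sum -sumEFin big_mkcond [RHS]big_mkcond/=.
  apply: eq_bigr => IJ _; rewrite [in RHS]inE.
  rewrite (_ : (rho \in _) = (rho == chiU sigma IJ)); last by apply/idP/eqP; rewrite inE.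
  by case: (IJ \in bidegree p q).
rewrite esum_sum => [|rho IJ _ _]; last by case: ifP.
rewrite -sum1_card natr_sum -sumEFin; apply: eq_bigr => IJ _.
rewrite -esum_mkcondr (_ : _ `&` _ = [set chiU sigma IJ]) ?esum_set1//.
apply/seteqP; split=> [_ [_ ->]//|_ ->]; split=> //.
exact: chiU_character.
Qed.
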